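(* The synchronous multiparty session subtyping $\leqslant$ is operationally precise, i.e. for any two session types ${\mathsf T}$ and ${\mathsf T}'$: ${\mathsf T} \leqslant {\mathsf T}'$ holds if and only if there are no process $P$, participant ${\sf p}$ and multiparty session $\mathcal M$ such that (1) $\vdash P : {\mathsf T}$, (2) for every process $Q$, $\vdash Q : {\mathsf T}'$ implies that the session ${\sf p}\lhd Q \mid \mathcal M$ is typable by some global type, and (3) the session ${\sf p}\lhd P \mid \mathcal M$ gets stuck.
   Context: Setting: a synchronous multiparty session calculus. Processes: $P ::= {\sf p}?\ell(x).P \mid {\sf p}!\ell(e).P \mid P + P \mid \mathtt{if}\ e\ \mathtt{then}\ P\ \mathtt{else}\ P \mid \mu X.P \mid X \mid \mathbf 0$ (recursion guarded, equi-recursive). Expressions are built from variables and values (naturals, integers, booleans) using $\mathtt{succ}$ (defined only on naturals), $\mathtt{neg}$ (on integers), $\neg$ (on booleans), $>$, and internal choice $e_1\oplus e_2$ (evaluates to the value of $e_1$ or of $e_2$). Multiparty sessions: $\mathcal M ::= {\sf p}\lhd P \mid \mathcal M \mid \mathcal M$, with the usual structural congruence (commutativity/associativity of $+$ and $\mid$, and ${\sf p}\lhd\mathbf 0 \mid \mathcal M \equiv \mathcal M$). Reduction: ${\sf p}\lhd \sum_{i\in I}{\sf q}?\ell_i(x).P_i \mid {\sf q}\lhd {\sf p}!\ell_j(e).Q \longrightarrow {\sf p}\lhd P_j\{v/x\} \mid {\sf q}\lhd Q$ if $j\in I$ and $e$ evaluates to $v$; ${\sf p}\lhd \mathtt{if}\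 e\ \mathtt{then}\ P\ \mathtt{else}\ Q$ reduces to ${\sf p}\lhd P$ (resp. ${\sf p}\lhd Q$) if $e$ evaluates to true (resp. false); closed under parallel contexts and structural congruence. A session $\mathcal M$ is stuck if $\mathcal M\not\equiv{\sf p}\lhd\mathbf 0$ and $\mathcal M$ has no reduction; $\mathcal M$ gets stuck if it reduces (in zero or more steps) to a stuck session. Types: sorts $S ::= \mathtt{nat}\mid\mathtt{int}\mid\mathtt{bool}$ with subsorting $\leq:$ the reflexive-transitive closure of $\mathtt{nat}\leq:\mathtt{int}$. Session types ${\mathsf T} ::= \bigwedge_{i\in I}{\sf p}?\ell_i(S_i).{\mathsf T}_i \mid \bigvee_{i\in I}{\sf q}!\ell_i(S_i).{\mathsf T}_i \mid \mu\mathbf t.{\mathsf T} \mid \mathbf t \mid \mathtt{end}$ (distinct labels, guarded recursion, equal up to regular trees). Subtyping $\leqslant$ is defined coinductively by: $\mathtt{end}\leqslant\mathtt{end}$; $\bigwedge_{i\in I\cup J}{\sf p}?\ell_i(S_i).{\mathsf T}_i \leqslant \bigwedge_{i\in I}{\sf p}?\ell_i(S'_i).{\mathsf T}'_i$ if for all $i\in I$, $S'_i\leq: S_i$ and ${\mathsf T}_i\leqslant{\mathsf T}'_i$; $\bigvee_{i\in I}{\sf p}!\ell_i(S_i).{\mathsf T}_i \leqslant \bigvee_{i\in I\cup J}{\sf p}!\ell_i(S'_i).{\mathsf T}'_i$ if for all $i\in I$, $S_i\leq: S'_i$ and ${\mathsf T}_i\leqslant{\mathsf T}'_i$. Processes are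 typed by session types (external choice of inputs gets an intersection of input types, output gets an output type, conditional gets the union of the branch types, $\mathbf 0$ gets $\mathtt{end}$, with a subsumption rule: if $\vdash P:{\mathsf T}$ and ${\mathsf T}\leqslant{\mathsf T}'$ then $\vdash P:{\mathsf T}'$). Global types ${\sf G} ::= {\sf p}\to{\sf q}:\{\ell_i(S_i).{\sf G}_i\}_{i\in I}\mid\mu\mathbf t.{\sf G}\mid\mathbf t\mid\mathtt{end}$, with (partial) projections ${\sf G}\upharpoonright{\sf r}$ onto participants. A session $\prod_{i\in I}{\sf p}_i\lhd P_i$ is typed by ${\sf G}$ if $\vdash P_i : {\sf G}\upharpoonright{\sf p}_i$ for all $i\in I$ and all participants of ${\sf G}$ are among the ${\sf p}_i$. Typed sessions never get stuck (safety). *)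

(* Defs.v *)
(* Bound names are de Bruijn indices: one index space for expression variables,
   one for process variables, one for type variables. *)
From Stdlib Require Import List ZArith Arith.
Import ListNotations.

Definition participant := nat.
Definition label := nat.

(** * Expressions *)

(* A natural number is a nonnegative integer, so a single constructor covers
   both kinds of numeric value. *)
Inductive value : Type :=
| VInt (z : Z)
| VBool (b : bool).

Inductive expr : Type :=
| EVar (n : nat)
| EVal (v : value)
| ESucc (e : expr)
| ENeg (e : expr)
| ENot (e : expr)
| EGt (e1 e2 : expr)
| EChoice (e1 e2 : expr).

Inductive eval : expr -> value -> Prop :=
| eval_val v : eval (EVal v) v
| eval_succ e z : eval e (VInt z) -> (0 <= z)%Z -> eval (ESucc e) (VInt (z + 1))
| eval_neg e z : eval e (VInt z) -> eval (ENeg e) (VInt (- z))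
| eval_not e b : eval e (VBool b) -> eval (ENot e) (VBool (negb b))
| eval_gt e1 e2 z1 z2 :
    eval e1 (VInt z1) -> eval e2 (VInt z2) ->
    eval (EGt e1 e2) (VBool (z2 <? z1)%Z)
| eval_choice_l e1 e2 v : eval e1 v -> eval (EChoice e1 e2) v
| eval_choice_r e1 e2 v : eval e2 v -> eval (EChoice e1 e2) v.

Fixpoint shift_expr (c : nat) (e : expr) : expr :=
  match e with
  | EVar n => EVar (if n <? c then n else S n)
  | EVal v => EVal v
  | ESucc e => ESucc (shift_expr c e)
  | ENeg e => ENeg (shift_expr c e)
  | ENot e => ENot (shift_expr c e)
  | EGt e1 e2 => EGt (shift_expr c e1) (shift_expr c e2)
  | EChoice e1 e2 => EChoice (shift_expr c e1) (shift_expr c e2)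
  end.

Fixpoint subst_expr (k : nat) (v : value) (e : expr) : expr :=
  match e with
  | EVar n => if n =? k then EVal v else EVar (if n <? k then n else n - 1)
  | EVal w => EVal w
  | ESucc e => ESucc (subst_expr k v e)
  | ENeg e => ENeg (subst_expr k v e)
  | ENot e => ENot (subst_expr k v e)
  | EGt e1 e2 => EGt (subst_expr k v e1) (subst_expr k v e2)
  | EChoice e1 e2 => EChoice (subst_expr k v e1) (subst_expr k v e2)
  end.

(** * Processes *)

(* [PIn q l P] binds expression variable 0 in [P]; [PRec P] binds process
   variable 0 in [P]. *)
Inductive proc : Type :=
| PIn (q : participant) (l : label) (P : proc)
| POut (q : participant) (l : label) (e : expr) (P : proc)
| PSum (P Q : proc)
| PIf (e : expr) (P Q : proc)
| PRec (P : proc)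
| PVar (n : nat)
| PEnd.

(* [shiftE]/[substE] act on expression variables, [shiftP]/[substP] on process
   variables. *)
Fixpoint shiftE (c : nat) (P : proc) : proc :=
  match P with
  | PIn q l P => PIn q l (shiftE (S c) P)
  | POut q l e P => POut q l (shift_expr c e) (shiftE c P)
  | PSum P Q => PSum (shiftE c P) (shiftE c Q)
  | PIf e P Q => PIf (shift_expr c e) (shiftE c P) (shiftE c Q)
  | PRec P => PRec (shiftE c P)
  | PVar n => PVar n
  | PEnd => PEnd
  end.

Fixpoint substE (k : nat) (v : value) (P : proc) : proc :=
  match P with
  | PIn q l P => PIn q l (substE (S k) v P)
  | POut q l e P => POut q l (subst_expr k v e) (substE k v P)
  | PSum P Q => PSum (substE k v P) (substE k v Q)
  | PIf e P Q => PIf (subst_expr k v e) (substE k v P) (substE k v Q)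
  | PRec P => PRec (substE k v P)
  | PVar n => PVar n
  | PEnd => PEnd
  end.

Fixpoint shiftP (c : nat) (P : proc) : proc :=
  match P with
  | PIn q l P => PIn q l (shiftP c P)
  | POut q l e P => POut q l e (shiftP c P)
  | PSum P Q => PSum (shiftP c P) (shiftP c Q)
  | PIf e P Q => PIf e (shiftP c P) (shiftP c Q)
  | PRec P => PRec (shiftP (S c) P)
  | PVar n => PVar (if n <? c then n else S n)
  | PEnd => PEnd
  end.

Fixpoint substP (k : nat) (R : proc) (P : proc) : proc :=
  match P with
  | PIn q l P => PIn q l (substP k (shiftE 0 R) P)
  | POut q l e P => POut q l e (substP k R P)
  | PSum P Q => PSum (substP k R P) (substP k R Q)
  | PIf e P Q => PIf e (substP k R P) (substP k R Q)
  | PRec P => PRec (substP (S k) (shiftP 0 R) P)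
  | PVar n => if n =? k then R else PVar (if n <? k then n else n - 1)
  | PEnd => PEnd
  end.

(* Process variable [n] occurs in [P] outside every input and output prefix. *)
Fixpoint exposedP (n : nat) (P : proc) : bool :=
  match P with
  | PIn _ _ _ | POut _ _ _ _ | PEnd => false
  | PSum P Q | PIf _ P Q => exposedP n P || exposedP n Q
  | PRec P => exposedP (S n) P
  | PVar m => m =? n
  end.

Fixpoint guardedP (P : proc) : Prop :=
  match P with
  | PIn _ _ P | POut _ _ _ P => guardedP P
  | PSum P Q | PIf _ P Q => guardedP P /\ guardedP Q
  | PRec P => exposedP 0 P = false /\ guardedP P
  | PVar _ | PEnd => True
  end.

(* [input_sum q P bs]: [P] is the external choice, over [(l, P')] in [bs], of
   the inputs [q?l(x).P']. *)
Inductive input_sum (q : participant) : proc -> list (label * proc) -> Prop :=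
| input_sum_one l P : input_sum q (PIn q l P) [(l, P)]
| input_sum_plus P1 P2 bs1 bs2 :
    input_sum q P1 bs1 -> input_sum q P2 bs2 ->
    input_sum q (PSum P1 P2) (bs1 ++ bs2).

Inductive proc_cong : proc -> proc -> Prop :=
| pc_unfold P : proc_cong (PRec P) (substP 0 (PRec P) P)
| pc_sumC P Q : proc_cong (PSum P Q) (PSum Q P)
| pc_sumA P Q R : proc_cong (PSum (PSum P Q) R) (PSum P (PSum Q R))
| pc_refl P : proc_cong P P
| pc_sym P Q : proc_cong P Q -> proc_cong Q P
| pc_trans P Q R : proc_cong P Q -> proc_cong Q R -> proc_cong P R
| pc_in q l P P' : proc_cong P P' -> proc_cong (PIn q l P) (PIn q l P')
| pc_out q l e P P' : proc_cong P P' -> proc_cong (POut q l e P) (POut q l e P')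
| pc_sum P P' Q Q' :
    proc_cong P P' -> proc_cong Q Q' -> proc_cong (PSum P Q) (PSum P' Q')
| pc_if e P P' Q Q' :
    proc_cong P P' -> proc_cong Q Q' -> proc_cong (PIf e P Q) (PIf e P' Q')
| pc_rec P P' : proc_cong P P' -> proc_cong (PRec P) (PRec P').

(** * Multiparty sessions *)

Inductive session : Type :=
| SProc (p : participant) (P : proc)
| SPar (M1 M2 : session).

Fixpoint parties (M : session) : list (participant * proc) :=
  match M with
  | SProc p P => [(p, P)]
  | SPar M1 M2 => parties M1 ++ parties M2
  end.

Fixpoint guardedS (M : session) : Prop :=
  match M with
  | SProc _ P => guardedP P
  | SPar M1 M2 => guardedS M1 /\ guardedS M2
  end.

Inductive session_cong : session -> session -> Prop :=
| sc_proc p P Q : proc_cong P Q -> session_cong (SProc p P) (SProc p Q)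
| sc_end p M : session_cong (SPar (SProc p PEnd) M) M
| sc_parC M1 M2 : session_cong (SPar M1 M2) (SPar M2 M1)
| sc_parA M1 M2 M3 :
    session_cong (SPar (SPar M1 M2) M3) (SPar M1 (SPar M2 M3))
| sc_refl M : session_cong M M
| sc_sym M1 M2 : session_cong M1 M2 -> session_cong M2 M1
| sc_trans M1 M2 M3 :
    session_cong M1 M2 -> session_cong M2 M3 -> session_cong M1 M3
| sc_par M1 M1' M2 M2' :
    session_cong M1 M1' -> session_cong M2 M2' ->
    session_cong (SPar M1 M2) (SPar M1' M2').

Inductive step : session -> session -> Prop :=
| step_comm p q P bs l P' e v Q :
    input_sum q P bs -> In (l, P') bs -> eval e v ->
    step (SPar (SProc p P) (SProc q (POut p l e Q)))
         (SPar (SProc p (substE 0 v P')) (SProc q Q))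
| step_if_true p e P Q :
    eval e (VBool true) -> step (SProc p (PIf e P Q)) (SProc p P)
| step_if_false p e P Q :
    eval e (VBool false) -> step (SProc p (PIf e P Q)) (SProc p Q)
| step_par M1 M1' M2 : step M1 M1' -> step (SPar M1 M2) (SPar M1' M2)
| step_cong M1 M1' M2 M2' :
    session_cong M1 M1' -> step M1' M2' -> session_cong M2' M2 -> step M1 M2.

Inductive steps : session -> session -> Prop :=
| steps_refl M : steps M M
| steps_step M1 M2 M3 : step M1 M2 -> steps M2 M3 -> steps M1 M3.

Definition stuck (M : session) : Prop :=
  ~ (exists p, session_cong M (SProc p PEnd)) /\ ~ (exists M', step M M').

Definition gets_stuck (M : session) : Prop :=
  exists M', steps M M' /\ stuck M'.

(** * Sorts and session types *)

Inductive sort : Type := SNat | SInt | SBool.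

Inductive subsort : sort -> sort -> Prop :=
| subsort_refl S : subsort S S
| subsort_nat_int : subsort SNat SInt.

(* [TIn q bs] is the intersection, over [(l, S, U)] in [bs], of [q?l(S).U];
   [TOut q bs] is the union of the [q!l(S).U]; [TRec U] binds type variable 0. *)
Inductive stype : Type :=
| TIn (q : participant) (bs : list (label * sort * stype))
| TOut (q : participant) (bs : list (label * sort * stype))
| TRec (T : stype)
| TVar (n : nat)
| TEnd.

Definition labels {A : Type} (bs : list (label * sort * A)) : list label :=
  map (fun b => fst (fst b)) bs.

Fixpoint shiftT (c : nat) (T : stype) : stype :=
  match T with
  | TIn q bs => TIn q (map (fun b => (fst b, shiftT c (snd b))) bs)
  | TOut q bs => TOut q (map (fun b => (fst b, shiftT c (snd b))) bs)
  | TRec T => TRec (shiftT (S c) T)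
  | TVar n => TVar (if n <? c then n else S n)
  | TEnd => TEnd
  end.

Fixpoint substT (k : nat) (U : stype) (T : stype) : stype :=
  match T with
  | TIn q bs => TIn q (map (fun b => (fst b, substT k U (snd b))) bs)
  | TOut q bs => TOut q (map (fun b => (fst b, substT k U (snd b))) bs)
  | TRec T => TRec (substT (S k) (shiftT 0 U) T)
  | TVar n => if n =? k then U else TVar (if n <? k then n else n - 1)
  | TEnd => TEnd
  end.

Fixpoint exposedT (n : nat) (T : stype) : bool :=
  match T with
  | TIn _ _ | TOut _ _ | TEnd => false
  | TRec T => exposedT (S n) T
  | TVar m => m =? n
  end.

(* [wfT k T]: recursion is guarded, branchings are nonempty with pairwise
   distinct labels, and every free type variable is below [k]. *)
Inductive wfT : nat -> stype -> Prop :=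
| wfT_in k q bs :
    bs <> [] -> NoDup (labels bs) -> (forall b, In b bs -> wfT k (snd b)) ->
    wfT k (TIn q bs)
| wfT_out k q bs :
    bs <> [] -> NoDup (labels bs) -> (forall b, In b bs -> wfT k (snd b)) ->
    wfT k (TOut q bs)
| wfT_rec k T : exposedT 0 T = false -> wfT (S k) T -> wfT k (TRec T)
| wfT_var k n : n < k -> wfT k (TVar n)
| wfT_end k : wfT k TEnd.

Definition session_type (T : stype) : Prop := wfT 0 T.

(* [headT T U]: [U] is the non-recursive type obtained by unfolding the
   outermost recursions of [T]; it exposes the root of the tree of [T]. *)
Inductive headT : stype -> stype -> Prop :=
| headT_in q bs : headT (TIn q bs) (TIn q bs)
| headT_out q bs : headT (TOut q bs) (TOut q bs)
| headT_end : headT TEnd TEnd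
| headT_rec T U : headT (substT 0 (TRec T) T) U -> headT (TRec T) U.

(* Equality of the (regular) trees; branches form an unordered family indexed
   by labels. *)
CoInductive eqT : stype -> stype -> Prop :=
| eqT_end T T' : headT T TEnd -> headT T' TEnd -> eqT T T'
| eqT_in T T' q bs bs' :
    headT T (TIn q bs) -> headT T' (TIn q bs') ->
    (forall l S U, In (l, S, U) bs ->
       exists U', In (l, S, U') bs' /\ eqT U U') ->
    (forall l S U', In (l, S, U') bs' ->
       exists U, In (l, S, U) bs /\ eqT U U') ->
    eqT T T'
| eqT_out T T' q bs bs' :
    headT T (TOut q bs) -> headT T' (TOut q bs') ->
    (forall l S U, In (l, S, U) bs ->
       exists U', In (l, S, U') bs' /\ eqT U U') ->
    (forall l S U', In (l, S, U') bs' ->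
       exists U, In (l, S, U) bs /\ eqT U U') ->
    eqT T T'.

CoInductive subtype : stype -> stype -> Prop :=
| sub_end T T' : headT T TEnd -> headT T' TEnd -> subtype T T'
| sub_in T T' q bs bs' :
    headT T (TIn q bs) -> headT T' (TIn q bs') ->
    (forall l S' U', In (l, S', U') bs' ->
       exists S U, In (l, S, U) bs /\ subsort S' S /\ subtype U U') ->
    subtype T T'
| sub_out T T' q bs bs' :
    headT T (TOut q bs) -> headT T' (TOut q bs') ->
    (forall l S U, In (l, S, U) bs ->
       exists S' U', In (l, S', U') bs' /\ subsort S S' /\ subtype U U') ->
    subtype T T'.

(* [bs] is the union of the families in [bss], up to tree equality.  When the
   labels of [bs] are distinct, this forces branches of [bss] with a common
   label to agree. *)
Definition branch_union (bss : list (list (label * sort * stype)))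
    (bs : list (label * sort * stype)) : Prop :=
  (forall l S U, In (l, S, U) bs ->
     exists cs U', In cs bss /\ In (l, S, U') cs /\ eqT U U') /\
  (forall cs l S U', In cs bss -> In (l, S, U') cs ->
     exists U, In (l, S, U) bs /\ eqT U U').

(* [T] is the union of [T1] and [T2]: it is defined when they are equal, and
   when they are unions of outputs to the same participant. *)
Inductive union_type (T1 T2 T : stype) : Prop :=
| union_same : eqT T1 T -> eqT T2 T -> union_type T1 T2 T
| union_out q bs1 bs2 bs :
    headT T1 (TOut q bs1) -> headT T2 (TOut q bs2) -> headT T (TOut q bs) ->
    branch_union [bs1; bs2] bs -> union_type T1 T2 T.

(** * Typing of expressions and processes *)

Inductive has_sort (G : list sort) : expr -> sort -> Prop :=
| hs_var n S : nth_error G n = Some S -> has_sort G (EVar n) S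
| hs_nat z : (0 <= z)%Z -> has_sort G (EVal (VInt z)) SNat
| hs_int z : has_sort G (EVal (VInt z)) SInt
| hs_bool b : has_sort G (EVal (VBool b)) SBool
| hs_succ e : has_sort G e SNat -> has_sort G (ESucc e) SNat
| hs_neg e : has_sort G e SInt -> has_sort G (ENeg e) SInt
| hs_not e : has_sort G e SBool -> has_sort G (ENot e) SBool
| hs_gt e1 e2 :
    has_sort G e1 SInt -> has_sort G e2 SInt -> has_sort G (EGt e1 e2) SBool
| hs_choice e1 e2 S :
    has_sort G e1 S -> has_sort G e2 S -> has_sort G (EChoice e1 e2) S
| hs_sub e S S' : has_sort G e S -> subsort S S' -> has_sort G e S'.

(* The context is split into the sorts of expression variables ([G]) and the
   types of process variables ([D]).  In [ht_in] the whole external choice is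
   typed at once: typing [P + Q] from subsumed types of [P] and [Q] would lose
   the labels forgotten by subsumption and be unsound. *)
Inductive has_type : list sort -> list stype -> proc -> stype -> Prop :=
| ht_in G D P q bs tbs :
    input_sum q P bs ->
    map fst bs = labels tbs -> NoDup (labels tbs) ->
    (forall l P' S U, In (l, P') bs -> In (l, S, U) tbs ->
       has_type (S :: G) D P' U) ->
    has_type G D P (TIn q tbs)
| ht_out G D q l e P S U :
    has_sort G e S -> has_type G D P U ->
    has_type G D (POut q l e P) (TOut q [(l, S, U)])
| ht_if G D e P1 P2 T1 T2 T :
    has_sort G e SBool -> has_type G D P1 T1 -> has_type G D P2 T2 ->
    session_type T -> union_type T1 T2 T ->
    has_type G D (PIf e P1 P2) T
| ht_rec G D P T :
    session_type T -> has_type G (T :: D) P T -> has_type G D (PRec P) T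
| ht_var G D n T : nth_error D n = Some T -> has_type G D (PVar n) T
| ht_end G D : has_type G D PEnd TEnd
| ht_sub G D P T T' :
    has_type G D P T -> session_type T' -> subtype T T' -> has_type G D P T'.

(** * Global types *)

Inductive gtype : Type :=
| GMsg (p q : participant) (bs : list (label * sort * gtype))
| GRec (G : gtype)
| GVar (n : nat)
| GEnd.

Fixpoint shiftG (c : nat) (G : gtype) : gtype :=
  match G with
  | GMsg p q bs => GMsg p q (map (fun b => (fst b, shiftG c (snd b))) bs)
  | GRec G => GRec (shiftG (S c) G)
  | GVar n => GVar (if n <? c then n else S n)
  | GEnd => GEnd
  end.

Fixpoint substG (k : nat) (H : gtype) (G : gtype) : gtype :=
  match G with
  | GMsg p q bs => GMsg p q (map (fun b => (fst b, substG k H (snd b))) bs)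
  | GRec G => GRec (substG (S k) (shiftG 0 H) G)
  | GVar n => if n =? k then H else GVar (if n <? k then n else n - 1)
  | GEnd => GEnd
  end.

Fixpoint exposedG (n : nat) (G : gtype) : bool :=
  match G with
  | GMsg _ _ _ | GEnd => false
  | GRec G => exposedG (S n) G
  | GVar m => m =? n
  end.

Inductive wfG : nat -> gtype -> Prop :=
| wfG_msg k p q bs :
    p <> q -> bs <> [] -> NoDup (labels bs) ->
    (forall b, In b bs -> wfG k (snd b)) ->
    wfG k (GMsg p q bs)
| wfG_rec k G : exposedG 0 G = false -> wfG (S k) G -> wfG k (GRec G)
| wfG_var k n : n < k -> wfG k (GVar n)
| wfG_end k : wfG k GEnd.

Definition global_type (G : gtype) : Prop := wfG 0 G.

Inductive headG : gtype -> gtype -> Prop :=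
| headG_msg p q bs : headG (GMsg p q bs) (GMsg p q bs)
| headG_end : headG GEnd GEnd
| headG_rec G H : headG (substG 0 (GRec G) G) H -> headG (GRec G) H.

(* [r] is a participant of (the tree of) [G]. *)
Inductive in_pt (r : participant) : gtype -> Prop :=
| in_pt_head G p q bs : headG G (GMsg p q bs) -> r = p \/ r = q -> in_pt r G
| in_pt_cont G p q bs b :
    headG G (GMsg p q bs) -> In b bs -> in_pt r (snd b) -> in_pt r G.

(* [T] is the merge of the projections [Ts] of the branches of a communication
   that does not involve the participant: either they all coincide, or they are
   inputs from the same sender and [T] is their intersection. *)
Inductive merge (Ts : list stype) (T : stype) : Prop :=
| merge_same : (forall U, In U Ts -> eqT U T) -> merge Ts T
| merge_in q bss bs :
    Forall2 (fun U cs => headT U (TIn q cs)) Ts bss ->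
    headT T (TIn q bs) -> branch_union bss bs -> merge Ts T.

(* [proj r G T]: the projection of [G] onto [r] is defined and equal to [T].
   It is read on trees, as are the types themselves. *)
CoInductive proj (r : participant) : gtype -> stype -> Prop :=
| proj_end G T : ~ in_pt r G -> headT T TEnd -> proj r G T
| proj_out G T q bs tbs :
    headG G (GMsg r q bs) -> headT T (TOut q tbs) ->
    map fst bs = map fst tbs ->
    (forall l S H U, In (l, S, H) bs -> In (l, S, U) tbs -> proj r H U) ->
    proj r G T
| proj_in G T p bs tbs :
    headG G (GMsg p r bs) -> headT T (TIn p tbs) ->
    map fst bs = map fst tbs ->
    (forall l S H U, In (l, S, H) bs -> In (l, S, U) tbs -> proj r H U) ->
    proj r G T
| proj_other G T p q bs tbs :
    headG G (GMsg p q bs) -> r <> p -> r <> q -> in_pt r G ->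
    map fst bs = map fst tbs ->
    (forall l S H U, In (l, S, H) bs -> In (l, S, U) tbs -> proj r H U) ->
    session_type T -> merge (map snd tbs) T ->
    proj r G T.

(** * Typing of sessions *)

(* A session is typed as a parallel composition of processes owned by pairwise
   distinct participants. *)
Definition typed_session (M : session) (G : gtype) : Prop :=
  global_type G /\
  NoDup (map fst (parties M)) /\
  (forall p P, In (p, P) (parties M) ->
     exists T, proj p G T /\ has_type [] [] P T) /\
  (forall r, in_pt r G -> In r (map fst (parties M))).

(* Main.v *)
Require Import Defs.
From Stdlib Require Import List ZArith Arith Lia Permutation SetoidPermutation.
From Stdlib Require Import Relations RelationClasses Bool Btauto.
From Stdlib Require SetoidList.
Import ListNotations.

Set Implicit Arguments.
Unset Strict Implicit.

(** Soundness.  If [T <= T'] then a process of type [T] also has type [T'] by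
    subsumption, so the session is typed and it suffices that typed sessions are
    safe.  The invariant of reduction is that every participant, up to structural
    congruence, follows a type that agrees with a common global tree.  When [a]
    sends to [b] below the root of the tree, the first node on every path that
    involves [a] or [b] is that very communication, so it can be removed.

    Completeness.  If [T <= T'] fails, this has an inductive witness: a path of
    common communications to a clash of heads, labels or sorts.  Participant
    [n], above all those of [T'], runs the characteristic process of [T]: it
    chooses outputs nondeterministically and tests the sort of each value that it
    receives.  Its partners run the characteristic processes of the projections
    of a global type whose projection on [n] is [T'], where after each
    communication with [n] the partner forwards the label to all the others.
    Following the path leads to a session in which [n] and its partner are blocked
    and everybody else waits for a label from that partner. *)

(** * De Bruijn calculus on processes *)

Ltac index_cases :=
  repeat match goal with
  | |- context [?a <? ?b] => destruct (Nat.ltb_spec a b)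
  | |- context [?a =? ?b] => destruct (Nat.eqb_spec a b)
  end; subst; try lia; try reflexivity; try (f_equal; lia).

Lemma shift_expr_shift_expr e : forall c d, c <= d ->
  shift_expr (S d) (shift_expr c e) = shift_expr c (shift_expr d e).
Proof.
  induction e; intros c d Hcd; simpl; try (f_equal; auto; fail).
  index_cases.
Qed.

Lemma subst_expr_shift_expr e : forall c k v, c <= k ->
  subst_expr (S k) v (shift_expr c e) = shift_expr c (subst_expr k v e).
Proof.
  induction e; intros c k w Hck; simpl; try (f_equal; auto; fail).
  index_cases; simpl; index_cases.
Qed.

Lemma shiftE_shiftE P : forall c d, c <= d ->
  shiftE (S d) (shiftE c P) = shiftE c (shiftE d P).
Proof.
  induction P; intros c d Hcd; simpl;
    rewrite ?shift_expr_shift_expr by lia; f_equal; auto with arith.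
Qed.

Lemma shiftE_shiftP P : forall c d, shiftE c (shiftP d P) = shiftP d (shiftE c P).
Proof. induction P; intros c d; simpl; f_equal; auto. Qed.

Lemma shiftP_shiftP P : forall c d, c <= d ->
  shiftP (S d) (shiftP c P) = shiftP c (shiftP d P).
Proof.
  induction P; intros c d Hcd; simpl; try (f_equal; auto with arith; fail).
  index_cases.
Qed.

Lemma shiftE_substP P : forall c k R,
  shiftE c (substP k R P) = substP k (shiftE c R) (shiftE c P).
Proof.
  induction P; intros c k R; simpl; try (f_equal; auto; fail).
  - rewrite IHP, shiftE_shiftE by lia. reflexivity.
  - rewrite IHP, shiftE_shiftP. reflexivity.
  - index_cases.
Qed.

Lemma shiftP_substP_le P : forall c k R, c <= k ->
  shiftP c (substP k R P) = substP (S k) (shiftP c R) (shiftP c P).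
Proof.
  induction P; intros c k R Hck; simpl; try (f_equal; auto; fail).
  - rewrite IHP, shiftE_shiftP by lia. reflexivity.
  - rewrite IHP, shiftP_shiftP by lia. reflexivity.
  - index_cases; simpl; index_cases.
Qed.

Lemma shiftP_substP_ge P : forall c k R, k <= c ->
  shiftP c (substP k R P) = substP k (shiftP c R) (shiftP (S c) P).
Proof.
  induction P; intros c k R Hck; simpl; try (f_equal; auto; fail).
  - rewrite IHP, shiftE_shiftP by lia. reflexivity.
  - rewrite IHP, shiftP_shiftP by lia. reflexivity.
  - index_cases; simpl; index_cases.
Qed.

Lemma substP_shiftP P : forall k R, substP k R (shiftP k P) = P.
Proof.
  induction P; intros k R; simpl; try (f_equal; auto; fail).
  index_cases.
Qed.

Lemma substP_substP P : forall i k R Q, i <= k ->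
  substP k R (substP i Q P) =
  substP i (substP k R Q) (substP (S k) (shiftP i R) P).
Proof.
  induction P; intros i k R Q' Hik; simpl; try (f_equal; auto; fail).
  - rewrite IHP, shiftE_substP, shiftE_shiftP by lia. reflexivity.
  - rewrite IHP, shiftP_substP_le, shiftP_shiftP by lia. reflexivity.
  - destruct (Nat.eqb_spec n i); [subst|].
    { simpl. index_cases. simpl. index_cases. }
    destruct (Nat.eqb_spec n (S k)); [subst|].
    { index_cases. simpl. index_cases. rewrite substP_shiftP. reflexivity. }
    index_cases; simpl; index_cases.
Qed.

Lemma substE_shiftE P : forall c k v, c <= k ->
  substE (S k) v (shiftE c P) = shiftE c (substE k v P).
Proof.
  induction P; intros c k v Hck; simpl;
    rewrite ?subst_expr_shift_expr by lia; f_equal; auto with arith.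
Qed.

Lemma substE_shiftP P : forall k v d, substE k v (shiftP d P) = shiftP d (substE k v P).
Proof. induction P; intros; simpl; f_equal; auto. Qed.

Lemma substE_substP P : forall k v i R,
  substE k v (substP i R P) = substP i (substE k v R) (substE k v P).
Proof.
  induction P; intros k v i R; simpl; try (f_equal; auto; fail).
  - rewrite IHP, substE_shiftE by lia. reflexivity.
  - rewrite IHP, substE_shiftP. reflexivity.
  - index_cases.
Qed.

(** * Guardedness *)

Lemma exposedP_shiftE P : forall c n, exposedP n (shiftE c P) = exposedP n P.
Proof. induction P; intros; simpl; rewrite ?IHP, ?IHP1, ?IHP2; auto. Qed.

Lemma exposedP_substE P : forall k v n, exposedP n (substE k v P) = exposedP n P.
Proof. induction P; intros; simpl; rewrite ?IHP, ?IHP1, ?IHP2; auto. Qed.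

Lemma exposedP_shiftP P : forall c n,
  exposedP (if n <? c then n else S n) (shiftP c P) = exposedP n P.
Proof.
  induction P as [| |P IHP Q IHQ|e P IHP Q IHQ|P IHP|m|]; intros c n; simpl;
    rewrite ?IHP, ?IHQ; auto.
  - rewrite <- (IHP (S c) (S n)). f_equal. index_cases.
  - index_cases.
Qed.

Lemma exposedP_shiftP_eq P : forall c, exposedP c (shiftP c P) = false.
Proof.
  induction P; intros c; simpl; rewrite ?IHP, ?IHP1, ?IHP2; auto.
  index_cases.
Qed.

Lemma exposedP_substP P : forall k R n,
  exposedP n (substP k R P) =
  exposedP (if n <? k then n else S n) P || (exposedP k P && exposedP n R).
Proof.
  induction P as [| |P IHP Q IHQ|e P IHP Q IHQ|P IHP|m|]; intros k R n; simpl; auto.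
  - rewrite IHP, IHQ. btauto.
  - rewrite IHP, IHQ. btauto.
  - rewrite IHP, (exposedP_shiftP R 0 n : exposedP (S n) _ = _). do 2 f_equal. index_cases.
  - destruct (Nat.eqb_spec m k); simpl; index_cases.
Qed.

Lemma guardedP_shiftE P : forall c, guardedP (shiftE c P) <-> guardedP P.
Proof.
  induction P; intros c; simpl; rewrite ?exposedP_shiftE, ?IHP, ?IHP1, ?IHP2; tauto.
Qed.

Lemma guardedP_substE P : forall k v, guardedP (substE k v P) <-> guardedP P.
Proof.
  induction P; intros k v; simpl; rewrite ?exposedP_substE, ?IHP, ?IHP1, ?IHP2; tauto.
Qed.

Lemma guardedP_shiftP P : forall c, guardedP (shiftP c P) <-> guardedP P.
Proof.
  induction P; intros c; simpl; rewrite ?IHP, ?IHP1, ?IHP2; try tauto.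
  rewrite (exposedP_shiftP P (S c) 0 : exposedP 0 _ = _). tauto.
Qed.

Lemma guardedP_substP P : forall k R,
  guardedP P -> guardedP R -> guardedP (substP k R P).
Proof.
  induction P as [| |P IHP Q IHQ|e P IHP Q IHQ|P IHP|m|]; intros k R HP HR;
    simpl in *; auto.
  - apply IHP; [|apply guardedP_shiftE]; auto.
  - destruct HP; auto.
  - destruct HP; auto.
  - destruct HP as [Hunexposed HP]. split.
    + rewrite exposedP_substP, exposedP_shiftP_eq. simpl.
      rewrite Hunexposed, andb_false_r. reflexivity.
    + apply IHP; [|apply guardedP_shiftP]; auto.
  - destruct (m =? k); simpl; auto.
Qed.

Lemma guardedP_substP_inv P : forall k R, guardedP (substP k R P) -> guardedP P.
Proof.
  induction P as [| |P IHP Q IHQ|e P IHP Q IHQ|P IHP|m|]; intros k R HP;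
    simpl in *; eauto.
  - destruct HP; eauto.
  - destruct HP; eauto.
  - destruct HP as [Hunexposed HP]. split; eauto.
    rewrite exposedP_substP in Hunexposed. apply orb_false_iff in Hunexposed. tauto.
Qed.

Lemma guardedP_substP_exposed P : forall k R,
  exposedP k P = true -> guardedP (substP k R P) -> guardedP R.
Proof.
  induction P as [| |P IHP Q IHQ|e P IHP Q IHQ|P IHP|m|]; intros k R Hexposed HP;
    simpl in *; try discriminate.
  - destruct HP. apply orb_true_iff in Hexposed. destruct Hexposed; eauto.
  - destruct HP. apply orb_true_iff in Hexposed. destruct Hexposed; eauto.
  - destruct HP. apply (guardedP_shiftP _ 0). eauto.
  - rewrite Hexposed in HP. exact HP.
Qed.

Lemma guardedP_unfold P :
  guardedP (PRec P) <-> guardedP (substP 0 (PRec P) P).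
Proof.
  split; intros HP.
  - apply guardedP_substP; [apply HP|exact HP].
  - destruct (exposedP 0 P) eqn:Hexposed.
    + eapply guardedP_substP_exposed; eauto.
    + split; [exact Hexposed|]. eapply guardedP_substP_inv; eauto.
Qed.

Lemma proc_cong_exposedP P Q : proc_cong P Q -> forall n, exposedP n P = exposedP n Q.
Proof.
  induction 1; intros n; simpl; try congruence.
  - rewrite exposedP_substP. simpl. btauto.
  - btauto.
  - btauto.
Qed.

Lemma proc_cong_guardedP P Q : proc_cong P Q -> (guardedP P <-> guardedP Q).
Proof.
  induction 1 as [P| | | | | | | | | |P P' Hcong IH]; simpl; try tauto.
  - apply guardedP_unfold.
  - rewrite (proc_cong_exposedP Hcong). tauto.
Qed.

(** * Structural congruence *)

#[global] Instance proc_cong_equivalence : Equivalence proc_cong.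
Proof. split; [exact pc_refl|exact pc_sym|exact pc_trans]. Qed.

#[global] Instance session_cong_equivalence : Equivalence session_cong.
Proof. split; [exact sc_refl|exact sc_sym|exact sc_trans]. Qed.

Section CongruenceOfSubstitution.

#[local] Hint Constructors proc_cong : core.

Lemma proc_cong_shiftE P Q : proc_cong P Q -> forall c, proc_cong (shiftE c P) (shiftE c Q).
Proof.
  induction 1; intros c; simpl; eauto.
  rewrite shiftE_substP. apply pc_unfold.
Qed.

Lemma proc_cong_shiftP P Q : proc_cong P Q -> forall c, proc_cong (shiftP c P) (shiftP c Q).
Proof.
  induction 1; intros c; simpl; eauto.
  rewrite shiftP_substP_ge by lia. apply pc_unfold.
Qed.

Lemma proc_cong_substE P Q :
  proc_cong P Q -> forall k v, proc_cong (substE k v P) (substE k v Q).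
Proof.
  induction 1; intros k v; simpl; eauto.
  rewrite substE_substP. apply pc_unfold.
Qed.

Lemma proc_cong_substP_body P Q :
  proc_cong P Q -> forall k R, proc_cong (substP k R P) (substP k R Q).
Proof.
  induction 1; intros k R'; simpl; eauto.
  rewrite substP_substP by lia. apply pc_unfold.
Qed.

Lemma proc_cong_substP_arg P : forall k R R',
  proc_cong R R' -> proc_cong (substP k R P) (substP k R' P).
Proof.
  induction P; intros k R R' HR; simpl; auto using proc_cong_shiftE, proc_cong_shiftP.
  destruct (n =? k); auto.
Qed.

Lemma proc_cong_substP P Q k R R' :
  proc_cong P Q -> proc_cong R R' -> proc_cong (substP k R P) (substP k R' Q).
Proof.
  intros HP HR. transitivity (substP k R Q).
  - apply proc_cong_substP_body; auto.
  - apply proc_cong_substP_arg; auto.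
Qed.

End CongruenceOfSubstitution.

(** * Summands of a process *)

Lemma PermutationA_in {A} (R : relation A) {HR : Equivalence R} l l' b :
  PermutationA R l l' -> In b l' -> exists a, In a l /\ R a b.
Proof.
  intros Hperm Hb.
  apply (SetoidList.In_InA HR), (PermutationA_equivlistA HR Hperm),
    SetoidList.InA_alt in Hb.
  destruct Hb as [a [Hab Ha]]. exists a. split; [exact Ha|symmetry; exact Hab].
Qed.

Lemma PermutationA_length {A} (R : relation A) l l' :
  PermutationA R l l' -> length l = length l'.
Proof. induction 1; simpl; congruence. Qed.

Lemma PermutationA_singleton_l {A} (R : relation A) {HR : Equivalence R} a l :
  PermutationA R [a] l -> exists b, l = [b] /\ R a b.
Proof.
  intros Hperm. pose proof (PermutationA_length Hperm) as Hlength.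
  destruct l as [|b [|? ?]]; try discriminate.
  exists b. split; [reflexivity|].
  destruct (PermutationA_in (b := b) Hperm) as [a' [[<-|[]] Hab]]; simpl; auto.
Qed.

Lemma PermutationA_map {A B} (RA : relation A) (RB : relation B)
    {HA : Equivalence RA} {HB : Equivalence RB} (f g : A -> B) l l' :
  (forall a b, In a l -> RA a b -> RB (f a) (g b)) ->
  PermutationA RA l l' -> PermutationA RB (map f l) (map g l').
Proof.
  intros Hfg Hperm. destruct (PermutationA_decompose HA Hperm) as [m [Hlm Hml']].
  apply permA_trans with (map f m).
  { apply (Permutation_PermutationA HB), Permutation_map, Hlm. }
  apply eqlistA_PermutationA.
  assert (Hm : forall a, In a m -> In a l).
  { intros a. apply Permutation_in. symmetry. exact Hlm. }
  clear Hlm Hperm. induction Hml'; simpl; constructor; auto using in_eq, in_cons.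
Qed.

Definition atom (P : proc) : Prop :=
  match P with PSum _ _ | PRec _ => False | _ => True end.

(* The summands are read after unfolding all recursions that are not under a
   prefix or a conditional. *)
Inductive summands : proc -> list proc -> Prop :=
| summands_atom P : atom P -> summands P [P]
| summands_sum P Q As Bs :
    summands P As -> summands Q Bs -> summands (PSum P Q) (As ++ Bs)
| summands_rec P As :
    summands (substP 0 (PRec P) P) As -> summands (PRec P) As.

Lemma summands_atom_inv P As : atom P -> summands P As -> As = [P].
Proof. intros Hatom Hsum. destruct Hsum; simpl in Hatom; tauto. Qed.

Lemma summands_sum_inv P Q As : summands (PSum P Q) As ->
  exists Ps Qs, As = Ps ++ Qs /\ summands P Ps /\ summands Q Qs.
Proof. intros Hsum. inversion Hsum; subst; [contradiction|eauto]. Qed.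

Lemma summands_rec_inv P As :
  summands (PRec P) As -> summands (substP 0 (PRec P) P) As.
Proof. intros Hsum. inversion Hsum; subst; [contradiction|auto]. Qed.

Lemma summands_functional P As Bs : summands P As -> summands P Bs -> As = Bs.
Proof.
  intros HAs. revert Bs. induction HAs as [P HP|P Q As As' HAs IH HAs' IH'|P As HAs IH];
    intros Bs HBs.
  - symmetry. apply summands_atom_inv; auto.
  - apply summands_sum_inv in HBs. destruct HBs as [Ps [Qs [-> [HPs HQs]]]].
    f_equal; auto.
  - apply IH, summands_rec_inv, HBs.
Qed.

Lemma summands_nonempty P As : summands P As -> As <> [].
Proof. induction 1 as [| P Q [|? ?] | ]; simpl; congruence. Qed.

Fixpoint unfold_size (P : proc) : nat :=
  match P with
  | PSum P Q => S (unfold_size P + unfold_size Q)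
  | PRec P => S (unfold_size P)
  | _ => 0
  end.

Lemma unfold_size_substP P : forall k R,
  exposedP k P = false -> unfold_size (substP k R P) = unfold_size P.
Proof.
  induction P as [| |P IHP Q IHQ| |P IHP|m|]; intros k R Hexposed; simpl in *; auto.
  - apply orb_false_iff in Hexposed. destruct Hexposed. rewrite IHP, IHQ; auto.
  - rewrite Hexposed. reflexivity.
Qed.

(* Well-founded because unfolding a guarded recursion removes a leading binder. *)
Lemma guardedP_ind (X : proc -> Prop) :
  (forall P, guardedP P -> atom P -> X P) ->
  (forall P Q, guardedP P -> guardedP Q -> X P -> X Q -> X (PSum P Q)) ->
  (forall P, guardedP (PRec P) -> X (substP 0 (PRec P) P) -> X (PRec P)) ->
  forall P, guardedP P -> X P.
Proof.
  intros Xatom Xsum Xrec P. induction P as [P IH] using (induction_ltof1 _ unfold_size).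
  unfold ltof in IH. intros HP. destruct P as [| |P Q| |P| |];
    try (apply Xatom; [exact HP|exact I]).
  - destruct HP as [HP HQ]. apply Xsum; auto; apply IH; auto; simpl; lia.
  - apply Xrec; [exact HP|]. apply IH; [|apply (proj1 (guardedP_unfold P)), HP].
    rewrite unfold_size_substP by apply HP. simpl. lia.
Qed.

Lemma guardedP_summands P : guardedP P -> exists As, summands P As.
Proof.
  induction 1 as [P HP Hatom|P Q HP HQ [As HAs] [Bs HBs]|P HP [As HAs]] using guardedP_ind.
  - exists [P]. constructor. exact Hatom.
  - exists (As ++ Bs). constructor; auto.
  - exists As. constructor. exact HAs.
Qed.

Lemma summands_exposedP P As n :
  summands P As -> In (PVar n) As -> exposedP n P = true.
Proof.
  induction 1 as [P HP|P Q As Bs HAs IHP HBs IHQ|P As HAs IH]; intros Hn.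
  - destruct Hn as [->|[]]. apply Nat.eqb_refl.
  - apply in_app_or in Hn. apply orb_true_iff. tauto.
  - apply IH in Hn. rewrite exposedP_substP in Hn. simpl in *.
    rewrite <- Hn. btauto.
Qed.

Lemma summands_substP P As k R :
  summands P As -> ~ In (PVar k) As -> summands (substP k R P) (map (substP k R) As).
Proof.
  intros Hsum. revert k R. induction Hsum as [P HP|P Q As Bs HAs IHP HBs IHQ|P As HAs IH];
    intros k R Hk.
  - apply (summands_atom (P := substP k R P)).
    destruct P; simpl in *; auto. destruct (Nat.eqb_spec n k); subst; simpl; tauto.
  - rewrite map_app. rewrite in_app_iff in Hk. constructor; auto.
  - constructor. specialize (IH k R Hk).
    rewrite substP_substP in IH by lia. exact IH.
Qed.

Lemma summands_rec_guarded P As : exposedP 0 P = false -> summands P As ->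
  ~ In (PVar 0) As /\ summands (PRec P) (map (substP 0 (PRec P)) As).
Proof.
  intros Hexposed HAs.
  assert (Hvar : ~ In (PVar 0) As).
  { intros Hvar. rewrite (summands_exposedP HAs Hvar) in Hexposed. discriminate. }
  split; [exact Hvar|]. apply summands_rec, summands_substP; auto.
Qed.

Section CongruenceOfSummands.

#[local] Hint Constructors proc_cong : core.

Inductive atom_cong : proc -> proc -> Prop :=
| ac_in q l P P' : proc_cong P P' -> atom_cong (PIn q l P) (PIn q l P')
| ac_out q l e P P' : proc_cong P P' -> atom_cong (POut q l e P) (POut q l e P')
| ac_if e P P' Q Q' :
    proc_cong P P' -> proc_cong Q Q' -> atom_cong (PIf e P Q) (PIf e P' Q')
| ac_sum P P' Q Q' :
    proc_cong P P' -> proc_cong Q Q' -> atom_cong (PSum P Q) (PSum P' Q')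
| ac_rec P P' : proc_cong P P' -> atom_cong (PRec P) (PRec P')
| ac_var n : atom_cong (PVar n) (PVar n)
| ac_end : atom_cong PEnd PEnd.

#[local] Hint Constructors atom_cong : core.

#[global] Instance atom_cong_equivalence : Equivalence atom_cong.
Proof.
  split.
  - intros P. destruct P; auto.
  - intros P Q HPQ. destruct HPQ; auto.
  - intros P Q R HPQ HQR. destruct HPQ; inversion HQR; subst; eauto.
Qed.

Lemma atom_cong_substP P Q k R R' :
  atom_cong P Q -> P <> PVar k -> proc_cong R R' ->
  atom_cong (substP k R P) (substP k R' Q).
Proof.
  intros HPQ Hk HR. destruct HPQ; simpl;
    try (constructor; auto using proc_cong_substP, proc_cong_shiftE, proc_cong_shiftP; fail).
  destruct (Nat.eqb_spec n k); [congruence|]. reflexivity.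
Qed.

Lemma atom_cong_summands P Q As Bs : atom P -> atom_cong P Q ->
  summands P As -> summands Q Bs -> PermutationA atom_cong As Bs.
Proof.
  intros HP HPQ HAs HBs. assert (HQ : atom Q) by (destruct HPQ; exact HP).
  rewrite (summands_atom_inv HP HAs), (summands_atom_inv HQ HBs).
  apply permA_skip; [exact HPQ|apply permA_nil].
Qed.

Lemma proc_cong_summands P Q As Bs :
  proc_cong P Q -> guardedP P -> summands P As -> summands Q Bs ->
  PermutationA atom_cong As Bs.
Proof.
  intros Hcong. revert As Bs.
  induction Hcong as [P|P Q|P Q R|P|P Q HPQ IH|P Q R HPQ IHPQ HQR IHQR|q l P P' HP _
      |q l e P P' HP _|P P' Q Q' HP IHP HQ IHQ|e P P' Q Q' HP _ HQ _|P P' HP IH];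
    intros As Bs HG HAs HBs.
  - apply summands_rec_inv in HAs. rewrite (summands_functional HAs HBs). reflexivity.
  - apply summands_sum_inv in HAs, HBs.
    destruct HAs as [Ps [Qs [-> [HPs HQs]]]], HBs as [Qs' [Ps' [-> [HQs' HPs']]]].
    rewrite (summands_functional HPs HPs'), (summands_functional HQs HQs').
    apply PermutationA_app_comm. typeclasses eauto.
  - assert (HPs : summands (PSum P (PSum Q R)) As); [|
      rewrite (summands_functional HPs HBs); reflexivity].
    apply summands_sum_inv in HAs. destruct HAs as [PQs [Rs [-> [HPQs HRs]]]].
    apply summands_sum_inv in HPQs. destruct HPQs as [Ps [Qs [-> [HPs HQs]]]].
    rewrite <- app_assoc. apply summands_sum; [|apply summands_sum]; assumption.
  - rewrite (summands_functional HAs HBs). reflexivity.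
  - symmetry. apply IH; auto. apply (proc_cong_guardedP HPQ); auto.
  - assert (HQ : guardedP Q) by (apply (proc_cong_guardedP HPQ); auto).
    destruct (guardedP_summands HQ) as [Cs HCs]. eapply permA_trans; eauto.
  - apply (atom_cong_summands (P := PIn q l P) (Q := PIn q l P')); simpl; auto.
  - apply (atom_cong_summands (P := POut q l e P) (Q := POut q l e P')); simpl; auto.
  - destruct HG. apply summands_sum_inv in HAs, HBs.
    destruct HAs as [Ps [Qs [-> [HPs HQs]]]], HBs as [Ps' [Qs' [-> [HPs' HQs']]]].
    apply PermutationA_app; [typeclasses eauto|auto|auto].
  - apply (atom_cong_summands (P := PIf e P Q) (Q := PIf e P' Q')); simpl; auto.
  - (* Guardedness keeps the recursion variable out of the summands of the bodies. *)
    assert (HG' : guardedP (PRec P')) by (apply (proc_cong_guardedP (P := PRec P)); auto).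
    destruct HG as [Hexposed HG], HG' as [Hexposed' HG'].
    destruct (guardedP_summands HG) as [Cs HCs], (guardedP_summands HG') as [Ds HDs].
    destruct (summands_rec_guarded Hexposed HCs) as [Hvar HAs'].
    destruct (summands_rec_guarded Hexposed' HDs) as [_ HBs'].
    rewrite (summands_functional HAs HAs'), (summands_functional HBs HBs').
    apply (PermutationA_map (RA := atom_cong) (RB := atom_cong)); [|auto].
    intros C D HC HCD. apply atom_cong_substP; [exact HCD|congruence|auto].
Qed.

Lemma proc_cong_summands_ex P Q As :
  proc_cong P Q -> guardedP P -> summands P As ->
  exists Bs, summands Q Bs /\ PermutationA atom_cong As Bs.
Proof.
  intros HPQ HP HAs.
  assert (HQ : guardedP Q) by (apply (proc_cong_guardedP HPQ); auto).
  destruct (guardedP_summands HQ) as [Bs HBs].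
  exists Bs. split; [exact HBs|]. eapply proc_cong_summands; eauto.
Qed.

Fixpoint big_join (op : proc -> proc -> proc) (Ps : list proc) : proc :=
  match Ps with
  | [] => PEnd
  | [P] => P
  | P :: Ps => op P (big_join op Ps)
  end.

Lemma big_join_cons op P Ps : Ps <> [] -> big_join op (P :: Ps) = op P (big_join op Ps).
Proof. destruct Ps; simpl; congruence. Qed.

Lemma big_join_ind (X : proc -> Prop) op Ps :
  (Ps = [] -> X PEnd) -> (forall P Q, X P -> X Q -> X (op P Q)) ->
  (forall P, In P Ps -> X P) -> X (big_join op Ps).
Proof.
  intros Xend Xop. induction Ps as [|P Ps IH]; intros XPs; [apply Xend; reflexivity|].
  destruct Ps as [|Q Ps]; [apply XPs, in_eq|].
  rewrite big_join_cons by discriminate. apply Xop; [apply XPs, in_eq|].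
  apply IH; [discriminate|]. intros R HR. apply XPs, in_cons, HR.
Qed.

Lemma big_join_map {B} (f : proc -> proc) op (g g' : B -> proc) bs :
  f PEnd = PEnd -> (forall P Q, f (op P Q) = op (f P) (f Q)) ->
  (forall b, In b bs -> f (g b) = g' b) ->
  f (big_join op (map g bs)) = big_join op (map g' bs).
Proof.
  intros f_end f_op. induction bs as [|b bs IH]; intros Hg; [exact f_end|].
  destruct bs as [|b' bs]; [apply Hg, in_eq|].
  cbn [map] in *. rewrite !(big_join_cons _ (_ b)) by discriminate.
  rewrite f_op, Hg, IH by auto using in_eq, in_cons. reflexivity.
Qed.

Definition big_sum : list proc -> proc := big_join PSum.

Lemma big_sum_app Ps Qs : Ps <> [] -> Qs <> [] ->
  proc_cong (big_sum (Ps ++ Qs)) (PSum (big_sum Ps) (big_sum Qs)).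
Proof.
  unfold big_sum. intros HPs HQs. induction Ps as [|P Ps IH]; [congruence|].
  destruct Ps as [|P' Ps]; cbn [app].
  - rewrite big_join_cons by auto. reflexivity.
  - rewrite (big_join_cons _ P (Ps := P' :: Ps ++ Qs)), (big_join_cons _ P (Ps := P' :: Ps))
      by discriminate.
    transitivity (PSum P (PSum (big_join PSum (P' :: Ps)) (big_join PSum Qs))); auto.
    apply pc_sum; auto. apply IH. discriminate.
Qed.

Lemma summands_big_sum P As : summands P As -> proc_cong P (big_sum As).
Proof.
  induction 1 as [P HP|P Q As Bs HAs IHP HBs IHQ|P As HAs IH]; [reflexivity| |eauto].
  transitivity (PSum (big_sum As) (big_sum Bs)); auto.
  symmetry. apply big_sum_app; eapply summands_nonempty; eauto.
Qed.

Definition in_branch (q : participant) (b : label * proc) : proc :=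
  PIn q (fst b) (snd b).

Lemma in_in_branch q q' l P bs :
  In (PIn q' l P) (map (in_branch q) bs) <-> q' = q /\ In (l, P) bs.
Proof.
  rewrite in_map_iff. split.
  - intros [[l' P'] [Hb Hbs]]. injection Hb as -> -> ->. auto.
  - intros [-> Hbs]. exists (l, P). auto.
Qed.

Lemma input_sum_summands q P bs :
  input_sum q P bs -> summands P (map (in_branch q) bs).
Proof.
  induction 1.
  - apply summands_atom. exact I.
  - rewrite map_app. constructor; auto.
Qed.

Lemma big_sum_input_sum q bs : bs <> [] ->
  input_sum q (big_sum (map (in_branch q) bs)) bs.
Proof.
  intros Hbs. induction bs as [|[l P] bs IH]; [congruence|].
  destruct bs as [|b bs]; [apply input_sum_one|].
  unfold big_sum. simpl map. rewrite big_join_cons by discriminate.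
  apply (input_sum_plus q _ _ [(l, P)] (b :: bs)); [apply input_sum_one|].
  apply IH. discriminate.
Qed.

Lemma input_sum_nonempty q P bs : input_sum q P bs -> bs <> [].
Proof. induction 1 as [|P Q [|? ?]]; simpl; congruence. Qed.

Lemma input_sum_guardedP q P bs l P' :
  input_sum q P bs -> guardedP P -> In (l, P') bs -> guardedP P'.
Proof.
  induction 1 as [l0 P|P Q bs cs HP IHP HQ IHQ]; simpl; intros HG HP'.
  - destruct HP' as [HP'|[]]. injection HP' as <- <-. auto.
  - destruct HG. apply in_app_or in HP'. destruct HP'; auto.
Qed.

Lemma PermutationA_in_branches q bs As :
  PermutationA atom_cong (map (in_branch q) bs) As ->
  exists cs, As = map (in_branch q) cs /\
    (forall l P, In (l, P) bs -> exists P', In (l, P') cs) /\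
    (forall l P', In (l, P') cs -> exists P, In (l, P) bs /\ proc_cong P P').
Proof.
  intros Hperm.
  assert (Hcs : exists cs, As = map (in_branch q) cs).
  { assert (HAs : forall A, In A As -> exists b, A = in_branch q b).
    { intros A HA. destruct (PermutationA_in Hperm HA) as [B [HB HBA]].
      apply in_map_iff in HB. destruct HB as [[l P] [<- _]].
      inversion HBA; subst. exists (l, P'). reflexivity. }
    clear Hperm. induction As as [|A As IH]; [exists []; reflexivity|].
    destruct IH as [cs ->]; [auto using in_cons|].
    destruct (HAs A) as [b ->]; [apply in_eq|]. exists (b :: cs). reflexivity. }
  destruct Hcs as [cs ->]. exists cs. split; [reflexivity|split].
  - intros l P HP. symmetry in Hperm.
    destruct (PermutationA_in (b := PIn q l P) Hperm) as [A [HA HAP]].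
    { apply in_in_branch. auto. }
    inversion HAP; subst. apply in_in_branch in HA. destruct HA. eauto.
  - intros l P' HP'.
    destruct (PermutationA_in (b := PIn q l P') Hperm) as [A [HA HAP]].
    { apply in_in_branch. auto. }
    inversion HAP; subst. apply in_in_branch in HA. destruct HA. eauto.
Qed.

(** * Terminated processes *)

Fixpoint ended (P : proc) : bool :=
  match P with
  | PEnd => true
  | PRec P => ended P
  | _ => false
  end.

Lemma ended_shiftP P : forall c, ended (shiftP c P) = ended P.
Proof. induction P; intros; simpl; auto. Qed.

Lemma ended_substP_ended P : forall k R, ended P = true -> ended (substP k R P) = true.
Proof. induction P; intros k R HP; simpl in *; auto; discriminate. Qed.

Lemma ended_substP_not_ended P : forall k R,
  ended R = false -> ended (substP k R P) = ended P.
Proof.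
  induction P; intros k R HR; simpl in *; auto.
  - apply IHP. rewrite ended_shiftP. auto.
  - destruct (n =? k); auto.
Qed.

Lemma proc_cong_ended P Q : proc_cong P Q -> ended P = ended Q.
Proof.
  induction 1 as [P| | | | | | | | | |]; simpl; try congruence.
  destruct (ended P) eqn:HP.
  - symmetry. apply ended_substP_ended, HP.
  - rewrite ended_substP_not_ended; auto.
Qed.

Lemma ended_proc_cong P : ended P = true <-> proc_cong P PEnd.
Proof.
  split.
  - induction P; simpl; intros HP; try discriminate; auto.
    transitivity (PRec PEnd); [auto|]. apply (pc_unfold PEnd).
  - intros HP. rewrite (proc_cong_ended HP). reflexivity.
Qed.

End CongruenceOfSummands.

(** * Labelled branches *)

Lemma NoDup_map_inj {A B} (f : A -> B) l x y :
  NoDup (map f l) -> In x l -> In y l -> f x = f y -> x = y.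
Proof.
  induction l as [|a l IH]; simpl; intros Hnodup Hx Hy Hxy; [contradiction|].
  apply NoDup_cons_iff in Hnodup. destruct Hnodup as [Ha Hnodup].
  destruct Hx as [->|Hx], Hy as [->|Hy]; auto; exfalso; apply Ha.
  - rewrite Hxy. apply in_map, Hy.
  - rewrite <- Hxy. apply in_map, Hx.
Qed.

Lemma labels_functional {A} (bs : list (label * sort * A)) l S S' U U' :
  NoDup (labels bs) -> In (l, S, U) bs -> In (l, S', U') bs -> S = S' /\ U = U'.
Proof.
  intros Hnodup HU HU'.
  pose proof (NoDup_map_inj Hnodup HU HU' eq_refl) as Heq.
  injection Heq. auto.
Qed.

Lemma in_labels {A} (bs : list (label * sort * A)) l :
  In l (labels bs) <-> exists S U, In (l, S, U) bs.
Proof.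
  unfold labels. rewrite in_map_iff. split.
  - intros [[[l' S] U] [<- HU]]. eauto.
  - intros [S [U HU]]. exists (l, S, U). auto.
Qed.

Lemma in_map_fst {A B} (bs : list (A * B)) a : In a (map fst bs) <-> exists b, In (a, b) bs.
Proof.
  rewrite in_map_iff. split.
  - intros [[a' b] [<- Hb]]. eauto.
  - intros [b Hb]. exists (a, b). auto.
Qed.

Definition map_cont {A B} (f : label -> A -> B) (bs : list (label * sort * A)) :
    list (label * sort * B) :=
  map (fun b => (fst b, f (fst (fst b)) (snd b))) bs.

Lemma in_map_cont {A B} (f : label -> A -> B) bs l S V :
  In (l, S, V) (map_cont f bs) <-> exists U, In (l, S, U) bs /\ V = f l U.
Proof.
  unfold map_cont. rewrite in_map_iff. split.
  - intros [[[l' S'] U] [Hb HU]]. injection Hb as -> -> <-. eauto.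
  - intros [U [HU ->]]. exists (l, S, U). auto.
Qed.

Lemma map_fst_map_cont {A B} (f : label -> A -> B) bs :
  map fst (map_cont f bs) = map fst bs.
Proof. unfold map_cont. rewrite map_map. reflexivity. Qed.

Lemma labels_map_cont {A B} (f : label -> A -> B) bs : labels (map_cont f bs) = labels bs.
Proof. unfold labels, map_cont. rewrite map_map. reflexivity. Qed.

Lemma map_cont_id {A} (f : label -> A -> A) bs :
  (forall b, In b bs -> f (fst (fst b)) (snd b) = snd b) -> map_cont f bs = bs.
Proof.
  intros Hf. rewrite <- (map_id bs) at 2. apply map_ext_in.
  intros b Hb. rewrite (Hf _ Hb). symmetry. apply surjective_pairing.
Qed.

Lemma map_cont_ext_in {A B} (f g : label -> A -> B) bs :
  (forall b, In b bs -> f (fst (fst b)) (snd b) = g (fst (fst b)) (snd b)) ->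
  map_cont f bs = map_cont g bs.
Proof. intros Hfg. apply map_ext_in. intros b Hb. rewrite (Hfg _ Hb). reflexivity. Qed.

Lemma map_cont_map_cont {A B C} (g : label -> B -> C) (f : label -> A -> B) bs :
  map_cont g (map_cont f bs) = map_cont (fun l U => g l (f l U)) bs.
Proof. unfold map_cont. rewrite map_map. reflexivity. Qed.

(** * Session types *)

Lemma stype_nested_ind (X : stype -> Prop) :
  (forall q bs, (forall b, In b bs -> X (snd b)) -> X (TIn q bs)) ->
  (forall q bs, (forall b, In b bs -> X (snd b)) -> X (TOut q bs)) ->
  (forall T, X T -> X (TRec T)) -> (forall n, X (TVar n)) -> X TEnd -> forall T, X T.
Proof.
  intros Xin Xout Xrec Xvar Xend. fix IH 1.
  assert (IHbs : forall bs (b : label * sort * stype), In b bs -> X (snd b)).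
  { induction bs as [|b bs IHbs]; intros b' Hb'; [destruct Hb'|].
    destruct Hb' as [<-|Hb']; [apply IH|apply IHbs, Hb']. }
  intros [q bs|q bs|T|n|].
  - apply Xin, IHbs.
  - apply Xout, IHbs.
  - apply Xrec, IH.
  - apply Xvar.
  - apply Xend.
Qed.

Definition wf_branches (k : nat) (bs : list (label * sort * stype)) : Prop :=
  bs <> [] /\ NoDup (labels bs) /\ forall b, In b bs -> wfT k (snd b).

Lemma wfT_in_iff k q bs : wfT k (TIn q bs) <-> wf_branches k bs.
Proof.
  split.
  - intros HT. inversion HT. repeat split; assumption.
  - intros [Hne [Hnodup Hwf]]. constructor; assumption.
Qed.

Lemma wfT_out_iff k q bs : wfT k (TOut q bs) <-> wf_branches k bs.
Proof.
  split.
  - intros HT. inversion HT. repeat split; assumption.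
  - intros [Hne [Hnodup Hwf]]. constructor; assumption.
Qed.

Lemma wf_branches_cont k bs l S U : wf_branches k bs -> In (l, S, U) bs -> wfT k U.
Proof. intros [_ [_ Hwf]] HU. exact (Hwf _ HU). Qed.

Lemma wf_branches_ex k bs : wf_branches k bs -> exists l S U, In (l, S, U) bs.
Proof.
  intros [Hne _]. destruct bs as [|[[l S] U] bs]; [congruence|].
  exists l, S, U. apply in_eq.
Qed.

Lemma wf_branches_map_cont m k (f : label -> stype -> stype) bs :
  wf_branches m bs -> (forall b, In b bs -> wfT k (f (fst (fst b)) (snd b))) ->
  wf_branches k (map_cont f bs).
Proof.
  intros [Hne [Hnodup _]] Hf. split; [|split].
  - destruct bs; simpl; congruence.
  - rewrite labels_map_cont. exact Hnodup.
  - intros b Hb. apply in_map_iff in Hb. destruct Hb as [b' [<- Hb']]. apply Hf, Hb'.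
Qed.

Lemma wf_branches_single k l S U : wfT k U -> wf_branches k [(l, S, U)].
Proof.
  intros HU. split; [discriminate|split].
  - repeat constructor. intros [].
  - intros b [<-|[]]. exact HU.
Qed.

Lemma shiftT_closed k T : wfT k T -> forall c, k <= c -> shiftT c T = T.
Proof.
  induction 1 as [k q bs Hne Hnodup Hwf IH|k q bs Hne Hnodup Hwf IH|k T Hexp HT IH|k n Hn|k];
    intros c Hc; simpl.
  - f_equal. apply (map_cont_id (f := fun _ => shiftT c)). auto.
  - f_equal. apply (map_cont_id (f := fun _ => shiftT c)). auto.
  - rewrite IH by lia. reflexivity.
  - index_cases.
  - reflexivity.
Qed.

Lemma substT_closed k T : wfT k T -> forall c U, k <= c -> substT c U T = T.
Proof.
  induction 1 as [k q bs Hne Hnodup Hwf IH|k q bs Hne Hnodup Hwf IH|k T Hexp HT IH|k n Hn|k];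
    intros c U Hc; simpl.
  - f_equal. apply (map_cont_id (f := fun _ => substT c U)). auto.
  - f_equal. apply (map_cont_id (f := fun _ => substT c U)). auto.
  - rewrite IH by lia. reflexivity.
  - index_cases.
  - reflexivity.
Qed.

Lemma wfT_weaken k T : wfT k T -> forall m, k <= m -> wfT m T.
Proof. induction 1; intros m Hm; constructor; auto with arith. lia. Qed.

Lemma exposedT_closed k T : wfT k T -> forall n, k <= n -> exposedT n T = false.
Proof. induction 1; intros m Hm; simpl; auto with arith. index_cases. Qed.

Lemma exposedT_substT_lt T : forall k U j, session_type U -> j < k ->
  exposedT j (substT k U T) = exposedT j T.
Proof.
  induction T as [| |T IH|n|] using stype_nested_ind; intros k U j HU Hj; simpl; auto.
  - rewrite (shiftT_closed HU) by lia. apply IH; auto with arith.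
  - destruct (Nat.eqb_spec n k); subst.
    + rewrite (exposedT_closed HU) by lia. index_cases.
    + simpl. index_cases.
Qed.

Lemma wfT_substT k U T : wfT (S k) T -> session_type U -> wfT k (substT k U T).
Proof.
  intros HT HU. remember (S k) as m eqn:Hm. revert k Hm.
  induction HT as [m q bs Hne Hnodup Hwf IH|m q bs Hne Hnodup Hwf IH|m T Hexp HT IH|m n Hn|m];
    intros k ->; simpl.
  - apply wfT_in_iff, (wf_branches_map_cont (m := S k) (f := fun _ => substT k U)); auto.
    repeat split; auto.
  - apply wfT_out_iff, (wf_branches_map_cont (m := S k) (f := fun _ => substT k U)); auto.
    repeat split; auto.
  - rewrite (shiftT_closed HU) by lia. constructor; auto.
    rewrite exposedT_substT_lt; auto with arith.
  - destruct (Nat.eqb_spec n k); subst.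
    + apply (wfT_weaken HU). lia.
    + constructor. index_cases.
  - constructor.
Qed.

Lemma session_type_unfold T :
  session_type (TRec T) -> session_type (substT 0 (TRec T) T).
Proof. intros HT. inversion HT; subst. apply wfT_substT; assumption. Qed.

Lemma headT_functional T U V : headT T U -> headT T V -> U = V.
Proof.
  intros HU. revert V. induction HU; intros V HV; inversion HV; subst; auto.
Qed.

Ltac same_head :=
  match goal with
  | HU : headT ?T ?U, HV : headT ?T ?V |- _ =>
      let Heq := fresh in
      pose proof (headT_functional HU HV) as Heq;
      first [discriminate Heq
            |injection Heq as <- <-; clear HV
            |injection Heq as <-; clear HV
            |injection Heq as ->; clear HU
            |clear Heq HV]
  end.

Lemma headT_session_type T U : headT T U -> session_type T -> session_type U.
Proof.
  induction 1 as [| | |T U HU IH]; auto. intros HT. apply IH, session_type_unfold, HT.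
Qed.

Lemma headT_in_wf T q bs : session_type T -> headT T (TIn q bs) -> wf_branches 0 bs.
Proof. intros HT Hhead. eapply wfT_in_iff, headT_session_type; eauto. Qed.

Lemma headT_out_wf T q bs : session_type T -> headT T (TOut q bs) -> wf_branches 0 bs.
Proof. intros HT Hhead. eapply wfT_out_iff, headT_session_type; eauto. Qed.

Fixpoint leading_recs (T : stype) : nat :=
  match T with TRec T => S (leading_recs T) | _ => 0 end.

Lemma leading_recs_substT T : forall k U,
  exposedT k T = false -> leading_recs (substT k U T) = leading_recs T.
Proof.
  induction T as [| |T IH|n|] using stype_nested_ind; intros k U Hexp; simpl in *; auto.
  rewrite Hexp. reflexivity.
Qed.

Inductive head_view (T : stype) : Prop :=
| head_view_in q bs : headT T (TIn q bs) -> wf_branches 0 bs -> head_view T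
| head_view_out q bs : headT T (TOut q bs) -> wf_branches 0 bs -> head_view T
| head_view_end : headT T TEnd -> head_view T.

Lemma session_type_head_view T : session_type T -> head_view T.
Proof.
  remember (leading_recs T) as m eqn:Hm. revert T Hm.
  induction m as [m IH] using lt_wf_ind. intros [q bs|q bs|T|n|] -> HT.
  - apply head_view_in with q bs; [constructor|apply (wfT_in_iff 0 q), HT].
  - apply head_view_out with q bs; [constructor|apply (wfT_out_iff 0 q), HT].
  - inversion HT as [| |k T' Hexp HT'| |]; subst.
    destruct (IH (leading_recs T)) with (T := substT 0 (TRec T) T)
      as [q bs Hhead|q bs Hhead|Hhead];
      auto using session_type_unfold, eq_sym, leading_recs_substT.
    + apply head_view_in with q bs; [constructor|]; assumption.
    + apply head_view_out with q bs; [constructor|]; assumption.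
    + apply head_view_end. constructor. assumption.
  - inversion HT. lia.
  - apply head_view_end. constructor.
Qed.

(** * Subtyping *)

Lemma eqT_refl T : session_type T -> eqT T T.
Proof.
  revert T. cofix CH. intros T HT.
  destruct (session_type_head_view HT) as [q bs Hhead Hbs|q bs Hhead Hbs|Hhead].
  - apply eqT_in with q bs bs; auto; intros l S U HU; exists U; split; auto;
      apply CH, (wf_branches_cont Hbs HU).
  - apply eqT_out with q bs bs; auto; intros l S U HU; exists U; split; auto;
      apply CH, (wf_branches_cont Hbs HU).
  - apply eqT_end; auto.
Qed.

Lemma eqT_sym T U : eqT T U -> eqT U T.
Proof.
  revert T U. cofix CH. intros T U HTU.
  destruct HTU as [T U HT HU|T U q bs cs HT HU Hbs Hcs|T U q bs cs HT HU Hbs Hcs].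
  - apply eqT_end; auto.
  - apply eqT_in with q cs bs; auto; intros l S V HV.
    + destruct (Hcs l S V HV) as [W [HW HWV]]. exists W. auto.
    + destruct (Hbs l S V HV) as [W [HW HVW]]. exists W. auto.
  - apply eqT_out with q cs bs; auto; intros l S V HV.
    + destruct (Hcs l S V HV) as [W [HW HWV]]. exists W. auto.
    + destruct (Hbs l S V HV) as [W [HW HVW]]. exists W. auto.
Qed.

Lemma eqT_subtype T U : eqT T U -> subtype T U.
Proof.
  revert T U. cofix CH. intros T U HTU.
  destruct HTU as [T U HT HU|T U q bs cs HT HU Hbs Hcs|T U q bs cs HT HU Hbs Hcs].
  - apply sub_end; auto.
  - apply sub_in with q bs cs; auto. intros l S V HV.
    destruct (Hcs l S V HV) as [W [HW HWV]].
    exists S, W. split; [exact HW|]. split; [constructor|]. apply CH, HWV.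
  - apply sub_out with q bs cs; auto. intros l S V HV.
    destruct (Hbs l S V HV) as [W [HW HVW]].
    exists S, W. split; [exact HW|]. split; [constructor|]. apply CH, HVW.
Qed.

Lemma subtype_refl T : session_type T -> subtype T T.
Proof. intros HT. apply eqT_subtype, eqT_refl, HT. Qed.

Lemma subsort_trans S1 S2 S3 : subsort S1 S2 -> subsort S2 S3 -> subsort S1 S3.
Proof. intros H12 H23. destruct H12; inversion H23; subst; constructor. Qed.

Lemma subsort_dec S S' : {subsort S S'} + {~ subsort S S'}.
Proof.
  destruct S, S'; try (left; constructor; fail); right; intros HSS; inversion HSS.
Qed.

Lemma subtype_trans T U V : subtype T U -> subtype U V -> subtype T V.
Proof.
  revert T U V. cofix CH. intros T U V HTU HUV.
  destruct HTU as [T U HT HU|T U q bs cs HT HU Hbs|T U q bs cs HT HU Hbs];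
    destruct HUV as [U V HU' HV|U V q' cs' ds HU' HV Hcs|U V q' cs' ds HU' HV Hcs];
    pose proof (headT_functional HU HU') as Heq; try discriminate Heq.
  - apply sub_end; auto.
  - injection Heq as <- <-. apply sub_in with q bs ds; auto.
    intros l S3 V3 HV3. destruct (Hcs l S3 V3 HV3) as [S2 [V2 [HV2 [H32 HV23]]]].
    destruct (Hbs l S2 V2 HV2) as [S1 [V1 [HV1 [H21 HV12]]]].
    exists S1, V1. split; [exact HV1|]. split; [exact (subsort_trans H32 H21)|].
    exact (CH _ _ _ HV12 HV23).
  - injection Heq as <- <-. apply sub_out with q bs ds; auto.
    intros l S1 V1 HV1. destruct (Hbs l S1 V1 HV1) as [S2 [V2 [HV2 [H12 HV12]]]].
    destruct (Hcs l S2 V2 HV2) as [S3 [V3 [HV3 [H23 HV23]]]].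
    exists S3, V3. split; [exact HV3|]. split; [exact (subsort_trans H12 H23)|].
    exact (CH _ _ _ HV12 HV23).
Qed.

Lemma subtype_unfold T : session_type (TRec T) -> subtype (substT 0 (TRec T) T) (TRec T).
Proof.
  intros HT. pose proof (subtype_refl HT) as Hrefl.
  inversion Hrefl as [U V HU HV|U V q bs cs HU HV Hbs|U V q bs cs HU HV Hbs]; subst;
    inversion HU; subst.
  - apply sub_end; auto.
  - apply sub_in with q bs cs; auto.
  - apply sub_out with q bs cs; auto.
Qed.

Lemma union_type_subtype T1 T2 T :
  union_type T1 T2 T -> subtype T1 T /\ subtype T2 T.
Proof.
  intros [HT1 HT2|q bs1 bs2 bs HT1 HT2 HT [_ Hbs]]; [auto using eqT_subtype|].
  assert (Hbss : forall T' cs, headT T' (TOut q cs) -> In cs [bs1; bs2] -> subtype T' T).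
  { intros T' cs HT' Hcs. apply sub_out with q cs bs; auto. intros l S U HU.
    destruct (Hbs cs l S U Hcs HU) as [V [HV HVU]].
    exists S, V. split; [exact HV|]. split; [constructor|].
    apply eqT_subtype, eqT_sym, HVU. }
  split; eapply Hbss; eauto using in_eq, in_cons.
Qed.

Lemma Forall2_in_l {A B} (R : A -> B -> Prop) l l' a :
  Forall2 R l l' -> In a l -> exists b, In b l' /\ R a b.
Proof.
  induction 1 as [|a' b l l' Hab Hl IH]; intros Ha; [destruct Ha|].
  destruct Ha as [->|Ha].
  - exists b. split; [apply in_eq|exact Hab].
  - destruct (IH Ha) as [b' [Hb' Hab']]. exists b'. split; [apply in_cons|]; assumption.
Qed.

Lemma merge_subtype Ts T U : merge Ts T -> In U Ts -> subtype T U.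
Proof.
  intros [Hsame|q bss bs Hheads HT [_ Hbs]] HU.
  - apply eqT_subtype, eqT_sym, Hsame, HU.
  - destruct (Forall2_in_l Hheads HU) as [cs [Hcs HU']].
    apply sub_in with q bs cs; auto. intros l S V HV.
    destruct (Hbs cs l S V Hcs HV) as [W [HW HWV]].
    exists S, W. split; [exact HW|]. split; [constructor|]. apply eqT_subtype, HWV.
Qed.

(** * Typing of expressions *)

Definition value_sort (v : value) (S : sort) : Prop :=
  match S, v with
  | SNat, VInt z => (0 <= z)%Z
  | SInt, VInt _ | SBool, VBool _ => True
  | _, _ => False
  end.

Lemma value_sort_subsort v S S' : value_sort v S -> subsort S S' -> value_sort v S'.
Proof. intros Hv HS. destruct HS; auto. destruct v; simpl in *; tauto. Qed.

Lemma value_sort_has_sort G v S : value_sort v S -> has_sort G (EVal v) S.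
Proof. destruct S, v; simpl; intros Hv; try tauto; constructor; auto. Qed.

Lemma nth_error_middle {A} (l l' : list A) a : nth_error (l ++ a :: l') (length l) = Some a.
Proof. rewrite nth_error_app2, Nat.sub_diag by lia. reflexivity. Qed.

Lemma nth_error_insert {A} (l l' : list A) a n :
  nth_error (l ++ a :: l') (if n <? length l then n else S n) = nth_error (l ++ l') n.
Proof.
  destruct (Nat.ltb_spec n (length l)).
  - rewrite !nth_error_app1 by lia. reflexivity.
  - rewrite !nth_error_app2, Nat.sub_succ_l by lia. reflexivity.
Qed.

Lemma nth_error_remove {A} (l l' : list A) a n : n <> length l ->
  nth_error (l ++ l') (if n <? length l then n else n - 1) = nth_error (l ++ a :: l') n.
Proof.
  intros Hn. rewrite <- (nth_error_insert l l' a). f_equal. index_cases.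
Qed.

Lemma has_sort_shift G1 G2 S0 e S : has_sort (G1 ++ G2) e S ->
  has_sort (G1 ++ S0 :: G2) (shift_expr (length G1) e) S.
Proof.
  induction 1; simpl; try (econstructor; eauto; fail).
  constructor. rewrite nth_error_insert. assumption.
Qed.

Lemma has_sort_subst G1 G2 S0 v e S : value_sort v S0 -> has_sort (G1 ++ S0 :: G2) e S ->
  has_sort (G1 ++ G2) (subst_expr (length G1) v e) S.
Proof.
  intros Hv He. induction He as [n S Hn| | | | | | | | |]; simpl;
    try (econstructor; eauto; fail).
  destruct (Nat.eqb_spec n (length G1)) as [->|Hne].
  - rewrite nth_error_middle in Hn. injection Hn as ->.
    apply value_sort_has_sort, Hv.
  - constructor. rewrite (nth_error_remove (l := G1) G2 S0) by exact Hne. exact Hn.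
Qed.

Lemma eval_sort e S v : has_sort [] e S -> eval e v -> value_sort v S.
Proof.
  intros He. revert v. induction He; intros w Hw; try (inversion Hw; subst; simpl; auto; fail).
  - inversion Hw; subst. simpl. lia.
  - eauto using value_sort_subsort.
Qed.

Lemma eval_exists e S : has_sort [] e S -> exists v, eval e v.
Proof.
  induction 1 as [n S Hn|z Hz|z|b|e He IH|e He IH|e He IH|e1 e2 He1 IH1 He2 IH2
    |e1 e2 S He1 IH1 He2 IH2| ]; try (eexists; constructor; fail).
  - destruct n; discriminate.
  - destruct IH as [[z|b] Hv]; pose proof (eval_sort He Hv);
      [eexists; constructor; eauto|contradiction].
  - destruct IH as [[z|b] Hv]; pose proof (eval_sort He Hv);
      [eexists; constructor; eauto|contradiction].
  - destruct IH as [[z|b] Hv]; pose proof (eval_sort He Hv);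
      [contradiction|eexists; constructor; eauto].
  - destruct IH1 as [[z1|b] Hv1]; pose proof (eval_sort He1 Hv1);
      [|contradiction].
    destruct IH2 as [[z2|b] Hv2]; pose proof (eval_sort He2 Hv2);
      [eexists; constructor; eauto|contradiction].
  - destruct IH1 as [v Hv]. exists v. apply eval_choice_l, Hv.
  - auto.
Qed.

Lemma eval_bool_exists e : has_sort [] e SBool -> exists b, eval e (VBool b).
Proof.
  intros He. destruct (eval_exists He) as [[z|b] Hv];
    pose proof (eval_sort He Hv); [contradiction|eauto].
Qed.

(** * Typing of processes *)

Lemma input_sum_map (f g : proc -> proc) q P bs :
  (forall q l P, f (PIn q l P) = PIn q l (g P)) ->
  (forall P Q, f (PSum P Q) = PSum (f P) (f Q)) ->
  input_sum q P bs -> input_sum q (f P) (map (fun b => (fst b, g (snd b))) bs).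
Proof.
  intros f_in f_sum. induction 1.
  - rewrite f_in. constructor.
  - rewrite f_sum, map_app. constructor; auto.
Qed.

Lemma has_type_in_map (f g : proc -> proc) G D P q bs tbs :
  (forall q l P, f (PIn q l P) = PIn q l (g P)) ->
  (forall P Q, f (PSum P Q) = PSum (f P) (f Q)) ->
  input_sum q P bs -> map fst bs = labels tbs -> NoDup (labels tbs) ->
  (forall l P' S U, In (l, P') bs -> In (l, S, U) tbs ->
     has_type (S :: G) D (g P') U) ->
  has_type G D (f P) (TIn q tbs).
Proof.
  intros f_in f_sum Hsum Hlabels Hnodup Hbs. eapply ht_in.
  - apply (input_sum_map (f := f) (g := g)); eauto.
  - rewrite map_map. exact Hlabels.
  - exact Hnodup.
  - intros l P' S U HP' HU. apply in_map_iff in HP'. destruct HP' as [[l' P0] [Hb HP0]].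
    injection Hb as -> <-. eapply Hbs; eauto.
Qed.

Lemma has_type_shiftE G1 G2 S0 D P T : has_type (G1 ++ G2) D P T ->
  has_type (G1 ++ S0 :: G2) D (shiftE (length G1) P) T.
Proof.
  intros HP. remember (G1 ++ G2) as G eqn:HG. revert G1 HG.
  induction HP as [G D P q bs tbs Hsum Hlabels Hnodup Hbs IH| | | | | |];
    intros G1 ->; simpl; try (econstructor; eauto using has_sort_shift; fail).
  apply (has_type_in_map (f := shiftE (length G1)) (g := shiftE (S (length G1)))) with bs;
    auto.
  intros l P' S U HP' HU. exact (IH l P' S U HP' HU (S :: G1) eq_refl).
Qed.

Lemma has_type_substE G1 G2 S0 v D P T : value_sort v S0 ->
  has_type (G1 ++ S0 :: G2) D P T -> has_type (G1 ++ G2) D (substE (length G1) v P) T.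
Proof.
  intros Hv HP. remember (G1 ++ S0 :: G2) as G eqn:HG. revert G1 HG.
  induction HP as [G D P q bs tbs Hsum Hlabels Hnodup Hbs IH| | | | | |];
    intros G1 ->; simpl; try (econstructor; eauto using has_sort_subst; fail).
  apply (has_type_in_map (f := substE (length G1) v) (g := substE (S (length G1)) v)) with bs;
    auto.
  intros l P' S U HP' HU. exact (IH l P' S U HP' HU (S :: G1) eq_refl).
Qed.

Lemma has_type_shiftP G D1 D2 T0 P T : has_type G (D1 ++ D2) P T ->
  has_type G (D1 ++ T0 :: D2) (shiftP (length D1) P) T.
Proof.
  intros HP. remember (D1 ++ D2) as D eqn:HD. revert D1 HD.
  induction HP as [G D P q bs tbs Hsum Hlabels Hnodup Hbs IH| | |G D P T HT HP IH| | |];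
    intros D1 ->; simpl; try (econstructor; eauto; fail).
  - apply (has_type_in_map (f := shiftP (length D1)) (g := shiftP (length D1))) with bs; auto.
    intros l P' S U HP' HU. eauto.
  - apply ht_rec; auto. apply (IH (T :: D1)). reflexivity.
  - constructor. rewrite nth_error_insert. assumption.
Qed.

Lemma has_type_substP G D1 D2 T0 R P T :
  has_type G (D1 ++ D2) R T0 -> has_type G (D1 ++ T0 :: D2) P T ->
  has_type G (D1 ++ D2) (substP (length D1) R P) T.
Proof.
  intros HR HP. remember (D1 ++ T0 :: D2) as D eqn:HD. revert D1 R HD HR.
  induction HP as [G D P q bs tbs Hsum Hlabels Hnodup Hbs IH| | |G D P T HT HP IH
    |G D n T Hn| |]; intros D1 R -> HR; simpl; try (econstructor; eauto; fail).
  - apply (has_type_in_map (f := substP (length D1) R) (g := substP (length D1) (shiftE 0 R)))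
      with bs; auto.
    intros l P' S U HP' HU. apply (IH l P' S U HP' HU D1); auto.
    apply (has_type_shiftE (G1 := [])), HR.
  - apply ht_rec; auto. apply (IH (T :: D1)); auto. apply (has_type_shiftP (D1 := [])), HR.
  - destruct (Nat.eqb_spec n (length D1)) as [->|Hne].
    + rewrite nth_error_middle in Hn. injection Hn as ->. exact HR.
    + constructor. rewrite (nth_error_remove (l := D1) D2 T0) by exact Hne. exact Hn.
Qed.

Lemma input_sum_branch_ex q P bs (tbs : list (label * sort * stype)) l S U :
  input_sum q P bs -> map fst bs = labels tbs -> In (l, S, U) tbs ->
  exists P', In (l, P') bs.
Proof.
  intros Hsum Hlabels HU. apply in_map_fst. rewrite Hlabels. apply in_labels. eauto.
Qed.

Lemma has_type_session_type G D P T :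
  has_type G D P T -> Forall session_type D -> session_type T.
Proof.
  induction 1 as [G D P q bs tbs Hsum Hlabels Hnodup Hbs IH
    |G D q l e P S U He HP IH| | |G D n T Hn| |]; intros HD; auto.
  - apply wfT_in_iff. split; [|split; [exact Hnodup|]].
    + intros ->. apply input_sum_nonempty in Hsum. destruct bs; simpl in *; congruence.
    + intros [[l S] U] HU.
      destruct (input_sum_branch_ex Hsum Hlabels HU) as [P' HP'].
      exact (IH _ _ _ _ HP' HU HD).
  - apply wfT_out_iff, wf_branches_single, IH, HD.
  - apply nth_error_In in Hn. rewrite Forall_forall in HD. auto.
  - constructor.
Qed.

(* The continuations are related by a parameter [X], which is first [well_typed]
   and then its closure [cong_typed]. *)
Inductive typed_head (X : proc -> stype -> Prop) : list proc -> stype -> Prop :=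
| th_if e P1 P2 T :
    (exists b, eval e (VBool b)) -> X P1 T -> X P2 T ->
    typed_head X [PIf e P1 P2] T
| th_end T : headT T TEnd -> typed_head X [PEnd] T
| th_out q l e Q T tbs S U :
    headT T (TOut q tbs) -> In (l, S, U) tbs ->
    (exists v, eval e v) -> (forall v, eval e v -> value_sort v S) ->
    X Q U -> typed_head X [POut q l e Q] T
| th_in q bs T tbs :
    bs <> [] -> headT T (TIn q tbs) ->
    (forall l S U, In (l, S, U) tbs -> exists P, In (l, P) bs) ->
    (forall l S U P v, In (l, S, U) tbs -> In (l, P) bs -> value_sort v S ->
       X (substE 0 v P) U) ->
    typed_head X (map (in_branch q) bs) T.

Lemma typed_head_subtype (X : proc -> stype -> Prop) As T T' :
  (forall P U U', X P U -> session_type U' -> subtype U U' -> X P U') ->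
  typed_head X As T -> session_type T' -> subtype T T' -> typed_head X As T'.
Proof.
  intros Xsub HAs HT' HTT'.
  destruct HAs as [e P1 P2 T Hb HP1 HP2|T HT|q l e Q T tbs S U HT HU Hev Hsort HQ
    |q bs T tbs Hbs HT Hex Hcont].
  - apply th_if; eauto.
  - destruct HTT' as [T T' HT0 HT0'|T T' q bs bs' HT0 HT0' _|T T' q bs bs' HT0 HT0' _];
      same_head.
    apply th_end; auto.
  - destruct HTT' as [T T' HT0 HT0'|T T' q0 bs bs' HT0 HT0' _
      |T T' q0 bs tbs' HT0 HT0' Hsub]; same_head.
    destruct (Hsub _ _ _ HU) as [S' [U' [HU' [HSS' HUU']]]].
    eapply th_out; eauto using value_sort_subsort.
    eapply Xsub; eauto. apply (wf_branches_cont (bs := tbs') (l := l) (S := S')); auto.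
    exact (headT_out_wf HT' HT0').
  - destruct HTT' as [T T' HT0 HT0'|T T' q0 cs tbs' HT0 HT0' Hsub
      |T T' q0 cs cs' HT0 HT0' _]; same_head.
    apply th_in with tbs'; auto.
    + intros l S' U' HU'. destruct (Hsub _ _ _ HU') as [S [U [HU _]]]. eauto.
    + intros l S' U' P v HU' HP Hv.
      destruct (Hsub _ _ _ HU') as [S [U [HU [HS'S HUU']]]].
      apply Xsub with U; eauto using value_sort_subsort.
      exact (wf_branches_cont (headT_in_wf HT' HT0') HU').
Qed.

Definition well_typed (P : proc) (T : stype) : Prop := guardedP P /\ has_type [] [] P T.

Lemma well_typed_in_head q P bs tbs :
  input_sum q P bs -> map fst bs = labels tbs -> guardedP P ->
  (forall l P' S U, In (l, P') bs -> In (l, S, U) tbs -> has_type [S] [] P' U) ->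
  typed_head well_typed (map (in_branch q) bs) (TIn q tbs).
Proof.
  intros Hsum Hlabels HP Hbs.
  apply th_in with tbs; [eapply input_sum_nonempty; eauto|constructor| |].
  - intros l S U HU. eapply input_sum_branch_ex; eauto.
  - intros l S U P' v HU HP' Hv. split.
    + apply guardedP_substE. eapply input_sum_guardedP; eauto.
    + apply (has_type_substE (G1 := []) (S0 := S)); eauto.
Qed.

Lemma well_typed_head P T :
  well_typed P T -> exists As, summands P As /\ typed_head well_typed As T.
Proof.
  intros [HP HT]. revert T HT.
  induction P as [P IHP] using (induction_ltof1 _ unfold_size). unfold ltof in IHP.
  intros T HT. remember [] as G eqn:HG in HT. remember [] as D eqn:HD in HT.
  induction HT as [G D P q bs tbs Hsum Hlabels Hnodup Hbs _|G D q l e P S U He HU _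
    |G D e P1 P2 T1 T2 T He HP1 _ HP2 _ HTs HT|G D P T HTs HT _|G D n T Hn|G D
    |G D P T T' HT IHT HTs HTT']; subst.
  - exists (map (in_branch q) bs). split; [apply input_sum_summands, Hsum|].
    eapply well_typed_in_head; eauto.
  - exists [POut q l e P]. split; [constructor; exact I|].
    eapply th_out; [constructor|apply in_eq| | |split; auto].
    + eapply eval_exists; eauto.
    + intros v Hv. eapply eval_sort; eauto.
  - exists [PIf e P1 P2]. split; [constructor; exact I|]. destruct HP as [HG1 HG2].
    destruct (union_type_subtype HT) as [Hsub1 Hsub2].
    apply th_if; [apply eval_bool_exists, He| |]; split; auto; eapply ht_sub; eauto.
  - destruct (IHP (substP 0 (PRec P) P)) with (T := T) as [As [HAs Hhead]].
    + rewrite unfold_size_substP by apply HP. simpl. lia.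
    + apply (proj1 (guardedP_unfold P)), HP.
    + apply (has_type_substP (D1 := []) (T0 := T)); auto. apply ht_rec; auto.
    + exists As. split; [constructor|]; auto.
  - destruct n; discriminate.
  - exists [PEnd]. split; constructor; [exact I|constructor].
  - destruct IHT as [As [HAs Hhead]]; auto. exists As. split; [exact HAs|].
    apply typed_head_subtype with T; auto.
    intros Q U U' [HQ HU] HU' HUU'. split; [exact HQ|]. eapply ht_sub; eauto.
Qed.

(* Typability is not closed under [proc_cong] (a recursion may be folded around
   a summand of an external choice), hence the closure. *)
Definition cong_typed (P : proc) (T : stype) : Prop :=
  exists P0, proc_cong P P0 /\ well_typed P0 T.

Lemma cong_typed_cong P Q T : proc_cong P Q -> cong_typed P T -> cong_typed Q T.
Proof.
  intros HPQ [P0 [HP0 HT]]. exists P0. split; [|exact HT].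
  transitivity P; [symmetry|]; assumption.
Qed.

Lemma well_typed_cong_typed P T : well_typed P T -> cong_typed P T.
Proof. intros HP. exists P. split; [reflexivity|exact HP]. Qed.

Lemma cong_typed_session_type P T : cong_typed P T -> session_type T.
Proof. intros [P0 [_ [_ HT]]]. eapply has_type_session_type; eauto. Qed.

Lemma typed_head_cong As Bs T : PermutationA atom_cong As Bs ->
  typed_head well_typed As T -> typed_head cong_typed Bs T.
Proof.
  intros Hperm Hhead.
  destruct Hhead as [e P1 P2 T Hb HP1 HP2|T HT|q l e Q T tbs S U HT HU Hev Hsort HQ
    |q bs T tbs Hbs HT Hex Hcont];
    try (apply PermutationA_singleton_l in Hperm; [|typeclasses eauto];
      destruct Hperm as [B [-> HB]]; inversion HB; subst).
  - apply th_if; eauto using cong_typed_cong, well_typed_cong_typed.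
  - apply th_end, HT.
  - eapply th_out; eauto using cong_typed_cong, well_typed_cong_typed.
  - destruct (PermutationA_in_branches Hperm) as [cs [-> [Hbscs Hcsbs]]].
    apply th_in with tbs; auto.
    + intros ->. destruct bs as [|[l P] bs]; [congruence|].
      destruct (Hbscs l P) as [P' []]. apply in_eq.
    + intros l S U HU. destruct (Hex l S U HU) as [P HP]. eauto.
    + intros l S U P v HU HP Hv. destruct (Hcsbs l P HP) as [P0 [HP0 HP0P]].
      eapply cong_typed_cong; [|apply well_typed_cong_typed; eauto].
      apply proc_cong_substE, HP0P.
Qed.

Lemma cong_typed_head P T :
  cong_typed P T -> exists As, summands P As /\ typed_head cong_typed As T.
Proof.
  intros [P0 [HP HT]]. destruct (well_typed_head HT) as [As [HAs Hhead]].
  assert (HP0 : proc_cong P0 P) by (symmetry; exact HP).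
  destruct (proc_cong_summands_ex HP0 (proj1 HT) HAs) as [Bs [HBs Hperm]].
  exists Bs. split; [exact HBs|]. eapply typed_head_cong; eauto.
Qed.

Lemma cong_typed_atom_head P T : atom P -> cong_typed P T -> typed_head cong_typed [P] T.
Proof.
  intros HP HT. destruct (cong_typed_head HT) as [As [HAs Hhead]].
  rewrite (summands_atom_inv HP HAs) in Hhead. exact Hhead.
Qed.

Lemma cong_typed_if_inv e P Q T : cong_typed (PIf e P Q) T ->
  cong_typed P T /\ cong_typed Q T.
Proof.
  intros HT. apply cong_typed_atom_head in HT; [|exact I].
  inversion HT as [| | |q bs ? ? ? ? ? ? Hbs]; subst; [auto|].
  destruct bs as [|? [|? ?]]; discriminate Hbs.
Qed.

Lemma cong_typed_out_inv q l e P T : cong_typed (POut q l e P) T ->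
  exists tbs S U, headT T (TOut q tbs) /\ In (l, S, U) tbs /\
    (forall v, eval e v -> value_sort v S) /\ cong_typed P U.
Proof.
  intros HT. apply cong_typed_atom_head in HT; [|exact I].
  inversion HT as [| | |q0 bs ? ? ? ? ? ? Hbs]; subst; [eauto 8|].
  destruct bs as [|? [|? ?]]; discriminate Hbs.
Qed.

Lemma map_in_branch_inj q q' b bs bs' :
  map (in_branch q) bs = map (in_branch q') bs' -> In b bs -> q = q' /\ In b bs'.
Proof.
  destruct b as [l P]. intros Hbs Hb. apply (in_in_branch q'). rewrite <- Hbs.
  apply in_in_branch. auto.
Qed.

Lemma cong_typed_in_inv q P bs T : input_sum q P bs -> cong_typed P T ->
  exists tbs, headT T (TIn q tbs) /\
    forall l S U P' v, In (l, S, U) tbs -> In (l, P') bs -> value_sort v S ->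
      cong_typed (substE 0 v P') U.
Proof.
  intros Hsum HT. destruct (cong_typed_head HT) as [As [HAs Hhead]].
  rewrite (summands_functional HAs (input_sum_summands Hsum)) in Hhead.
  apply input_sum_nonempty in Hsum. destruct bs as [|b bs]; [congruence|].
  inversion Hhead as [| | |q0 cs T0 tbs _ HT0 _ Hcont Hcs]; subst;
    try (destruct b; destruct bs; discriminate).
  exists tbs.
  destruct (map_in_branch_inj (q := q) (bs := b :: bs) (eq_sym Hcs) (in_eq _ _)) as [<- _].
  split; [exact HT0|]. intros l S U P' v HU HP' Hv. apply Hcont with l S; auto.
  apply (map_in_branch_inj (q := q) (bs := b :: bs) (eq_sym Hcs) HP').
Qed.

Definition conditional (P : proc) : Prop :=
  exists e P1 P2 b, proc_cong P (PIf e P1 P2) /\ eval e (VBool b).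

Lemma cong_typed_end_canonical P T : cong_typed P T -> headT T TEnd ->
  conditional P \/ proc_cong P PEnd.
Proof.
  intros HP HT. destruct (cong_typed_head HP) as [As [HAs Hhead]].
  apply summands_big_sum in HAs.
  destruct Hhead as [e P1 P2 T [b Hb] _ _|T _|q l e Q T tbs S U HT' _ _ _ _
    |q bs T tbs _ HT' _ _]; [left|right; exact HAs|same_head|same_head].
  exists e, P1, P2, b. auto.
Qed.

Lemma cong_typed_out_canonical P T q tbs : cong_typed P T -> headT T (TOut q tbs) ->
  conditional P \/
  exists l S U e v Q,
    In (l, S, U) tbs /\ proc_cong P (POut q l e Q) /\ eval e v.
Proof.
  intros HP HT. destruct (cong_typed_head HP) as [As [HAs Hhead]].
  apply summands_big_sum in HAs.
  destruct Hhead as [e P1 P2 T [b Hb] _ _|T HT'|q' l e Q T tbs' S U HT' HU [v Hv] _ _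
    |q' bs T tbs' _ HT' _ _]; [left|same_head|right|same_head].
  - exists e, P1, P2, b. auto.
  - same_head. exists l, S, U, e, v, Q. auto.
Qed.

Lemma cong_typed_in_canonical P T q tbs : cong_typed P T -> headT T (TIn q tbs) ->
  conditional P \/
  exists P0 bs, proc_cong P P0 /\ input_sum q P0 bs /\
    forall l S U, In (l, S, U) tbs -> exists P', In (l, P') bs.
Proof.
  intros HP HT. destruct (cong_typed_head HP) as [As [HAs Hhead]].
  apply summands_big_sum in HAs.
  destruct Hhead as [e P1 P2 T [b Hb] _ _|T HT'|q' l e Q T tbs' S U HT' _ _ _ _
    |q' bs T tbs' Hne HT' Hbs _]; [left|same_head|same_head|right].
  - exists e, P1, P2, b. auto.
  - same_head. exists (big_sum (map (in_branch q) bs)), bs. auto using big_sum_input_sum.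
Qed.

(** * Sessions as lists of parties *)

Definition active (L : list (participant * proc)) : list (participant * proc) :=
  filter (fun x => negb (ended (snd x))) L.

Definition party_cong (x y : participant * proc) : Prop :=
  fst x = fst y /\ proc_cong (snd x) (snd y).

#[global] Instance party_cong_equivalence : Equivalence party_cong.
Proof.
  split.
  - intros x. split; reflexivity.
  - intros x y [Hname Hproc]. split; symmetry; assumption.
  - intros x y z [Hname Hproc] [Hname' Hproc']. split; etransitivity; eauto.
Qed.

Definition parties_cong (L L' : list (participant * proc)) : Prop :=
  PermutationA party_cong (active L) (active L').

#[global] Instance parties_cong_equivalence : Equivalence parties_cong.
Proof.
  unfold parties_cong. split.
  - intros L. reflexivity.
  - intros L L' HL. symmetry. exact HL.
  - intros L L' L'' HL HL'. eapply permA_trans; eauto.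
Qed.

Lemma active_app L L' : active (L ++ L') = active L ++ active L'.
Proof. apply filter_app. Qed.

Lemma parties_cong_app L1 L1' L2 L2' :
  parties_cong L1 L1' -> parties_cong L2 L2' -> parties_cong (L1 ++ L2) (L1' ++ L2').
Proof.
  unfold parties_cong. intros HL1 HL2. rewrite !active_app.
  apply PermutationA_app; [typeclasses eauto|exact HL1|exact HL2].
Qed.

Lemma parties_cong_app_comm L1 L2 : parties_cong (L1 ++ L2) (L2 ++ L1).
Proof.
  unfold parties_cong. rewrite !active_app.
  apply PermutationA_app_comm. typeclasses eauto.
Qed.

Lemma parties_cong_singleton p P Q : proc_cong P Q -> parties_cong [(p, P)] [(p, Q)].
Proof.
  intros HPQ. unfold parties_cong, active. simpl. rewrite <- (proc_cong_ended HPQ).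
  destruct (ended P); simpl; [constructor|].
  apply permA_skip; [split; auto|constructor].
Qed.

Lemma parties_cong_cons p P Q L L' :
  proc_cong P Q -> parties_cong L L' -> parties_cong ((p, P) :: L) ((p, Q) :: L').
Proof.
  intros HPQ HL. apply (parties_cong_app (L1 := [(p, P)]) (L1' := [(p, Q)])); [|exact HL].
  apply parties_cong_singleton, HPQ.
Qed.

Lemma session_cong_parties M M' :
  session_cong M M' -> parties_cong (parties M) (parties M').
Proof.
  induction 1 as [p P Q HPQ|p M|M1 M2|M1 M2 M3|M|M1 M2 _ IH|M1 M2 M3 _ IH12 _ IH23
    |M1 M1' M2 M2' _ IH1 _ IH2]; simpl.
  - apply parties_cong_singleton, HPQ.
  - unfold parties_cong. reflexivity.
  - apply parties_cong_app_comm.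
  - rewrite app_assoc. reflexivity.
  - reflexivity.
  - symmetry. exact IH.
  - etransitivity; eauto.
  - apply parties_cong_app; auto.
Qed.

Fixpoint session_of (L : list (participant * proc)) : session :=
  match L with
  | [] => SProc 0 PEnd
  | (p, P) :: L => SPar (SProc p P) (session_of L)
  end.

Lemma session_of_app L L' :
  session_cong (session_of (L ++ L')) (SPar (session_of L) (session_of L')).
Proof.
  induction L as [|[p P] L IH]; simpl.
  - symmetry. apply sc_end.
  - etransitivity; [apply sc_par; [reflexivity|apply IH]|]. symmetry. apply sc_parA.
Qed.

Lemma session_of_parties M : session_cong M (session_of (parties M)).
Proof.
  induction M as [p P|M1 IH1 M2 IH2]; simpl.
  - etransitivity; [|apply sc_parC]. symmetry. apply sc_end.
  - etransitivity; [apply sc_par; eauto|]. symmetry. apply session_of_app.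
Qed.

Lemma session_of_swap x y L :
  session_cong (session_of (x :: y :: L)) (session_of (y :: x :: L)).
Proof.
  destruct x as [p P], y as [q Q]. simpl.
  etransitivity; [symmetry; apply sc_parA|]. etransitivity; [|apply sc_parA].
  apply sc_par; [apply sc_parC|reflexivity].
Qed.

Lemma session_of_PermutationA L L' :
  PermutationA party_cong L L' -> session_cong (session_of L) (session_of L').
Proof.
  induction 1 as [|[p P] [q Q] L L' [Hpq HPQ] HL IH|x y L|L1 L2 L3 H12 IH12 H23 IH23].
  - reflexivity.
  - simpl in *. subst. apply sc_par; auto. apply sc_proc; auto.
  - apply session_of_swap.
  - etransitivity; eauto.
Qed.

Lemma session_of_active L : session_cong (session_of L) (session_of (active L)).
Proof.
  induction L as [|[p P] L IH]; simpl; [reflexivity|].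
  destruct (ended P) eqn:HP; simpl.
  - etransitivity; [|apply IH].
    etransitivity; [apply sc_par; [apply sc_proc, ended_proc_cong, HP|reflexivity]|].
    apply sc_end.
  - apply sc_par; [reflexivity|exact IH].
Qed.

Lemma parties_cong_session M M' :
  parties_cong (parties M) (parties M') -> session_cong M M'.
Proof.
  intros HMM'. rewrite (session_of_parties M), (session_of_active (parties M)).
  rewrite (session_of_parties M'), (session_of_active (parties M')).
  apply session_of_PermutationA, HMM'.
Qed.

Lemma parties_session_of L : parties_cong (parties (session_of L)) L.
Proof.
  assert (HL : parties (session_of L) = L ++ [(0, PEnd)]).
  { induction L as [|[p P] L IH]; simpl; rewrite ?IH; reflexivity. }
  rewrite HL. unfold parties_cong. rewrite active_app. simpl.
  rewrite app_nil_r. reflexivity.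
Qed.

Inductive parties_step : list (participant * proc) -> list (participant * proc) -> Prop :=
| parties_step_comm p q P bs l P' e v Q L :
    input_sum q P bs -> In (l, P') bs -> eval e v ->
    parties_step ((p, P) :: (q, POut p l e Q) :: L) ((p, substE 0 v P') :: (q, Q) :: L)
| parties_step_if p e P Q b L :
    eval e (VBool b) ->
    parties_step ((p, PIf e P Q) :: L) ((p, if b then P else Q) :: L).

Lemma parties_step_app L L' K : parties_step L L' -> parties_step (L ++ K) (L' ++ K).
Proof. destruct 1; simpl; econstructor; eauto. Qed.

Lemma step_parties_step M M' : step M M' -> exists L L',
  parties_cong (parties M) L /\ parties_step L L' /\ parties_cong L' (parties M').
Proof.
  induction 1 as [p q P bs l P' e v Q Hsum HP' Hv|p e P Q He|p e P Q He
    |M1 M1' M2 _ [L [L' [HL [Hstep HL']]]]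
    |M1 M1' M2 M2' HM1 _ [L [L' [HL [Hstep HL']]]] HM2]; simpl.
  - do 2 eexists. split; [reflexivity|]. split; [econstructor; eauto|reflexivity].
  - do 2 eexists. split; [reflexivity|]. split; [|reflexivity].
    exact (parties_step_if p P Q [] He).
  - do 2 eexists. split; [reflexivity|]. split; [|reflexivity].
    exact (parties_step_if p P Q [] He).
  - exists (L ++ parties M2), (L' ++ parties M2). split; [|split].
    + apply parties_cong_app; [exact HL|reflexivity].
    + apply parties_step_app, Hstep.
    + apply parties_cong_app; [exact HL'|reflexivity].
  - exists L, L'. split; [|split; [exact Hstep|]].
    + rewrite (session_cong_parties HM1). exact HL.
    + rewrite HL'. apply session_cong_parties, HM2.
Qed.

Lemma parties_step_step M L L' :
  parties_cong (parties M) L -> parties_step L L' -> step M (session_of L').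
Proof.
  intros HM HL. apply step_cong with (session_of L) (session_of L').
  - apply parties_cong_session. rewrite HM. symmetry. apply parties_session_of.
  - destruct HL as [p q P bs l P' e v Q L Hsum HP' Hv|p e P Q b L Hb]; simpl.
    + eapply step_cong; [symmetry; apply sc_parA| |apply sc_parA].
      apply step_par. econstructor; eauto.
    + apply step_par. destruct b; constructor; exact Hb.
  - reflexivity.
Qed.

(** * Configurations *)

(* A session in which no participant owns two non-terminated processes amounts to
   a function that maps each participant to its process; terminated processes
   are those of the participants that do not occur. *)
Definition config : Type := participant -> proc.

Definition upd (f : config) (r : participant) (P : proc) : config :=
  fun x => if x =? r then P else f x.

Lemma upd_eq f r P : upd f r P r = P.
Proof. unfold upd. rewrite Nat.eqb_refl. reflexivity. Qed.

Lemma upd_neq f r P x : x <> r -> upd f r P x = f x.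
Proof. intros Hx. unfold upd. apply Nat.eqb_neq in Hx. rewrite Hx. reflexivity. Qed.

Definition names (L : list (participant * proc)) : list participant := map fst (active L).

Definition proc_of (L : list (participant * proc)) : config := fun r =>
  match find (fun x => fst x =? r) (active L) with
  | Some x => snd x
  | None => PEnd
  end.

Definition hosts (L : list (participant * proc)) (f : config) : Prop :=
  NoDup (names L) /\ forall r, proc_cong (proc_of L r) (f r).

Lemma in_active p P L : In (p, P) (active L) <-> In (p, P) L /\ ended P = false.
Proof. unfold active. rewrite filter_In. simpl. rewrite negb_true_iff. reflexivity. Qed.

Lemma active_cons p P L :
  active ((p, P) :: L) = if ended P then active L else (p, P) :: active L.
Proof. simpl. destruct (ended P); reflexivity. Qed.

Lemma proc_of_spec L r :
  In (r, proc_of L r) (active L) \/ (~ In r (names L) /\ proc_of L r = PEnd).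
Proof.
  unfold proc_of. destruct (find _ _) as [[r' P]|] eqn:Hfind.
  - apply find_some in Hfind. destruct Hfind as [HP Hr]. apply Nat.eqb_eq in Hr.
    simpl in Hr. subst. left. exact HP.
  - right. split; [|reflexivity]. intros Hr. apply in_map_fst in Hr.
    destruct Hr as [P HP]. apply (find_none _ _ Hfind) in HP.
    simpl in HP. rewrite Nat.eqb_refl in HP. discriminate.
Qed.

Lemma proc_of_in L r P : NoDup (names L) -> In (r, P) (active L) -> proc_of L r = P.
Proof.
  intros Hnodup HP. destruct (proc_of_spec L r) as [HP'|[Hr _]].
  - pose proof (NoDup_map_inj Hnodup HP HP' eq_refl) as Heq. congruence.
  - exfalso. apply Hr, in_map_fst. eauto.
Qed.

Lemma proc_of_not_in L r : ~ In r (names L) -> proc_of L r = PEnd.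
Proof.
  intros Hr. destruct (proc_of_spec L r) as [HP|[_ Hend]]; [|exact Hend].
  exfalso. apply Hr, in_map_fst. eauto.
Qed.

Lemma parties_cong_names L L' : parties_cong L L' -> Permutation (names L) (names L').
Proof.
  unfold parties_cong, names.
  induction 1 as [|x y K K' [Hxy _] _ IH|x y K|K1 K2 K3 _ IH12 _ IH23]; simpl.
  - constructor.
  - rewrite Hxy. constructor. exact IH.
  - constructor.
  - etransitivity; eauto.
Qed.

Lemma parties_cong_proc_of L L' r : parties_cong L L' -> NoDup (names L) ->
  proc_cong (proc_of L r) (proc_of L' r).
Proof.
  intros HL Hnodup. destruct (proc_of_spec L' r) as [HP|[Hr ->]].
  - destruct (PermutationA_in HL HP) as [[r' P] [HP' [Hr HPP']]].
    simpl in *. subst. rewrite (proc_of_in Hnodup HP'). exact HPP'.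
  - rewrite proc_of_not_in; [reflexivity|].
    intros Hr'. apply Hr. apply (Permutation_in r (parties_cong_names HL)), Hr'.
Qed.

Lemma hosts_cong L L' f f' : parties_cong L L' -> (forall r, proc_cong (f r) (f' r)) ->
  hosts L f -> hosts L' f'.
Proof.
  intros HL Hff' [Hnodup HLf]. split.
  - apply (Permutation_NoDup (parties_cong_names HL)), Hnodup.
  - intros r. rewrite <- (parties_cong_proc_of r HL Hnodup).
    transitivity (f r); auto.
Qed.

Lemma hosts_proc_of L : NoDup (names L) -> hosts L (proc_of L).
Proof. intros Hnodup. split; [exact Hnodup|reflexivity]. Qed.

Lemma in_names_hosts L f r : hosts L f -> In r (names L) <-> ended (f r) = false.
Proof.
  intros [Hnodup HLf]. rewrite <- (proc_cong_ended (HLf r)). split; intros Hr.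
  - apply in_map_fst in Hr. destruct Hr as [P HP].
    rewrite (proc_of_in Hnodup HP). apply in_active in HP. apply HP.
  - destruct (proc_of_spec L r) as [HP|[_ Hend]].
    + apply in_map_fst. eauto.
    + rewrite Hend in Hr. discriminate.
Qed.

Lemma proc_of_cons_neq p P L r : r <> p -> proc_of ((p, P) :: L) r = proc_of L r.
Proof.
  intros Hr. unfold proc_of. rewrite active_cons. destruct (ended P); [reflexivity|].
  simpl. destruct (Nat.eqb_spec p r); [congruence|reflexivity].
Qed.

Lemma proc_of_cons_eq p P L :
  ~ In p (names L) -> proc_cong (proc_of ((p, P) :: L) p) P.
Proof.
  intros Hp. unfold proc_of. rewrite active_cons. destruct (ended P) eqn:HP.
  - fold (proc_of L p). rewrite proc_of_not_in by exact Hp.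
    symmetry. apply ended_proc_cong, HP.
  - simpl. rewrite Nat.eqb_refl. reflexivity.
Qed.

Lemma hosts_cons p P L f :
  proc_cong P (f p) -> hosts L (upd f p PEnd) -> hosts ((p, P) :: L) f.
Proof.
  intros HP HL. assert (Hp : ~ In p (names L)).
  { rewrite (in_names_hosts p HL), upd_eq. discriminate. }
  destruct HL as [Hnodup HL]. split.
  - unfold names. rewrite active_cons. destruct (ended P); [|constructor]; assumption.
  - intros r. destruct (Nat.eq_dec r p) as [->|Hr].
    + rewrite (proc_of_cons_eq P Hp). exact HP.
    + rewrite proc_of_cons_neq by exact Hr. rewrite (HL r), upd_neq by exact Hr. reflexivity.
Qed.

Lemma hosts_cons_inv p P L f : ended P = false -> hosts ((p, P) :: L) f ->
  proc_cong P (f p) /\ hosts L (upd f p PEnd).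
Proof.
  intros HP [Hnodup HL]. unfold names in Hnodup. rewrite active_cons, HP in Hnodup.
  apply NoDup_cons_iff in Hnodup. destruct Hnodup as [Hp Hnodup].
  split; [|split; [exact Hnodup|]].
  - rewrite <- (HL p). symmetry. apply proc_of_cons_eq, Hp.
  - intros r. destruct (Nat.eq_dec r p) as [->|Hr].
    + rewrite proc_of_not_in, upd_eq by exact Hp. reflexivity.
    + rewrite upd_neq, <- (HL r), proc_of_cons_neq by exact Hr. reflexivity.
Qed.

Lemma hosts_extract L f p P : hosts L f -> proc_cong (f p) P -> ended P = false ->
  exists L0, parties_cong L ((p, P) :: L0) /\ hosts L0 (upd f p PEnd).
Proof.
  intros HL HP Hactive.
  assert (Hp : In p (names L)).
  { rewrite (in_names_hosts p HL), (proc_cong_ended HP). exact Hactive. }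
  apply in_map_fst in Hp. destruct Hp as [P0 HP0].
  assert (HP0P : proc_cong P0 P).
  { rewrite <- HP, <- (proj2 HL p), (proc_of_in (proj1 HL) HP0). reflexivity. }
  apply in_active, proj1, in_split in HP0. destruct HP0 as [L1 [L2 HL12]].
  assert (Hcong : parties_cong L ((p, P) :: L1 ++ L2)).
  { rewrite HL12. change (parties_cong (L1 ++ [(p, P0)] ++ L2) ([(p, P)] ++ L1 ++ L2)).
    rewrite !app_assoc. apply parties_cong_app; [|reflexivity].
    rewrite (parties_cong_app_comm L1 [(p, P0)]).
    apply parties_cong_cons; [exact HP0P|reflexivity]. }
  exists (L1 ++ L2). split; [exact Hcong|].
  apply (hosts_cons_inv (P := P)); [exact Hactive|].
  apply (hosts_cong (L := L) (f := f)); auto. reflexivity.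
Qed.

Lemma hosts_upd p P L f : hosts L (upd f p PEnd) -> hosts ((p, P) :: L) (upd f p P).
Proof.
  intros HL. apply hosts_cons; [rewrite upd_eq; reflexivity|].
  apply (hosts_cong (L := L) (f := upd f p PEnd)); [reflexivity| |exact HL].
  intros r. unfold upd. destruct (r =? p); reflexivity.
Qed.

Lemma hosts_upd2 p P q Q L f : p <> q -> hosts L (upd (upd f p PEnd) q PEnd) ->
  hosts ((p, P) :: (q, Q) :: L) (upd (upd f p P) q Q).
Proof.
  intros Hpq HL. apply hosts_cons.
  { rewrite upd_neq, upd_eq by exact Hpq. reflexivity. }
  apply (hosts_cong (L := (q, Q) :: L) (f := upd (upd f p PEnd) q Q));
    [reflexivity| |apply hosts_upd, HL].
  intros r. unfold upd. destruct (Nat.eqb_spec r q), (Nat.eqb_spec r p);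
    try congruence; reflexivity.
Qed.

Inductive config_step (f : config) : config -> Prop :=
| config_step_comm p q P bs l P' e v Q :
    p <> q -> proc_cong (f p) P -> input_sum q P bs -> In (l, P') bs ->
    proc_cong (f q) (POut p l e Q) -> eval e v ->
    config_step f (upd (upd f p (substE 0 v P')) q Q)
| config_step_if p e P Q b :
    proc_cong (f p) (PIf e P Q) -> eval e (VBool b) ->
    config_step f (upd f p (if b then P else Q)).

Lemma input_sum_not_ended q P bs : input_sum q P bs -> ended P = false.
Proof. destruct 1; reflexivity. Qed.

Lemma parties_step_config_step L L' f : hosts L f -> parties_step L L' ->
  exists f', config_step f f' /\ hosts L' f'.
Proof.
  intros HL Hstep. destruct Hstep as [p q P bs l P' e v Q L Hsum HP' Hv|p e P Q b L Hb].
  - apply hosts_cons_inv in HL; [|eapply input_sum_not_ended; eauto].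
    destruct HL as [HP HL].
    apply hosts_cons_inv in HL; [|reflexivity]. destruct HL as [HQ HL].
    assert (Hpq : p <> q).
    { intros ->. rewrite upd_eq in HQ. apply proc_cong_ended in HQ. discriminate. }
    rewrite upd_neq in HQ by auto.
    exists (upd (upd f p (substE 0 v P')) q Q). split; [|apply hosts_upd2; assumption].
    symmetry in HP, HQ. eapply config_step_comm; eauto.
  - apply hosts_cons_inv in HL; [|reflexivity]. destruct HL as [HP HL].
    exists (upd f p (if b then P else Q)). split; [|apply hosts_upd, HL].
    symmetry in HP. eapply config_step_if; eauto.
Qed.

Lemma config_step_parties_step L f f' : hosts L f -> config_step f f' ->
  exists L0 L', parties_cong L L0 /\ parties_step L0 L' /\ hosts L' f'.
Proof.
  intros HL Hstep.
  destruct Hstep as [p q P bs l P' e v Q Hpq HP Hsum HP' HQ Hv|p e P Q b HP Hb].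
  - destruct (hosts_extract HL HP (input_sum_not_ended Hsum)) as [L1 [HL1 Hhosts]].
    rewrite <- (upd_neq f PEnd (r := p)) in HQ by auto.
    destruct (hosts_extract Hhosts HQ eq_refl) as [L2 [HL2 Hhosts2]].
    exists ((p, P) :: (q, POut p l e Q) :: L2), ((p, substE 0 v P') :: (q, Q) :: L2).
    split; [|split; [econstructor; eauto|apply hosts_upd2; assumption]].
    rewrite HL1. apply parties_cong_cons; [reflexivity|exact HL2].
  - destruct (hosts_extract HL HP eq_refl) as [L1 [HL1 Hhosts]].
    exists ((p, PIf e P Q) :: L1), ((p, if b then P else Q) :: L1).
    split; [exact HL1|split; [constructor; exact Hb|apply hosts_upd, Hhosts]].
Qed.

Lemma step_config_step M M' f : hosts (parties M) f -> step M M' ->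
  exists f', config_step f f' /\ hosts (parties M') f'.
Proof.
  intros HM Hstep. destruct (step_parties_step Hstep) as [L [L' [HL [Hsteps HL']]]].
  assert (HLf : hosts L f).
  { apply (hosts_cong (L := parties M) (f := f)); auto. reflexivity. }
  destruct (parties_step_config_step HLf Hsteps) as [f' [Hf' Hhosts]].
  exists f'. split; [exact Hf'|]. apply (hosts_cong (L := L') (f := f')); auto. reflexivity.
Qed.

Lemma config_step_step M f f' : hosts (parties M) f -> config_step f f' ->
  exists M', step M M' /\ hosts (parties M') f'.
Proof.
  intros HM Hstep.
  destruct (config_step_parties_step HM Hstep) as [L [L' [HL [Hsteps HL']]]].
  exists (session_of L'). split; [eapply parties_step_step; eauto|].
  apply hosts_cong with L' f'; [symmetry; apply parties_session_of|reflexivity|exact HL'].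
Qed.

Definition config_steps : config -> config -> Prop := clos_refl_trans_1n config config_step.

Definition config_stuck (f : config) : Prop :=
  (exists r, ended (f r) = false) /\ ~ (exists f', config_step f f').

Definition config_gets_stuck (f : config) : Prop :=
  exists f', config_steps f f' /\ config_stuck f'.

Lemma config_step_steps f g : config_step f g -> config_steps f g.
Proof. intros Hfg. apply clos_rt_rt1n, rt_step, Hfg. Qed.

Lemma config_steps_trans f g h : config_steps f g -> config_steps g h -> config_steps f h.
Proof.
  intros Hfg Hgh. apply clos_rt_rt1n, rt_trans with g; apply clos_rt1n_rt; assumption.
Qed.

Lemma config_steps_gets_stuck f g :
  config_steps f g -> config_gets_stuck g -> config_gets_stuck f.
Proof.
  intros Hfg [h [Hgh Hh]]. exists h. split; [|exact Hh].
  exact (config_steps_trans Hfg Hgh).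
Qed.

Lemma session_cong_end_iff M :
  (exists p, session_cong M (SProc p PEnd)) <-> active (parties M) = [].
Proof.
  split.
  - intros [p Hp]. apply session_cong_parties, PermutationA_length in Hp.
    apply length_zero_iff_nil, Hp.
  - intros Hactive. exists 0. apply parties_cong_session.
    unfold parties_cong. rewrite Hactive. reflexivity.
Qed.

Lemma hosts_active_iff L f : hosts L f -> (exists r, ended (f r) = false) <-> active L <> [].
Proof.
  intros HL. split.
  - intros [r Hr] Hactive. apply (in_names_hosts r HL) in Hr.
    unfold names in Hr. rewrite Hactive in Hr. destruct Hr.
  - intros Hactive. destruct (active L) as [|[r P] L'] eqn:HL'; [congruence|].
    exists r. apply (in_names_hosts r HL). unfold names. rewrite HL'. apply in_eq.
Qed.

Lemma stuck_iff_config_stuck M f : hosts (parties M) f -> stuck M <-> config_stuck f.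
Proof.
  intros HM. unfold stuck, config_stuck.
  rewrite session_cong_end_iff, (hosts_active_iff HM).
  split; intros [Hactive Hstep]; (split; [exact Hactive|]).
  - intros [f' Hf']. destruct (config_step_step HM Hf') as [M' [HM' _]]. eauto.
  - intros [M' HM']. destruct (step_config_step HM HM') as [f' [Hf' _]]. eauto.
Qed.

Lemma gets_stuck_iff_config_gets_stuck M f :
  hosts (parties M) f -> gets_stuck M <-> config_gets_stuck f.
Proof.
  intros HM. split.
  - intros [M' [Hsteps Hstuck]]. revert f HM.
    induction Hsteps as [M|M M1 M' Hstep Hsteps IH]; intros f HM.
    + exists f. split; [constructor|]. apply (stuck_iff_config_stuck HM), Hstuck.
    + destruct (step_config_step HM Hstep) as [f1 [Hf1 HM1]].
      apply config_steps_gets_stuck with f1; [|exact (IH Hstuck f1 HM1)].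
      apply config_step_steps, Hf1.
  - intros [f' [Hsteps Hstuck]]. revert M HM.
    induction Hsteps as [f|f f1 f' Hstep Hsteps IH]; intros M HM.
    + exists M. split; [constructor|]. apply (stuck_iff_config_stuck HM), Hstuck.
    + destruct (config_step_step HM Hstep) as [M1 [HM1 Hf1]].
      destruct (IH Hstuck M1 Hf1) as [M' [Hsteps' Hstuck']].
      exists M'. split; [|exact Hstuck']. apply steps_step with M1; assumption.
Qed.

(** * Global types *)

Lemma gtype_nested_ind (X : gtype -> Prop) :
  (forall p q bs, (forall b, In b bs -> X (snd b)) -> X (GMsg p q bs)) ->
  (forall G, X G -> X (GRec G)) -> (forall n, X (GVar n)) -> X GEnd -> forall G, X G.
Proof.
  intros Xmsg Xrec Xvar Xend. fix IH 1.
  assert (IHbs : forall bs (b : label * sort * gtype), In b bs -> X (snd b)).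
  { induction bs as [|b bs IHbs]; intros b' Hb'; [destruct Hb'|].
    destruct Hb' as [<-|Hb']; [apply IH|apply IHbs, Hb']. }
  intros [p q bs|G|n|].
  - apply Xmsg, IHbs.
  - apply Xrec, IH.
  - apply Xvar.
  - apply Xend.
Qed.

Lemma shiftG_closed k G : wfG k G -> forall c, k <= c -> shiftG c G = G.
Proof.
  induction 1 as [k p q bs Hpq Hne Hnodup Hwf IH|k G Hexp HG IH|k n Hn|k];
    intros c Hc; simpl.
  - f_equal. apply (map_cont_id (f := fun _ => shiftG c)). auto.
  - rewrite IH by lia. reflexivity.
  - index_cases.
  - reflexivity.
Qed.

Lemma wfG_weaken k G : wfG k G -> forall m, k <= m -> wfG m G.
Proof. induction 1; intros m Hm; constructor; auto with arith. lia. Qed.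

Lemma exposedG_closed k G : wfG k G -> forall n, k <= n -> exposedG n G = false.
Proof. induction 1; intros m Hm; simpl; auto with arith. index_cases. Qed.

Lemma exposedG_substG_lt G : forall k H j, global_type H -> j < k ->
  exposedG j (substG k H G) = exposedG j G.
Proof.
  induction G as [p q bs IHbs|G IH|n|] using gtype_nested_ind; intros k H j HH Hj; simpl; auto.
  - rewrite (shiftG_closed HH) by lia. apply IH; auto with arith.
  - destruct (Nat.eqb_spec n k); subst.
    + rewrite (exposedG_closed HH) by lia. index_cases.
    + simpl. index_cases.
Qed.

Lemma wfG_msg_map_cont {A} k p q (f : label -> A -> gtype) bs :
  p <> q -> bs <> [] -> NoDup (labels bs) ->
  (forall b, In b bs -> wfG k (f (fst (fst b)) (snd b))) ->
  wfG k (GMsg p q (map_cont f bs)).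
Proof.
  intros Hpq Hne Hnodup Hf. constructor; [exact Hpq| | |].
  - destruct bs; simpl; congruence.
  - rewrite labels_map_cont. exact Hnodup.
  - intros b Hb. apply in_map_iff in Hb. destruct Hb as [b' [<- Hb']]. apply Hf, Hb'.
Qed.

Lemma wfG_substG k H G : wfG (S k) G -> global_type H -> wfG k (substG k H G).
Proof.
  intros HG HH. remember (S k) as m eqn:Hm. revert k Hm.
  induction HG as [m p q bs Hpq Hne Hnodup Hwf IH|m G Hexp HG IH|m n Hn|m];
    intros k ->; simpl.
  - apply (wfG_msg_map_cont (f := fun _ => substG k H)); auto.
  - rewrite (shiftG_closed HH) by lia. constructor; auto.
    rewrite exposedG_substG_lt; auto with arith.
  - destruct (Nat.eqb_spec n k); subst.
    + apply (wfG_weaken HH). lia.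
    + constructor. index_cases.
  - constructor.
Qed.

Lemma global_type_unfold G :
  global_type (GRec G) -> global_type (substG 0 (GRec G) G).
Proof. intros HG. inversion HG; subst. apply wfG_substG; assumption. Qed.

Lemma headG_functional G H K : headG G H -> headG G K -> H = K.
Proof.
  intros HH. revert K. induction HH; intros K HK; inversion HK; subst; auto.
Qed.

Lemma headG_global_type G H : headG G H -> global_type G -> global_type H.
Proof.
  induction 1 as [| |G H HH IH]; auto. intros HG. apply IH, global_type_unfold, HG.
Qed.

Fixpoint leading_recsG (G : gtype) : nat :=
  match G with GRec G => S (leading_recsG G) | _ => 0 end.

Lemma leading_recsG_substG G : forall k H,
  exposedG k G = false -> leading_recsG (substG k H G) = leading_recsG G.
Proof.
  induction G as [p q bs IHbs|G IH|n|] using gtype_nested_ind; intros k H Hexp;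
    simpl in *; auto.
  rewrite Hexp. reflexivity.
Qed.

Fixpoint unfoldG (n : nat) (G : gtype) : gtype :=
  match n, G with
  | S n, GRec G => unfoldG n (substG 0 (GRec G) G)
  | _, _ => G
  end.

Definition root (G : gtype) : gtype := unfoldG (leading_recsG G) G.

Lemma headG_root G : global_type G -> headG G (root G).
Proof.
  unfold root. remember (leading_recsG G) as m eqn:Hm. revert G Hm.
  induction m as [|m IH]; intros [p q bs|G|n|] Hm HG; simpl in Hm; try discriminate;
    try (simpl; constructor; fail).
  - inversion HG; subst. lia.
  - simpl. constructor. apply IH; [|apply global_type_unfold, HG].
    inversion HG; subst. rewrite leading_recsG_substG; auto.
Qed.

Lemma headG_cases G H : headG G H -> H = GEnd \/ exists p q bs, H = GMsg p q bs.
Proof. induction 1; eauto 6. Qed.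

(** * Global trees *)

(* Executing a communication below the root of a global type is corecursive
   ([consume]), so its result is kept as a tree rather than as a [gtype]. *)
CoInductive gtree : Type :=
| tree_end
| tree_msg (p q : participant) (ls : list (label * sort)) (k : label -> gtree).

Lemma gtree_eta (t : gtree) :
  t = match t with tree_end => tree_end | tree_msg p q ls k => tree_msg p q ls k end.
Proof. destruct t; reflexivity. Qed.

CoFixpoint tree_of (G : gtype) : gtree :=
  match root G with
  | GMsg p q bs =>
      tree_msg p q (map fst bs)
        (fun l => match find (fun b => fst (fst b) =? l) bs with
                  | Some b => tree_of (snd b)
                  | None => tree_end
                  end)
  | _ => tree_end
  end.

Lemma find_label {A} (bs : list (label * sort * A)) l S U :
  NoDup (labels bs) -> In (l, S, U) bs ->
  find (fun b => fst (fst b) =? l) bs = Some (l, S, U).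
Proof.
  intros Hnodup HU. destruct (find (fun b => fst (fst b) =? l) bs) as [b|] eqn:Hfind.
  - apply find_some in Hfind. destruct Hfind as [Hb Hl]. apply Nat.eqb_eq in Hl.
    f_equal. apply (NoDup_map_inj Hnodup Hb HU Hl).
  - apply (find_none _ _ Hfind) in HU. simpl in HU. rewrite Nat.eqb_refl in HU.
    discriminate.
Qed.

Lemma tree_of_msg G p q bs : global_type G -> headG G (GMsg p q bs) ->
  exists k, tree_of G = tree_msg p q (map fst bs) k /\ p <> q /\
    forall l S H, In (l, S, H) bs -> k l = tree_of H /\ global_type H.
Proof.
  intros HG Hhead. rewrite (gtree_eta (tree_of G)). simpl.
  rewrite <- (headG_functional Hhead (headG_root HG)).
  apply (headG_global_type Hhead) in HG.
  inversion HG as [? ? ? ? Hpq Hne Hnodup Hwf| | |]; subst.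
  eexists. split; [reflexivity|]. split; [exact Hpq|]. intros l S H HH.
  rewrite (find_label Hnodup HH). split; [reflexivity|exact (Hwf _ HH)].
Qed.

Lemma tree_of_end G : global_type G -> headG G GEnd -> tree_of G = tree_end.
Proof.
  intros HG Hhead. rewrite (gtree_eta (tree_of G)). simpl.
  rewrite <- (headG_functional Hhead (headG_root HG)). reflexivity.
Qed.

Inductive in_tree (r : participant) : gtree -> Prop :=
| in_tree_head p q ls k : r = p \/ r = q -> in_tree r (tree_msg p q ls k)
| in_tree_cont p q ls k l S :
    In (l, S) ls -> in_tree r (k l) -> in_tree r (tree_msg p q ls k).

Lemma in_pt_in_tree r G : in_pt r G -> global_type G -> in_tree r (tree_of G).
Proof.
  induction 1 as [G p q bs Hhead Hr|G p q bs [[l S] H] Hhead HH _ IH]; intros HG;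
    destruct (tree_of_msg HG Hhead) as [k [-> [_ Hk]]].
  - apply in_tree_head, Hr.
  - destruct (Hk _ _ _ HH) as [Hkl HHwf]. apply in_tree_cont with l S.
    + apply in_map_fst. eauto.
    + rewrite Hkl. apply IH, HHwf.
Qed.

Inductive agrees_node (r : participant) (X : gtree -> stype -> Prop) :
    gtree -> stype -> Prop :=
| agrees_end T : headT T TEnd -> agrees_node r X tree_end T
| agrees_out q ls k T tbs :
    r <> q -> headT T (TOut q tbs) ->
    (forall l S U, In (l, S, U) tbs ->
       exists S', In (l, S') ls /\ subsort S S' /\ X (k l) U) ->
    agrees_node r X (tree_msg r q ls k) T
| agrees_in p ls k T tbs :
    p <> r -> headT T (TIn p tbs) ->
    (forall l S, In (l, S) ls ->
       exists S' U, In (l, S', U) tbs /\ subsort S S' /\ X (k l) U) ->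
    agrees_node r X (tree_msg p r ls k) T
| agrees_other p q ls k T :
    r <> p -> r <> q ->
    headT T TEnd \/ in_tree r (tree_msg p q ls k) ->
    (forall l S, In (l, S) ls -> X (k l) T) ->
    agrees_node r X (tree_msg p q ls k) T.

(* The greatest fixed point of [agrees_node]: participant [r] may follow [T]
   when the session follows [t].  Unlike in [proj], a communication that does
   not involve [r] leaves [T] unchanged; merging is absorbed by closing under
   subtyping. *)
Definition agrees (r : participant) (t : gtree) (T : stype) : Prop :=
  exists X : gtree -> stype -> Prop,
    (forall t T, X t T -> agrees_node r X t T) /\ X t T.

Lemma agrees_node_mono r (X Y : gtree -> stype -> Prop) t T :
  (forall t T, X t T -> Y t T) -> agrees_node r X t T -> agrees_node r Y t T.
Proof.
  intros HXY Hnode. destruct Hnode as [T HT|q ls k T tbs Hrq HT Hsend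
    |p ls k T tbs Hpr HT Hreceive|p q ls k T Hrp Hrq Hr Hcont].
  - apply agrees_end, HT.
  - apply agrees_out with tbs; auto. intros l S U HU.
    destruct (Hsend _ _ _ HU) as [S' [HS' [HSS' HX]]]. eauto.
  - apply agrees_in with tbs; auto. intros l S HS.
    destruct (Hreceive _ _ HS) as [S' [U [HU [HSS' HX]]]]. eauto 6.
  - apply agrees_other; eauto.
Qed.

Lemma agrees_unfold r t T : agrees r t T -> agrees_node r (agrees r) t T.
Proof.
  intros [X [HX HtT]]. apply agrees_node_mono with X; auto.
  intros t' T' HtT'. exists X. auto.
Qed.

Lemma agrees_coind r (X : gtree -> stype -> Prop) :
  (forall t T, X t T -> agrees_node r (fun t T => X t T \/ agrees r t T) t T) ->
  forall t T, X t T -> agrees r t T.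
Proof.
  intros HX t T HtT. exists (fun t T => X t T \/ agrees r t T). split; [|auto].
  intros t' T' [HtT'|HtT']; [auto|].
  apply agrees_node_mono with (agrees r); auto. apply agrees_unfold, HtT'.
Qed.

Lemma map_fst_in {A B C} (bs : list (A * B)) (cs : list (A * C)) a b :
  map fst bs = map fst cs -> In (a, b) bs -> exists c, In (a, c) cs.
Proof. intros Hfst Hb. apply in_map_fst. rewrite <- Hfst. apply in_map_fst. eauto. Qed.

Definition refines_proj (r : participant) (t : gtree) (T : stype) : Prop :=
  exists G U, t = tree_of G /\ global_type G /\ proj r G U /\ subtype T U.

Lemma refines_proj_end r G T U : global_type G -> ~ in_pt r G -> headT U TEnd ->
  subtype T U -> agrees_node r (refines_proj r) (tree_of G) T.
Proof.
  intros HG Hr HU HTU.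
  assert (HT : headT T TEnd).
  { destruct HTU as [T U HT _|T U q cs cs' _ HU' _|T U q cs cs' _ HU' _];
      [exact HT|same_head|same_head]. }
  pose proof (headG_root HG) as Hhead.
  destruct (headG_cases Hhead) as [Hroot|[p [q [bs Hroot]]]]; rewrite Hroot in Hhead.
  - rewrite (tree_of_end HG Hhead). apply agrees_end, HT.
  - destruct (tree_of_msg HG Hhead) as [k [-> [_ Hk]]].
    assert (Hrpq : ~ (r = p \/ r = q)).
    { intros Hrpq. apply Hr. eapply in_pt_head; eauto. }
    apply agrees_other; auto. intros l S HS. apply in_map_fst in HS. destruct HS as [H HH].
    destruct (Hk _ _ _ HH) as [-> HHwf]. exists H, U. repeat split; auto.
    apply proj_end; [|exact HU]. intros Hin. apply Hr. eapply in_pt_cont; eauto.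
Qed.

Lemma refines_proj_out r G T U q bs tbs : global_type G ->
  headG G (GMsg r q bs) -> headT U (TOut q tbs) -> map fst bs = map fst tbs ->
  (forall l S H V, In (l, S, H) bs -> In (l, S, V) tbs -> proj r H V) ->
  subtype T U -> agrees_node r (refines_proj r) (tree_of G) T.
Proof.
  intros HG Hhead HU Hfst Hproj HTU.
  destruct (tree_of_msg HG Hhead) as [k [-> [Hrq Hk]]].
  destruct HTU as [T U _ HU'|T U q' cs cs' _ HU' _|T U q' cs cs' HT HU' Hsub]; same_head.
  apply agrees_out with cs; auto. intros l S V HV.
  destruct (Hsub _ _ _ HV) as [S' [V' [HV' [HSS' HVV']]]].
  destruct (map_fst_in (eq_sym Hfst) HV') as [H HH].
  destruct (Hk _ _ _ HH) as [-> HHwf].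
  exists S'. split; [apply in_map_fst; eauto|]. split; [exact HSS'|].
  exists H, V'. eauto.
Qed.

Lemma refines_proj_in r G T U p bs tbs : global_type G ->
  headG G (GMsg p r bs) -> headT U (TIn p tbs) -> map fst bs = map fst tbs ->
  (forall l S H V, In (l, S, H) bs -> In (l, S, V) tbs -> proj r H V) ->
  subtype T U -> agrees_node r (refines_proj r) (tree_of G) T.
Proof.
  intros HG Hhead HU Hfst Hproj HTU.
  destruct (tree_of_msg HG Hhead) as [k [-> [Hpr Hk]]].
  destruct HTU as [T U _ HU'|T U q' cs cs' HT HU' Hsub|T U q' cs cs' _ HU' _]; same_head.
  apply agrees_in with cs; auto. intros l S HS. apply in_map_fst in HS. destruct HS as [H HH].
  destruct (map_fst_in Hfst HH) as [V' HV'].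
  destruct (Hsub _ _ _ HV') as [S' [V [HV [HSS' HVV']]]].
  destruct (Hk _ _ _ HH) as [-> HHwf].
  exists S', V. split; [exact HV|]. split; [exact HSS'|].
  exists H, V'. eauto.
Qed.

Lemma refines_proj_other r G T U p q bs tbs : global_type G ->
  headG G (GMsg p q bs) -> r <> p -> r <> q -> in_pt r G -> map fst bs = map fst tbs ->
  (forall l S H V, In (l, S, H) bs -> In (l, S, V) tbs -> proj r H V) ->
  merge (map snd tbs) U ->
  subtype T U -> agrees_node r (refines_proj r) (tree_of G) T.
Proof.
  intros HG Hhead Hrp Hrq Hr Hfst Hproj Hmerge HTU.
  pose proof (in_pt_in_tree Hr HG) as Hr'.
  destruct (tree_of_msg HG Hhead) as [k [Htree [_ Hk]]]. rewrite Htree in *.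
  apply agrees_other; auto. intros l S HS. apply in_map_fst in HS. destruct HS as [H HH].
  destruct (map_fst_in Hfst HH) as [V HV].
  destruct (Hk _ _ _ HH) as [-> HHwf]. exists H, V. repeat split; eauto.
  apply subtype_trans with U; [exact HTU|]. apply (merge_subtype Hmerge).
  apply in_map_iff. exists (l, S, V). auto.
Qed.

Lemma proj_agrees r G U T :
  global_type G -> proj r G U -> subtype T U -> agrees r (tree_of G) T.
Proof.
  intros HG Hproj HTU. exists (refines_proj r). split; [|exists G, U; auto].
  clear G U T HG Hproj HTU. intros t T [G [U [-> [HG [Hproj HTU]]]]].
  destruct Hproj as [G U Hr HU|G U q bs tbs Hhead HU Hfst Hcont
    |G U p bs tbs Hhead HU Hfst Hcont|G U p q bs tbs Hhead Hrp Hrq Hr Hfst Hcont _ Hmerge].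
  - eapply refines_proj_end; eauto.
  - eapply refines_proj_out; eauto.
  - eapply refines_proj_in; eauto.
  - eapply refines_proj_other with (p := p) (q := q); eauto.
Qed.

(** * Executing a communication inside a global tree *)

CoFixpoint consume (a b : participant) (l : label) (t : gtree) : gtree :=
  match t with
  | tree_end => tree_end
  | tree_msg p q ls k =>
      if (p =? a) && (q =? b) then k l
      else tree_msg p q ls (fun l' => consume a b l (k l'))
  end.

Lemma consume_here a b l ls k : consume a b l (tree_msg a b ls k) = k l.
Proof.
  rewrite (gtree_eta (consume _ _ _ _)). simpl. rewrite !Nat.eqb_refl. simpl.
  destruct (k l); reflexivity.
Qed.

Lemma consume_other a b l p q ls k : p <> a ->
  consume a b l (tree_msg p q ls k) = tree_msg p q ls (fun l' => consume a b l (k l')).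
Proof.
  intros Hpa. rewrite (gtree_eta (consume _ _ _ _)). simpl.
  apply Nat.eqb_neq in Hpa. rewrite Hpa. reflexivity.
Qed.

Lemma agrees_end_or_in r t T : agrees r t T -> headT T TEnd \/ in_tree r t.
Proof.
  intros Hagrees. apply agrees_unfold in Hagrees.
  destruct Hagrees; auto; right; apply in_tree_head; auto.
Qed.

Lemma agrees_sender_inv a b ls k T : agrees a (tree_msg a b ls k) T ->
  a <> b /\ exists tbs, headT T (TOut b tbs) /\
    forall l S U, In (l, S, U) tbs ->
      exists S', In (l, S') ls /\ subsort S S' /\ agrees a (k l) U.
Proof.
  intros Hagrees. apply agrees_unfold in Hagrees.
  inversion Hagrees; subst; try congruence. eauto.
Qed.

Lemma agrees_receiver_inv a b ls k T : agrees b (tree_msg a b ls k) T ->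
  exists tbs, headT T (TIn a tbs) /\
    forall l S, In (l, S) ls ->
      exists S' U, In (l, S', U) tbs /\ subsort S S' /\ agrees b (k l) U.
Proof.
  intros Hagrees. apply agrees_unfold in Hagrees.
  inversion Hagrees; subst; try congruence. eauto.
Qed.

Lemma agrees_bystander_inv r p q ls k T : r <> p -> r <> q ->
  agrees r (tree_msg p q ls k) T -> forall l S, In (l, S) ls -> agrees r (k l) T.
Proof.
  intros Hrp Hrq Hagrees. apply agrees_unfold in Hagrees.
  inversion Hagrees; subst; congruence || eauto.
Qed.

Section Exchange.

Variables (a b : participant) (Ta Tb : stype) (obs ibs : list (label * sort * stype)).
Hypothesis Hout : headT Ta (TOut b obs).
Hypothesis Hin : headT Tb (TIn a ibs).

Inductive exchange_view : gtree -> Prop :=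
| exchange_here ls k :
    (forall l S U, In (l, S, U) obs ->
       exists S', In (l, S') ls /\ subsort S S' /\ agrees a (k l) U) ->
    (forall l S, In (l, S) ls ->
       exists S' U, In (l, S', U) ibs /\ subsort S S' /\ agrees b (k l) U) ->
    exchange_view (tree_msg a b ls k)
| exchange_below p q ls k :
    p <> a -> q <> a -> p <> b -> q <> b ->
    (forall l S, In (l, S) ls -> agrees a (k l) Ta /\ agrees b (k l) Tb) ->
    exchange_view (tree_msg p q ls k).

Lemma agrees_exchange_view t : agrees a t Ta -> agrees b t Tb -> exchange_view t.
Proof.
  intros Ha Hb. pose proof (agrees_unfold Ha) as Hnode_a.
  inversion Hnode_a as [Ta' HTa|q ls k Ta' cs Haq HTa Hsend|p ls k Ta' cs Hpa HTa Hreceive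
    |p q ls k Ta' Hap Haq _ Hcont]; subst; try same_head.
  - destruct (agrees_receiver_inv Hb) as [cs [HTb Hreceive]]. same_head.
    apply exchange_here; assumption.
  - pose proof (agrees_unfold Hb) as Hnode_b.
    inversion Hnode_b as [|q' ls' k' Tb' cs Hbq HTb Hsend|p' ls' k' Tb' cs Hpb HTb Hreceive
      |p' q' ls' k' Tb' Hbp Hbq _ Hcont']; subst; try same_head; try congruence.
    apply exchange_below; auto. intros l S HS. split; [eapply Hcont|eapply Hcont']; eauto.
Qed.

Lemma agrees_sender_in_tree t : agrees a t Ta -> in_tree a t.
Proof.
  intros Ha. destruct (agrees_end_or_in Ha) as [HTa|Hat]; [same_head|exact Hat].
Qed.

Lemma sent_label_expected t l S U : agrees a t Ta -> agrees b t Tb -> In (l, S, U) obs ->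
  exists S' V, In (l, S', V) ibs /\ subsort S S'.
Proof.
  intros Ha Hb HU. pose proof (agrees_sender_in_tree Ha) as Hat.
  induction Hat as [p q ls k Hr|p q ls k l0 S0 Hl0 _ IH];
    pose proof (agrees_exchange_view Ha Hb) as Hview;
    inversion Hview as [ls' k' Hsend Hreceive|p' q' ls' k' Hpa Hqa Hpb Hqb Hcont]; subst;
    try (destruct (Hsend _ _ _ HU) as [S1 [HS1 [HSS1 _]]];
      destruct (Hreceive _ _ HS1) as [S2 [V [HV [HS12 _]]]];
      exists S2, V; split; [exact HV|exact (subsort_trans HSS1 HS12)]).
  - destruct Hr; congruence.
  - destruct (Hcont _ _ Hl0). auto.
Qed.

Variables (l : label) (S S' : sort) (Ua Ub : stype).
Hypothesis Hsent : In (l, S, Ua) obs.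
Hypothesis Hexpected : In (l, S', Ub) ibs.
Hypothesis Hnodup : NoDup (labels ibs).

Inductive evolves : participant -> stype -> stype -> Prop :=
| evolves_sender : evolves a Ta Ua
| evolves_receiver : evolves b Tb Ub
| evolves_other r T : r <> a -> r <> b -> evolves r T T.

Lemma exchange_here_evolves ls k r T T' :
  (forall l S U, In (l, S, U) obs ->
     exists S', In (l, S') ls /\ subsort S S' /\ agrees a (k l) U) ->
  (forall l S, In (l, S) ls ->
     exists S' U, In (l, S', U) ibs /\ subsort S S' /\ agrees b (k l) U) ->
  evolves r T T' -> agrees r (tree_msg a b ls k) T -> agrees r (k l) T'.
Proof.
  intros Hsend Hreceive HTT' Hr. destruct (Hsend _ _ _ Hsent) as [S1 [HS1 [_ HUa]]].
  destruct HTT' as [| |r T Hra Hrb]; [exact HUa| |].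
  - destruct (Hreceive _ _ HS1) as [S2 [U [HU [_ HkU]]]].
    destruct (labels_functional Hnodup Hexpected HU) as [_ ->]. exact HkU.
  - exact (agrees_bystander_inv Hra Hrb Hr HS1).
Qed.

Lemma consume_end_or_in t r T T' : agrees a t Ta -> agrees b t Tb ->
  evolves r T T' -> agrees r t T -> headT T' TEnd \/ in_tree r (consume a b l t).
Proof.
  intros Ha Hb HTT' Hr. pose proof (agrees_sender_in_tree Ha) as Hat.
  induction Hat as [p q ls k Hrpq|p q ls k l0 S0 Hl0 _ IH];
    pose proof (agrees_exchange_view Ha Hb) as Hview;
    inversion Hview as [ls' k' Hsend Hreceive|p' q' ls' k' Hpa Hqa Hpb Hqb Hcont]; subst;
    try (rewrite consume_here; apply agrees_end_or_in; eapply exchange_here_evolves; eauto;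
      fail).
  - destruct Hrpq; congruence.
  - rewrite consume_other by exact Hpa. destruct (Hcont _ _ Hl0) as [Ha0 Hb0].
    destruct (Nat.eq_dec r p) as [->|Hrp]; [right; apply in_tree_head; auto|].
    destruct (Nat.eq_dec r q) as [->|Hrq]; [right; apply in_tree_head; auto|].
    destruct (IH Ha0 Hb0) as [HT'|Hrt]; [|left; exact HT'|].
    + exact (agrees_bystander_inv Hrp Hrq Hr Hl0).
    + right. apply in_tree_cont with l0 S0; assumption.
Qed.

Lemma consume_agrees t r T T' : agrees a t Ta -> agrees b t Tb ->
  evolves r T T' -> agrees r t T -> agrees r (consume a b l t) T'.
Proof.
  intros Ha Hb HTT' Hr.
  apply agrees_coind with (X := fun t' T' => exists t T, t' = consume a b l t /\
    agrees a t Ta /\ agrees b t Tb /\ evolves r T T' /\ agrees r t T);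
    [|exists t, T; auto].
  clear t T T' Ha Hb HTT' Hr. intros t' T' [t [T [-> [Ha [Hb [HTT' Hr]]]]]].
  pose proof (consume_end_or_in Ha Hb HTT' Hr) as Hend.
  destruct (agrees_exchange_view Ha Hb) as [ls k Hsend Hreceive
    |p q ls k Hpa Hqa Hpb Hqb Hcont].
  - rewrite consume_here. apply agrees_node_mono with (agrees r); auto.
    apply agrees_unfold. eapply exchange_here_evolves; eauto.
  - rewrite consume_other in * by exact Hpa.
    assert (HTT : r = p \/ r = q -> T' = T /\ forall U, evolves r U U).
    { intros Hrpq. destruct HTT' as [| |r T Hra Hrb]; [destruct Hrpq; congruence..|].
      split; [reflexivity|]. intros U. apply evolves_other; assumption. }
    apply agrees_unfold in Hr.
    inversion Hr as [|q' ls' k' T0 cs Hrq HT Hsend|p' ls' k' T0 cs Hpr HT Hreceive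
      |p' q' ls' k' T0 Hrp Hrq _ Hother]; subst.
    + destruct HTT as [-> Hevolves]; [auto|]. apply agrees_out with cs; auto.
      intros l' S1 U HU. destruct (Hsend _ _ _ HU) as [S2 [HS2 [HS12 HkU]]].
      destruct (Hcont _ _ HS2). exists S2. split; [exact HS2|split; [exact HS12|left]].
      exists (k l'), U. auto.
    + destruct HTT as [-> Hevolves]; [auto|]. apply agrees_in with cs; auto.
      intros l' S1 HS1. destruct (Hreceive _ _ HS1) as [S2 [U [HU [HS12 HkU]]]].
      destruct (Hcont _ _ HS1).
      exists S2, U. split; [exact HU|split; [exact HS12|left]]. exists (k l'), U. auto.
    + apply agrees_other; auto. intros l' S1 HS1. destruct (Hcont _ _ HS1).
      left. exists (k l'), T. eauto 6.
Qed.

End Exchange.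

(** * Safety of typed sessions *)

Definition coherent (f : config) (t : gtree) : Prop :=
  forall r, exists T, agrees r t T /\ cong_typed (f r) T.

Lemma coherent_comm f t p q P bs l P' e v Q : coherent f t -> p <> q ->
  proc_cong (f p) P -> input_sum q P bs -> In (l, P') bs ->
  proc_cong (f q) (POut p l e Q) -> eval e v ->
  exists t', coherent (upd (upd f p (substE 0 v P')) q Q) t'.
Proof.
  intros Hf Hpq HP Hsum HP' HQ Hv.
  destruct (Hf p) as [Tp [Hagrees_p Htyped_p]], (Hf q) as [Tq [Hagrees_q Htyped_q]].
  apply (cong_typed_cong HP) in Htyped_p. apply (cong_typed_cong HQ) in Htyped_q.
  pose proof (cong_typed_session_type Htyped_p) as HTp.
  destruct (cong_typed_out_inv Htyped_q) as [obs [S [Uq [HTq [HUq [Hsort Htyped_Q]]]]]].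
  destruct (cong_typed_in_inv Hsum Htyped_p) as [ibs [HTpin Hcont]].
  destruct (sent_label_expected HTq HTpin Hagrees_q Hagrees_p HUq) as [S' [Up [HUp HSS']]].
  assert (Hnodup : NoDup (labels ibs)) by apply (headT_in_wf HTp HTpin).
  exists (consume q p l t). intros r.
  assert (Hevolves : forall T T', evolves q p Tq Tp Uq Up r T T' -> agrees r t T ->
    agrees r (consume q p l t) T').
  { intros T T' HTT' Hr. exact (consume_agrees HTq HTpin HUq HUp
      Hnodup Hagrees_q Hagrees_p HTT' Hr). }
  destruct (Nat.eq_dec r q) as [->|Hrq]; [|destruct (Nat.eq_dec r p) as [->|Hrp]].
  - exists Uq. rewrite upd_eq. split; [|exact Htyped_Q].
    apply Hevolves with Tq; [constructor|exact Hagrees_q].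
  - exists Up. rewrite upd_neq, upd_eq by exact Hrq. split.
    + apply Hevolves with Tp; [constructor|exact Hagrees_p].
    + apply Hcont with l S'; eauto using value_sort_subsort.
  - destruct (Hf r) as [T [Hagrees_r Htyped_r]]. exists T. rewrite !upd_neq by assumption.
    split; [|exact Htyped_r]. apply Hevolves with T; [constructor; assumption|exact Hagrees_r].
Qed.

Lemma coherent_step f f' t : coherent f t -> config_step f f' -> exists t', coherent f' t'.
Proof.
  intros Hf Hstep.
  destruct Hstep as [p q P bs l P' e v Q Hpq HP Hsum HP' HQ Hv|p e P Q b HP Hb].
  - eapply coherent_comm; eauto.
  - exists t. intros r. destruct (Hf r) as [T [Hagrees_r Htyped_r]].
    exists T. split; [exact Hagrees_r|].
    destruct (Nat.eq_dec r p) as [->|Hrp]; [|rewrite upd_neq by exact Hrp; exact Htyped_r].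
    rewrite upd_eq. apply (cong_typed_cong HP), cong_typed_if_inv in Htyped_r.
    destruct b; apply Htyped_r.
Qed.

Lemma conditional_step f r : conditional (f r) -> exists f', config_step f f'.
Proof.
  intros [e [P1 [P2 [b [HP Hb]]]]]. eexists. eapply config_step_if; eauto.
Qed.

Lemma coherent_not_stuck f t : coherent f t -> ~ config_stuck f.
Proof.
  intros Hf [[r Hr] Hstuck].
  assert (Hcond : forall r, ~ conditional (f r)).
  { intros r' Hr'. apply Hstuck, (conditional_step (r := r')), Hr'. }
  destruct t as [|a b ls k].
  - destruct (Hf r) as [T [Hagrees_r Htyped_r]]. apply agrees_unfold in Hagrees_r.
    inversion Hagrees_r as [T0 HT| | |]; subst.
    destruct (cong_typed_end_canonical Htyped_r HT) as [Hr'|Hr']; [exact (Hcond r Hr')|].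
    apply proc_cong_ended in Hr'. simpl in Hr'. congruence.
  - destruct (Hf a) as [Ta [Hagrees_a Htyped_a]], (Hf b) as [Tb [Hagrees_b Htyped_b]].
    destruct (agrees_sender_inv Hagrees_a) as [Hab [obs [HTa Hsend]]].
    destruct (agrees_receiver_inv Hagrees_b) as [ibs [HTb Hreceive]].
    destruct (cong_typed_out_canonical Htyped_a HTa)
      as [Ha|[l [S [U [e [v [Q [HU [HQ Hv]]]]]]]]]; [exact (Hcond a Ha)|].
    destruct (cong_typed_in_canonical Htyped_b HTb)
      as [Hb|[P [bs [HP [Hsum Hbs]]]]]; [exact (Hcond b Hb)|].
    destruct (Hsend _ _ _ HU) as [S1 [HS1 _]], (Hreceive l S1) as [S2 [V [HV _]]]; auto.
    destruct (Hbs _ _ _ HV) as [P' HP'].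
    apply Hstuck. eexists. apply config_step_comm with (p := b) (q := a) (P := P) (bs := bs)
      (l := l) (P' := P') (e := e) (v := v) (Q := Q); auto.
Qed.

Lemma coherent_not_gets_stuck f t : coherent f t -> ~ config_gets_stuck f.
Proof.
  intros Hf [g [Hsteps Hg]]. revert t Hf.
  induction Hsteps as [f|f f' g Hstep Hsteps IH]; intros t Hf.
  - exact (coherent_not_stuck Hf Hg).
  - destruct (coherent_step Hf Hstep) as [t' Hf']. exact (IH Hg t' Hf').
Qed.

Lemma guardedS_parties M p P : guardedS M -> In (p, P) (parties M) -> guardedP P.
Proof.
  induction M as [q Q|M1 IH1 M2 IH2]; simpl; intros HM HP.
  - destruct HP as [HP|[]]. injection HP as -> ->. exact HM.
  - destruct HM. apply in_app_or in HP. destruct HP; auto.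
Qed.

Lemma NoDup_map_filter {A B} (f : A -> B) (p : A -> bool) l :
  NoDup (map f l) -> NoDup (map f (filter p l)).
Proof.
  induction l as [|a l IH]; simpl; [auto|]. intros Hnodup.
  apply NoDup_cons_iff in Hnodup. destruct Hnodup as [Ha Hnodup].
  destruct (p a); simpl; [constructor|]; auto.
  intros Hfa. apply Ha. apply in_map_iff in Hfa. destruct Hfa as [a' [<- Ha']].
  apply in_map. apply filter_In in Ha'. apply Ha'.
Qed.

Lemma proc_of_parties L r P :
  NoDup (map fst L) -> In (r, P) L -> proc_cong (proc_of L r) P.
Proof.
  intros Hnodup HP. destruct (proc_of_spec L r) as [HP'|[Hr ->]].
  - apply in_active, proj1 in HP'.
    pose proof (NoDup_map_inj Hnodup HP HP' eq_refl) as Heq.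
    injection Heq as ->. reflexivity.
  - symmetry. apply ended_proc_cong. destruct (ended P) eqn:HPended; [reflexivity|].
    exfalso. apply Hr, in_map_fst. exists P. apply in_active. auto.
Qed.

Lemma typed_session_coherent M G :
  guardedS M -> typed_session M G -> coherent (proc_of (parties M)) (tree_of G).
Proof.
  intros HM [HG [Hnodup [Htyped Hpt]]] r.
  destruct (in_dec Nat.eq_dec r (map fst (parties M))) as [Hr|Hr].
  - apply in_map_fst in Hr. destruct Hr as [P HP].
    destruct (Htyped _ _ HP) as [T [Hproj HPT]]. exists T. split.
    + apply (proj_agrees HG Hproj), subtype_refl.
      eapply has_type_session_type; eauto.
    + apply cong_typed_cong with P; [symmetry; apply proc_of_parties; assumption|].
      apply well_typed_cong_typed. split; [eapply guardedS_parties; eauto|exact HPT].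
  - exists TEnd. split.
    + apply (proj_agrees (U := TEnd) HG); [|apply subtype_refl; constructor].
      apply proj_end; [|constructor]. intros Hin. exact (Hr (Hpt r Hin)).
    + rewrite proc_of_not_in.
      * apply well_typed_cong_typed. split; [exact I|constructor].
      * intros Hr'. apply Hr. apply in_map_fst in Hr'. destruct Hr' as [P HP].
        apply in_map_fst. exists P. apply in_active in HP. apply HP.
Qed.

Theorem typed_session_safe M G :
  guardedS M -> typed_session M G -> ~ gets_stuck M.
Proof.
  intros HM HG. assert (Hhosts : hosts (parties M) (proc_of (parties M))).
  { apply hosts_proc_of, NoDup_map_filter, HG. }
  rewrite (gets_stuck_iff_config_gets_stuck Hhosts).
  exact (coherent_not_gets_stuck (typed_session_coherent HM HG)).
Qed.

(** * Characteristic processes *)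

(* An expression in variable 0 that evaluates exactly when the variable is
   instantiated by a value of sort [S]. *)
Definition sort_test (S : sort) : expr :=
  match S with
  | SNat => EGt (ESucc (EVar 0)) (EVar 0)
  | SInt => EGt (EVar 0) (EVar 0)
  | SBool => ENot (EVar 0)
  end.

(* [sort_test S'] evaluates on [sample S] only if [S] is a subsort of [S']. *)
Definition sample (S : sort) : value :=
  match S with
  | SNat => VInt 0
  | SInt => VInt (-1)
  | SBool => VBool true
  end.

Lemma sample_value_sort S : value_sort (sample S) S.
Proof. destruct S; simpl; auto. lia. Qed.

Lemma sort_test_eval v S : value_sort v S ->
  exists b, eval (subst_expr 0 v (sort_test S)) (VBool b).
Proof.
  destruct S, v; simpl; intros Hv; try tauto; eexists; repeat constructor; auto.
Qed.

Lemma sort_test_stuck S S' w : ~ subsort S' S ->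
  ~ eval (subst_expr 0 (sample S') (sort_test S)) w.
Proof.
  intros HS Heval. destruct S, S'; try (apply HS; constructor; fail); simpl in Heval;
    inversion Heval; subst;
    repeat match goal with
    | H : eval (ESucc _) _ |- _ => inversion H; subst; clear H
    | H : eval (EVal _) _ |- _ => inversion H; subst; clear H
    end; lia.
Qed.

Lemma has_sort_test G S : has_sort (S :: G) (sort_test S) SBool.
Proof.
  assert (Hvar : has_sort (S :: G) (EVar 0) S) by (constructor; reflexivity).
  destruct S; simpl.
  - apply hs_gt; eapply hs_sub; try apply subsort_nat_int; auto. constructor. auto.
  - apply hs_gt; auto.
  - apply hs_not; auto.
Qed.

Definition test_then (S : sort) (P : proc) : proc := PIf (sort_test S) P P.

Definition coin : expr := EChoice (EVal (VBool true)) (EVal (VBool false)).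

Lemma coin_eval b : eval coin (VBool b).
Proof. destruct b; [apply eval_choice_l|apply eval_choice_r]; constructor. Qed.

Lemma has_sort_coin G : has_sort G coin SBool.
Proof. apply hs_choice; constructor. Qed.

Definition internal_choice : list proc -> proc := big_join (PIf coin).

Fixpoint char_proc (T : stype) : proc :=
  match T with
  | TIn q bs =>
      big_sum (map (fun b =>
        PIn q (fst (fst b)) (test_then (snd (fst b)) (char_proc (snd b)))) bs)
  | TOut q bs =>
      internal_choice (map (fun b =>
        POut q (fst (fst b)) (EVal (sample (snd (fst b)))) (char_proc (snd b))) bs)
  | TRec T => PRec (char_proc T)
  | TVar n => PVar n
  | TEnd => PEnd
  end.

Lemma char_proc_shiftE T : forall c, shiftE c (char_proc T) = char_proc T.
Proof.
  induction T as [q bs IH|q bs IH|T IH|n|] using stype_nested_ind; intros c; simpl; auto.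
  - apply (big_join_map (f := shiftE c)); auto.
    intros b Hb. simpl. rewrite IH by exact Hb. destruct (snd (fst b)); reflexivity.
  - apply (big_join_map (f := shiftE c)); auto.
    intros b Hb. simpl. rewrite IH by exact Hb. reflexivity.
  - rewrite IH. reflexivity.
Qed.

Lemma char_proc_substE T : forall k v, substE k v (char_proc T) = char_proc T.
Proof.
  induction T as [q bs IH|q bs IH|T IH|n|] using stype_nested_ind; intros k v; simpl; auto.
  - apply (big_join_map (f := substE k v)); auto.
    intros b Hb. simpl. rewrite IH by exact Hb. destruct (snd (fst b)); reflexivity.
  - apply (big_join_map (f := substE k v)); auto.
    intros b Hb. simpl. rewrite IH by exact Hb. reflexivity.
  - rewrite IH. reflexivity.
Qed.

Lemma char_proc_shiftT T : forall c, char_proc (shiftT c T) = shiftP c (char_proc T).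
Proof.
  induction T as [q bs IH|q bs IH|T IH|n|] using stype_nested_ind; intros c; simpl; auto.
  - rewrite map_map. symmetry. apply (big_join_map (f := shiftP c)); auto.
    intros b Hb. simpl. rewrite IH by exact Hb. reflexivity.
  - rewrite map_map. symmetry. apply (big_join_map (f := shiftP c)); auto.
    intros b Hb. simpl. rewrite IH by exact Hb. reflexivity.
  - rewrite IH. reflexivity.
Qed.

Lemma char_proc_substT T : forall k U,
  char_proc (substT k U T) = substP k (char_proc U) (char_proc T).
Proof.
  induction T as [q bs IH|q bs IH|T IH|n|] using stype_nested_ind; intros k U; simpl; auto.
  - rewrite map_map. symmetry. apply (big_join_map (f := substP k (char_proc U))); auto.
    intros b Hb. simpl. rewrite char_proc_shiftE, IH by exact Hb. reflexivity.
  - rewrite map_map. symmetry. apply (big_join_map (f := substP k (char_proc U))); auto.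
    intros b Hb. simpl. rewrite IH by exact Hb. reflexivity.
  - rewrite IH, char_proc_shiftT. reflexivity.
  - destruct (n =? k); reflexivity.
Qed.

Lemma char_proc_head T H : headT T H -> proc_cong (char_proc T) (char_proc H).
Proof.
  induction 1 as [| | |T H _ IH]; try reflexivity.
  rewrite <- IH, char_proc_substT. apply pc_unfold.
Qed.

Lemma big_join_exposedP op n Ps :
  (forall P Q, exposedP n (op P Q) = exposedP n P || exposedP n Q) ->
  (forall P, In P Ps -> exposedP n P = false) -> exposedP n (big_join op Ps) = false.
Proof.
  intros Hop. apply (big_join_ind (X := fun P => exposedP n P = false)); [reflexivity|].
  intros P Q HP HQ. rewrite Hop, HP, HQ. reflexivity.
Qed.

Lemma char_proc_exposedP T : forall n, exposedP n (char_proc T) = exposedT n T.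
Proof.
  induction T as [q bs _|q bs _|T IH|m|] using stype_nested_ind; intros n; simpl; auto.
  - apply big_join_exposedP; [reflexivity|]. intros P HP. apply in_map_iff in HP.
    destruct HP as [b [<- _]]. reflexivity.
  - apply big_join_exposedP; [reflexivity|]. intros P HP. apply in_map_iff in HP.
    destruct HP as [b [<- _]]. reflexivity.
Qed.

Lemma char_proc_guardedP k T : wfT k T -> guardedP (char_proc T).
Proof.
  induction 1 as [k q bs _ _ _ IH|k q bs _ _ _ IH|k T Hexp _ IH|k n _|k]; simpl; auto.
  - apply (big_join_ind (X := guardedP)); simpl; auto. intros P HP. apply in_map_iff in HP.
    destruct HP as [b [<- Hb]]. simpl. auto.
  - apply (big_join_ind (X := guardedP)); simpl; auto. intros P HP. apply in_map_iff in HP.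
    destruct HP as [b [<- Hb]]. simpl. auto.
  - split; [|exact IH]. rewrite char_proc_exposedP. exact Hexp.
Qed.

(* Simultaneous substitution of the closed types [D] for the variables from [k]
   on. *)
Fixpoint close (k : nat) (D : list stype) (T : stype) : stype :=
  match T with
  | TIn q bs => TIn q (map_cont (fun _ => close k D) bs)
  | TOut q bs => TOut q (map_cont (fun _ => close k D) bs)
  | TRec T => TRec (close (S k) D T)
  | TVar n => if n <? k then TVar n else nth (n - k) D TEnd
  | TEnd => TEnd
  end.

Lemma close_nil k T : wfT k T -> close k [] T = T.
Proof.
  induction 1 as [k q bs _ _ _ IH|k q bs _ _ _ IH|k T _ _ IH|k n Hn|k]; simpl; auto.
  - rewrite map_cont_id; auto.
  - rewrite map_cont_id; auto.
  - rewrite IH. reflexivity.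
  - apply Nat.ltb_lt in Hn. rewrite Hn. reflexivity.
Qed.

Lemma nth_session_type n D : Forall session_type D -> session_type (nth n D TEnd).
Proof.
  intros HD. destruct (Nat.lt_ge_cases n (length D)) as [Hn|Hn].
  - rewrite Forall_forall in HD. apply HD, nth_In, Hn.
  - rewrite nth_overflow by exact Hn. constructor.
Qed.

Lemma close_cons D V T : Forall session_type D -> session_type V -> forall k,
  substT k V (close (S k) D T) = close k (V :: D) T.
Proof.
  intros HD HV. induction T as [q bs IH|q bs IH|T IH|n|] using stype_nested_ind;
    intros k; cbn [close substT]; auto.
  - f_equal. change (map_cont (fun _ => substT k V) (map_cont (fun _ => close (S k) D) bs) =
      map_cont (fun _ => close k (V :: D)) bs).
    rewrite map_cont_map_cont. apply map_cont_ext_in. auto.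
  - f_equal. change (map_cont (fun _ => substT k V) (map_cont (fun _ => close (S k) D) bs) =
      map_cont (fun _ => close k (V :: D)) bs).
    rewrite map_cont_map_cont. apply map_cont_ext_in. auto.
  - rewrite (shiftT_closed HV) by lia. rewrite IH. reflexivity.
  - destruct (Nat.ltb_spec n (S k)); simpl.
    + destruct (Nat.eqb_spec n k) as [->|Hnk].
      * rewrite Nat.ltb_irrefl, Nat.sub_diag. reflexivity.
      * destruct (Nat.ltb_spec n k); [reflexivity|lia].
    + destruct (Nat.ltb_spec n k); [lia|].
      rewrite (substT_closed (nth_session_type _ HD)) by lia.
      replace (n - k) with (S (n - S k)) by lia. reflexivity.
Qed.

Lemma close_exposedT D T : Forall session_type D -> forall j k, j < k ->
  exposedT j (close k D T) = exposedT j T.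
Proof.
  intros HD. induction T as [| |T IH|n|] using stype_nested_ind; intros j k Hj; simpl; auto.
  - apply IH. lia.
  - destruct (Nat.ltb_spec n k); [reflexivity|].
    rewrite (exposedT_closed (nth_session_type _ HD)) by lia. index_cases.
Qed.

Lemma close_wfT D k T : Forall session_type D -> wfT (k + length D) T -> wfT k (close k D T).
Proof.
  intros HD HT. remember (k + length D) as m eqn:Hm. revert k Hm.
  induction HT as [m q bs Hne Hnodup Hwf IH|m q bs Hne Hnodup Hwf IH|m T Hexp _ IH|m n Hn|m];
    intros k ->; simpl.
  - apply wfT_in_iff, (wf_branches_map_cont (m := k + length D)); auto. repeat split; auto.
  - apply wfT_out_iff, (wf_branches_map_cont (m := k + length D)); auto. repeat split; auto.
  - constructor; [rewrite close_exposedT; auto with arith|]. apply IH. reflexivity.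
  - destruct (Nat.ltb_spec n k); [constructor; assumption|].
    apply wfT_weaken with 0; [apply nth_session_type, HD|lia].
  - constructor.
Qed.

Lemma has_type_test_then G D S P T : session_type T ->
  has_type (S :: G) D P T -> has_type (S :: G) D (test_then S P) T.
Proof.
  intros HT HP. apply ht_if with T T; auto using has_sort_test.
  apply union_same; apply eqT_refl, HT.
Qed.

Lemma has_type_internal_choice G D Ps T :
  Ps <> [] -> session_type T -> (forall P, In P Ps -> has_type G D P T) ->
  has_type G D (internal_choice Ps) T.
Proof.
  intros Hne HT. apply (big_join_ind (X := fun P => has_type G D P T)); [contradiction|].
  intros P Q HP HQ. apply ht_if with T T; auto using has_sort_coin.
  apply union_same; apply eqT_refl, HT.
Qed.

Lemma big_sum_test_input_sum q (bs : list (label * sort * stype)) (f : stype -> proc) :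
  bs <> [] ->
  input_sum q
    (big_sum (map (fun b => PIn q (fst (fst b)) (test_then (snd (fst b)) (f (snd b)))) bs))
    (map (fun b => (fst (fst b), test_then (snd (fst b)) (f (snd b)))) bs).
Proof.
  intros Hbs. set (g := fun b : label * sort * stype =>
    (fst (fst b), test_then (snd (fst b)) (f (snd b)))).
  change (input_sum q (big_sum (map (fun b => in_branch q (g b)) bs)) (map g bs)).
  rewrite <- (map_map g). apply big_sum_input_sum. destruct bs; simpl; congruence.
Qed.

Lemma has_type_test_inputs G D q bs (f : stype -> proc) (h : stype -> stype) :
  wf_branches 0 (map_cont (fun _ => h) bs) ->
  (forall l S U, In (l, S, U) bs -> has_type (S :: G) D (f U) (h U)) ->
  has_type G D
    (big_sum (map (fun b => PIn q (fst (fst b)) (test_then (snd (fst b)) (f (snd b)))) bs))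
    (TIn q (map_cont (fun _ => h) bs)).
Proof.
  intros Hbs Hf. destruct Hbs as [Hne [Hnodup Hwf]]. eapply ht_in.
  - apply big_sum_test_input_sum. destruct bs; simpl in *; congruence.
  - rewrite labels_map_cont, map_map. reflexivity.
  - exact Hnodup.
  - intros l P S V HP HV. pose proof (Hwf _ HV) as HVwf.
    apply in_map_cont in HV. destruct HV as [U [HU ->]].
    apply in_map_iff in HP. destruct HP as [[[l' S'] U'] [Hb HU']]. simpl in Hb.
    injection Hb as -> <-. rewrite labels_map_cont in Hnodup.
    destruct (labels_functional Hnodup HU HU') as [<- <-].
    apply has_type_test_then; [exact HVwf|eauto].
Qed.

Lemma has_type_sample_outputs G D q bs (f : stype -> proc) (h : stype -> stype) :
  wf_branches 0 (map_cont (fun _ => h) bs) ->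
  (forall l S U, In (l, S, U) bs -> has_type G D (f U) (h U)) ->
  has_type G D
    (internal_choice (map (fun b =>
      POut q (fst (fst b)) (EVal (sample (snd (fst b)))) (f (snd b))) bs))
    (TOut q (map_cont (fun _ => h) bs)).
Proof.
  intros Hbs Hf. assert (HT : session_type (TOut q (map_cont (fun _ => h) bs))).
  { apply wfT_out_iff, Hbs. }
  apply has_type_internal_choice; [|exact HT|].
  { destruct bs; [destruct Hbs as [Hne _]; contradiction|discriminate]. }
  intros P HP. apply in_map_iff in HP. destruct HP as [[[l S] U] [<- HU]]. simpl.
  assert (HhU : In (l, S, h U) (map_cont (fun _ => h) bs)) by (apply in_map_cont; eauto).
  apply ht_sub with (TOut q [(l, S, h U)]); [|exact HT|].
  - apply ht_out; [apply value_sort_has_sort, sample_value_sort|eauto].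
  - eapply sub_out; [constructor|constructor|].
    intros l' S' U' [Hb|[]]. injection Hb as <- <- <-.
    exists S, (h U). split; [exact HhU|]. split; [constructor|].
    apply subtype_refl, (wf_branches_cont Hbs HhU).
Qed.

Lemma has_type_char_proc_open T G D : wfT (length D) T -> Forall session_type D ->
  has_type G D (char_proc T) (close 0 D T).
Proof.
  intros HT. remember (length D) as m eqn:Hm. revert G D Hm.
  induction HT as [m q bs Hne Hnodup Hwf IH|m q bs Hne Hnodup Hwf IH|m T Hexp HT IH|m n Hn|m];
    intros G D -> HD.
  - apply has_type_test_inputs.
    + apply (wf_branches_map_cont (m := length D)); [repeat split; assumption|].
      intros b Hb. apply close_wfT; auto.
    + intros l S U HU. exact (IH _ HU (S :: G) D eq_refl HD).
  - apply has_type_sample_outputs.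
    + apply (wf_branches_map_cont (m := length D)); [repeat split; assumption|].
      intros b Hb. apply close_wfT; auto.
    + intros l S U HU. exact (IH _ HU G D eq_refl HD).
  - assert (HW : session_type (TRec (close 1 D T))).
    { apply (close_wfT (D := D) (k := 0) (T := TRec T)); [exact HD|constructor; assumption]. }
    apply ht_rec; [exact HW|].
    specialize (IH G (TRec (close 1 D T) :: D) eq_refl (Forall_cons _ HW HD)).
    rewrite <- close_cons in IH by assumption.
    eapply ht_sub; [exact IH|exact HW|apply subtype_unfold, HW].
  - simpl. rewrite Nat.sub_0_r. constructor. apply nth_error_nth', Hn.
  - constructor.
Qed.

Lemma has_type_char_proc T : session_type T -> has_type [] [] (char_proc T) T.
Proof.
  intros HT. rewrite <- (close_nil HT) at 2.
  apply has_type_char_proc_open; [exact HT|constructor].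
Qed.

(** * Characteristic global types *)

Inductive below (n : nat) : stype -> Prop :=
| below_in q bs : q < n -> (forall b, In b bs -> below n (snd b)) -> below n (TIn q bs)
| below_out q bs : q < n -> (forall b, In b bs -> below n (snd b)) -> below n (TOut q bs)
| below_rec T : below n T -> below n (TRec T)
| below_var m : below n (TVar m)
| below_end : below n TEnd.

Lemma below_weaken n T : below n T -> forall k, n <= k -> below k T.
Proof. induction 1; intros k Hk; constructor; auto; lia. Qed.

Lemma below_branches (bs : list (label * sort * stype)) :
  (forall b, In b bs -> exists n, below n (snd b)) ->
  exists n, forall b, In b bs -> below n (snd b).
Proof.
  induction bs as [|b bs IH]; intros Hbs.
  - exists 0. intros b [].
  - destruct IH as [n Hn]; [auto using in_cons|].
    destruct (Hbs b) as [m Hm]; [apply in_eq|].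
    exists (max n m). intros b' [<-|Hb'].
    + apply below_weaken with m; [exact Hm|lia].
    + apply below_weaken with n; [exact (Hn _ Hb')|lia].
Qed.

Lemma below_exists T : exists n, below n T.
Proof.
  induction T as [q bs IH|q bs IH|T [n Hn]|m|] using stype_nested_ind.
  - destruct (below_branches IH) as [n Hn]. exists (max n (S q)).
    constructor; [lia|]. intros b Hb. apply below_weaken with n; [exact (Hn _ Hb)|lia].
  - destruct (below_branches IH) as [n Hn]. exists (max n (S q)).
    constructor; [lia|]. intros b Hb. apply below_weaken with n; [exact (Hn _ Hb)|lia].
  - exists n. constructor. exact Hn.
  - exists 0. constructor.
  - exists 0. constructor.
Qed.

Lemma below_shiftT n T : below n T -> forall c, below n (shiftT c T).
Proof.
  induction 1; intros c; simpl; constructor; auto; intros b Hb;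
    apply in_map_iff in Hb; destruct Hb as [b' [<- Hb']]; simpl; auto.
Qed.

Lemma below_substT n T : below n T -> forall k U, below n U -> below n (substT k U T).
Proof.
  induction 1 as [| | |m|]; intros k U HU; simpl;
    try (constructor; auto using below_shiftT; intros b Hb;
      apply in_map_iff in Hb; destruct Hb as [b' [<- Hb']]; simpl; auto; fail).
  destruct (m =? k); [exact HU|constructor].
Qed.

Lemma below_head n T H : headT T H -> below n T -> below n H.
Proof.
  induction 1 as [| | |T H _ IH]; auto. intros HT. apply IH. inversion HT; subst.
  apply below_substT; assumption.
Qed.

Definition communicates (T : stype) (q : participant)
    (bs : list (label * sort * stype)) : Prop :=
  headT T (TIn q bs) \/ headT T (TOut q bs).

Lemma communicates_wf T q bs : session_type T -> communicates T q bs -> wf_branches 0 bs.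
Proof.
  intros HT [Hhead|Hhead]; [eapply headT_in_wf|eapply headT_out_wf]; eauto.
Qed.

Lemma communicates_lt n T q bs : below n T -> communicates T q bs -> q < n.
Proof.
  intros HT [Hhead|Hhead]; apply (below_head Hhead) in HT; inversion HT; assumption.
Qed.

Lemma communicates_below n T q bs l S U :
  below n T -> communicates T q bs -> In (l, S, U) bs -> below n U.
Proof.
  intros HT [Hhead|Hhead] HU; apply (below_head Hhead) in HT;
    inversion HT as [? ? _ Hbs|? ? _ Hbs| | |]; subst; exact (Hbs _ HU).
Qed.

Definition others (n : nat) (q : participant) : list participant :=
  filter (fun r => negb (r =? q)) (seq 0 n).

Lemma in_others n q r : In r (others n q) <-> r < n /\ r <> q.
Proof.
  unfold others. rewrite filter_In, in_seq, negb_true_iff, Nat.eqb_neq. lia.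
Qed.

Lemma others_NoDup n q : NoDup (others n q).
Proof. apply NoDup_filter, seq_NoDup. Qed.

Lemma others_self n q : ~ In q (others n q).
Proof. rewrite in_others. tauto. Qed.

Fixpoint inform (l : label) (rs : list participant) (T : stype) : stype :=
  match rs with
  | [] => T
  | r :: rs => TOut r [(l, SBool, inform l rs T)]
  end.

Fixpoint informG (q : participant) (l : label) (rs : list participant) (G : gtype) : gtype :=
  match rs with
  | [] => G
  | r :: rs => GMsg q r [(l, SBool, informG q l rs G)]
  end.

(* Participant [n] follows [T] with partners below [n].  After each of its
   communications the partner forwards the label to everybody else below [n]:
   this is what makes the projections of the branches mergeable. *)
Fixpoint char_global (n : nat) (T : stype) : gtype :=
  match T with
  | TIn q bs =>
      GMsg q n (map_cont (fun l U => informG q l (others n q) (char_global n U)) bs)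
  | TOut q bs =>
      GMsg n q (map_cont (fun l U => informG q l (others n q) (char_global n U)) bs)
  | TRec T => GRec (char_global n T)
  | TVar m => GVar m
  | TEnd => GEnd
  end.

(* A label is forwarded together with a dummy boolean. *)
Definition forwarded_branches (f : stype -> stype) (bs : list (label * sort * stype)) :
    list (label * sort * stype) :=
  map (fun b => (fst (fst b), SBool, f (snd b))) bs.

(* The projection of [char_global n T] onto [r < n]. *)
Fixpoint peer (n r : nat) (T : stype) : stype :=
  match T with
  | TIn q bs =>
      if r =? q then TOut n (map_cont (fun l U => inform l (others n q) (peer n r U)) bs)
      else TIn q (forwarded_branches (peer n r) bs)
  | TOut q bs =>
      if r =? q then TIn n (map_cont (fun l U => inform l (others n q) (peer n r U)) bs)
      else TIn q (forwarded_branches (peer n r) bs)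
  | TRec T => TRec (peer n r T)
  | TVar m => TVar m
  | TEnd => TEnd
  end.

Lemma in_forwarded_branches f bs l S V :
  In (l, S, V) (forwarded_branches f bs) <->
  S = SBool /\ exists S' U, In (l, S', U) bs /\ V = f U.
Proof.
  unfold forwarded_branches. rewrite in_map_iff. split.
  - intros [[[l' S'] U] [Hb HU]]. injection Hb as -> <- <-. eauto.
  - intros [-> [S' [U [HU ->]]]]. exists (l, S', U). auto.
Qed.

Lemma labels_forwarded_branches f bs : labels (forwarded_branches f bs) = labels bs.
Proof. unfold labels, forwarded_branches. rewrite map_map. reflexivity. Qed.

Lemma wf_forwarded_branches k f bs : wf_branches k bs ->
  (forall b, In b bs -> wfT k (f (snd b))) -> wf_branches k (forwarded_branches f bs).
Proof.
  intros [Hne [Hnodup _]] Hf. split; [|split].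
  - destruct bs; simpl; congruence.
  - rewrite labels_forwarded_branches. exact Hnodup.
  - intros b Hb. apply in_map_iff in Hb. destruct Hb as [b' [<- Hb']]. apply Hf, Hb'.
Qed.

Lemma inform_shiftT l rs T c : shiftT c (inform l rs T) = inform l rs (shiftT c T).
Proof. induction rs as [|r rs IH]; simpl; congruence. Qed.

Lemma inform_substT l rs T k U : substT k U (inform l rs T) = inform l rs (substT k U T).
Proof. induction rs as [|r rs IH]; simpl; congruence. Qed.

Lemma informG_shiftG q l rs G c : shiftG c (informG q l rs G) = informG q l rs (shiftG c G).
Proof. induction rs as [|r rs IH]; simpl; congruence. Qed.

Lemma informG_substG q l rs G k H :
  substG k H (informG q l rs G) = informG q l rs (substG k H G).
Proof. induction rs as [|r rs IH]; simpl; congruence. Qed.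

Lemma peer_shiftT n r T : forall c, peer n r (shiftT c T) = shiftT c (peer n r T).
Proof.
  induction T as [q bs IH|q bs IH|T IH|m|] using stype_nested_ind; intros c; simpl; auto.
  - destruct (r =? q); simpl; f_equal; unfold map_cont, forwarded_branches;
      rewrite !map_map; apply map_ext_in;
      intros b Hb; simpl; rewrite ?inform_shiftT, IH by exact Hb; reflexivity.
  - destruct (r =? q); simpl; f_equal; unfold map_cont, forwarded_branches;
      rewrite !map_map; apply map_ext_in;
      intros b Hb; simpl; rewrite ?inform_shiftT, IH by exact Hb; reflexivity.
  - rewrite IH. reflexivity.
Qed.

Lemma peer_substT n r T : forall k U,
  peer n r (substT k U T) = substT k (peer n r U) (peer n r T).
Proof.
  induction T as [q bs IH|q bs IH|T IH|m|] using stype_nested_ind; intros k U; simpl; auto.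
  - destruct (r =? q); simpl; f_equal; unfold map_cont, forwarded_branches;
      rewrite !map_map; apply map_ext_in;
      intros b Hb; simpl; rewrite ?inform_substT, IH by exact Hb; reflexivity.
  - destruct (r =? q); simpl; f_equal; unfold map_cont, forwarded_branches;
      rewrite !map_map; apply map_ext_in;
      intros b Hb; simpl; rewrite ?inform_substT, IH by exact Hb; reflexivity.
  - rewrite IH, peer_shiftT. reflexivity.
  - destruct (m =? k); reflexivity.
Qed.

Lemma char_global_shiftT n T : forall c,
  char_global n (shiftT c T) = shiftG c (char_global n T).
Proof.
  induction T as [q bs IH|q bs IH|T IH|m|] using stype_nested_ind; intros c; simpl; auto.
  - f_equal; unfold map_cont; rewrite !map_map; apply map_ext_in;
      intros b Hb; simpl; rewrite informG_shiftG, IH by exact Hb; reflexivity.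
  - f_equal; unfold map_cont; rewrite !map_map; apply map_ext_in;
      intros b Hb; simpl; rewrite informG_shiftG, IH by exact Hb; reflexivity.
  - rewrite IH. reflexivity.
Qed.

Lemma char_global_substT n T : forall k U,
  char_global n (substT k U T) = substG k (char_global n U) (char_global n T).
Proof.
  induction T as [q bs IH|q bs IH|T IH|m|] using stype_nested_ind; intros k U; simpl; auto.
  - f_equal; unfold map_cont; rewrite !map_map; apply map_ext_in;
      intros b Hb; simpl; rewrite informG_substG, IH by exact Hb; reflexivity.
  - f_equal; unfold map_cont; rewrite !map_map; apply map_ext_in;
      intros b Hb; simpl; rewrite informG_substG, IH by exact Hb; reflexivity.
  - rewrite IH, char_global_shiftT. reflexivity.
  - destruct (m =? k); reflexivity.
Qed.

Lemma peer_head n r T H : headT T H -> headT (peer n r T) (peer n r H).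
Proof.
  induction 1 as [q bs|q bs| |T H _ IH]; simpl;
    try (destruct (r =? q); constructor; fail); constructor.
  rewrite peer_substT in IH. exact IH.
Qed.

Lemma peer_head_in n q T bs : headT T (TIn q bs) -> headT (peer n q T)
  (TOut n (map_cont (fun l U => inform l (others n q) (peer n q U)) bs)).
Proof.
  intros Hhead. apply (peer_head n q) in Hhead. simpl in Hhead.
  rewrite Nat.eqb_refl in Hhead. exact Hhead.
Qed.

Lemma peer_head_out n q T bs : headT T (TOut q bs) -> headT (peer n q T)
  (TIn n (map_cont (fun l U => inform l (others n q) (peer n q U)) bs)).
Proof.
  intros Hhead. apply (peer_head n q) in Hhead. simpl in Hhead.
  rewrite Nat.eqb_refl in Hhead. exact Hhead.
Qed.

Lemma peer_head_bystander n r q T bs : r <> q -> communicates T q bs ->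
  headT (peer n r T) (TIn q (forwarded_branches (peer n r) bs)).
Proof.
  intros Hrq Hcomm. apply Nat.eqb_neq in Hrq.
  destruct Hcomm as [Hhead|Hhead]; apply (peer_head n r) in Hhead; simpl in Hhead;
    rewrite Hrq in Hhead; exact Hhead.
Qed.

Lemma char_global_head n T H : headT T H -> headG (char_global n T) (char_global n H).
Proof.
  induction 1 as [q bs|q bs| |T H _ IH]; simpl; constructor.
  rewrite char_global_substT in IH. exact IH.
Qed.

Lemma char_global_communicates n T q bs : communicates T q bs ->
  exists p1 p2,
    headG (char_global n T) (GMsg p1 p2
      (map_cont (fun l U => informG q l (others n q) (char_global n U)) bs)) /\
    (p1 = q /\ p2 = n \/ p1 = n /\ p2 = q).
Proof.
  intros [Hhead|Hhead]; apply (char_global_head n) in Hhead; eauto 6.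
Qed.

Lemma peer_exposedT n r T : forall j, exposedT j (peer n r T) = exposedT j T.
Proof.
  induction T using stype_nested_ind; intros j; simpl; auto; destruct (r =? q); auto.
Qed.

Lemma wfT_inform k l rs T : wfT k T -> wfT k (inform l rs T).
Proof.
  intros HT. induction rs as [|r rs IH]; simpl; [exact HT|].
  apply wfT_out_iff, wf_branches_single, IH.
Qed.

Lemma peer_wfT n r k T : wfT k T -> wfT k (peer n r T).
Proof.
  induction 1 as [k q bs Hne Hnodup Hwf IH|k q bs Hne Hnodup Hwf IH|k T Hexp _ IH|k m Hm|k];
    simpl.
  - assert (Hbs : wf_branches k bs) by (repeat split; assumption). destruct (r =? q).
    + apply wfT_out_iff, (wf_branches_map_cont (m := k)); auto using wfT_inform.
    + apply wfT_in_iff, wf_forwarded_branches; auto.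
  - assert (Hbs : wf_branches k bs) by (repeat split; assumption). destruct (r =? q).
    + apply wfT_in_iff, (wf_branches_map_cont (m := k)); auto using wfT_inform.
    + apply wfT_in_iff, wf_forwarded_branches; auto.
  - constructor; [rewrite peer_exposedT; exact Hexp|exact IH].
  - constructor. exact Hm.
  - constructor.
Qed.

Lemma wfG_informG k q l rs G : wfG k G -> ~ In q rs -> wfG k (informG q l rs G).
Proof.
  intros HG. induction rs as [|r rs IH]; simpl; intros Hq; [exact HG|].
  constructor; [intuition congruence|discriminate| |].
  - repeat constructor. intros [].
  - intros b [<-|[]]. apply IH. tauto.
Qed.

Lemma char_global_exposedG n T : forall j, exposedG j (char_global n T) = exposedT j T.
Proof. induction T using stype_nested_ind; intros j; simpl; auto. Qed.

Lemma char_global_wfG n k T : wfT k T -> below n T -> wfG k (char_global n T).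
Proof.
  induction 1 as [k q bs Hne Hnodup Hwf IH|k q bs Hne Hnodup Hwf IH|k T Hexp _ IH|k m Hm|k];
    intros HT; inversion HT; subst; simpl.
  - apply wfG_msg_map_cont; auto; [lia|]. auto using wfG_informG, others_self.
  - apply wfG_msg_map_cont; auto; [lia|]. auto using wfG_informG, others_self.
  - constructor; [rewrite char_global_exposedG; exact Hexp|auto].
  - constructor. exact Hm.
  - constructor.
Qed.

(** * Projections of characteristic global types *)

(* [q] is about to inform [rs], after which participant [n] follows [T]. *)
Record informing (n : nat) (q : participant) (rs : list participant) (T : stype) : Prop := {
  informing_type : session_type T;
  informing_below : below n T;
  informing_sender_lt : q < n;
  informing_NoDup : NoDup rs;
  informing_not_sender : ~ In q rs;
  informing_lt r : In r rs -> r < n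
}.

Lemma informing_nil n q T : session_type T -> below n T -> q < n -> informing n q [] T.
Proof.
  intros HT Hbelow Hq. split; auto; [constructor|intros r []].
Qed.

Lemma informing_tail n q r rs T : informing n q (r :: rs) T -> informing n q rs T.
Proof.
  intros [HT Hbelow Hq Hnodup Hself Hlt]. apply NoDup_cons_iff in Hnodup.
  split; auto using in_cons. tauto.
Qed.

Lemma informing_others n T q bs l S U : session_type T -> below n T ->
  communicates T q bs -> In (l, S, U) bs -> informing n q (others n q) U.
Proof.
  intros HT Hbelow Hcomm HU. split.
  - exact (wf_branches_cont (communicates_wf HT Hcomm) HU).
  - exact (communicates_below Hbelow Hcomm HU).
  - exact (communicates_lt Hbelow Hcomm).
  - apply others_NoDup.
  - apply others_self.
  - intros r Hr. apply in_others in Hr. apply Hr.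
Qed.

Lemma informG_in_pt_tail r q l rs G : in_pt r G -> in_pt r (informG q l rs G).
Proof.
  intros Hr. induction rs as [|r' rs IH]; simpl; [exact Hr|].
  eapply in_pt_cont; [constructor|apply in_eq|exact IH].
Qed.

Lemma informG_in_pt r q l rs G : In r rs -> in_pt r (informG q l rs G).
Proof.
  induction rs as [|r' rs IH]; simpl; [contradiction|]. intros [<-|Hr].
  - eapply in_pt_head; [constructor|auto].
  - eapply in_pt_cont; [constructor|apply in_eq|exact (IH Hr)].
Qed.

Lemma char_global_in_pt n r T q bs : session_type T -> communicates T q bs -> r <= n ->
  in_pt r (char_global n T).
Proof.
  intros HT Hcomm Hr.
  destruct (char_global_communicates n Hcomm) as [p1 [p2 [Hhead Hp]]].
  destruct (Nat.eq_dec r q) as [->|Hrq]; [eapply in_pt_head; [exact Hhead|lia]|].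
  destruct (Nat.eq_dec r n) as [->|Hrn]; [eapply in_pt_head; [exact Hhead|lia]|].
  destruct (wf_branches_ex (communicates_wf HT Hcomm)) as [l [S [U HU]]].
  eapply in_pt_cont; [exact Hhead|apply in_map_cont; eauto|].
  apply informG_in_pt, in_others. lia.
Qed.

Lemma headG_end_not_in_pt r G : headG G GEnd -> ~ in_pt r G.
Proof.
  intros Hend Hr. inversion Hr as [? ? ? ? Hmsg|? ? ? ? ? Hmsg]; subst;
    pose proof (headG_functional Hend Hmsg); discriminate.
Qed.

Lemma informG_in_pt_inv r q l rs G :
  in_pt r (informG q l rs G) -> r = q \/ In r rs \/ in_pt r G.
Proof.
  induction rs as [|r' rs IH]; simpl; intros Hr; [auto|].
  inversion Hr as [? p1 p2 gs Hhead Hrp|? p1 p2 gs b Hhead Hb Hrb]; subst;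
    inversion Hhead; subst.
  - destruct Hrp; auto.
  - destruct Hb as [<-|[]]. destruct (IH Hrb) as [|[|]]; auto.
Qed.

Lemma informG_head_msg n q l rs T p1 p2 gs : informing n q rs T ->
  headG (informG q l rs (char_global n T)) (GMsg p1 p2 gs) ->
  p1 <= n /\ p2 <= n /\ forall b, In b gs -> exists q l rs T,
    snd b = informG q l rs (char_global n T) /\ informing n q rs T.
Proof.
  intros Hinf Hhead. destruct rs as [|r rs]; simpl in Hhead.
  - destruct Hinf as [HT Hbelow _ _ _ _].
    assert (Hcont : forall q bs p p', communicates T q bs ->
      GMsg p1 p2 gs =
        GMsg p p' (map_cont (fun l U => informG q l (others n q) (char_global n U)) bs) ->
      forall b, In b gs -> exists q l rs T,
        snd b = informG q l rs (char_global n T) /\ informing n q rs T).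
    { intros q' bs p p' Hcomm Hmsg [[l' S] H] HH. injection Hmsg as -> -> ->.
      apply in_map_cont in HH. destruct HH as [U [HU ->]].
      exists q', l', (others n q'), U. split; [reflexivity|].
      exact (informing_others HT Hbelow Hcomm HU). }
    destruct (session_type_head_view HT) as [q' bs HT'|q' bs HT'|HT'];
      pose proof (headG_functional Hhead (char_global_head n HT')) as Hmsg.
    + pose proof (communicates_lt Hbelow (or_introl HT')).
      split; [|split; [|exact (Hcont _ _ _ _ (or_introl HT') Hmsg)]];
        injection Hmsg as -> -> _; lia.
    + pose proof (communicates_lt Hbelow (or_intror HT')).
      split; [|split; [|exact (Hcont _ _ _ _ (or_intror HT') Hmsg)]];
        injection Hmsg as -> -> _; lia.
    + discriminate.
  - inversion Hhead; subst. pose proof (informing_sender_lt Hinf).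
    pose proof (informing_lt Hinf (in_eq _ _)).
    split; [lia|]. split; [lia|]. intros b [<-|[]].
    exists p1, l, rs, T. split; [reflexivity|eapply informing_tail; eauto].
Qed.

Lemma char_global_pt_le n r G : in_pt r G -> forall q l rs T,
  G = informG q l rs (char_global n T) -> informing n q rs T -> r <= n.
Proof.
  induction 1 as [G p1 p2 gs Hhead Hr|G p1 p2 gs b Hhead Hb _ IH]; intros q l rs T -> Hinf;
    destruct (informG_head_msg Hinf Hhead) as [Hp1 [Hp2 Hcont]].
  - lia.
  - destruct (Hcont _ Hb) as [q' [l' [rs' [T' [Hsnd Hinf']]]]]. eauto.
Qed.

Inductive proj_node (r : participant) (X : gtype -> stype -> Prop) :
    gtype -> stype -> Prop :=
| pn_end G T : ~ in_pt r G -> headT T TEnd -> proj_node r X G T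
| pn_out G T q bs tbs :
    headG G (GMsg r q bs) -> headT T (TOut q tbs) ->
    map fst bs = map fst tbs ->
    (forall l S H U, In (l, S, H) bs -> In (l, S, U) tbs -> X H U) ->
    proj_node r X G T
| pn_in G T p bs tbs :
    headG G (GMsg p r bs) -> headT T (TIn p tbs) ->
    map fst bs = map fst tbs ->
    (forall l S H U, In (l, S, H) bs -> In (l, S, U) tbs -> X H U) ->
    proj_node r X G T
| pn_other G T p q bs tbs :
    headG G (GMsg p q bs) -> r <> p -> r <> q -> in_pt r G ->
    map fst bs = map fst tbs ->
    (forall l S H U, In (l, S, H) bs -> In (l, S, U) tbs -> X H U) ->
    session_type T -> merge (map snd tbs) T ->
    proj_node r X G T.

Lemma proj_coind r (X : gtype -> stype -> Prop) :
  (forall G T, X G T -> proj_node r X G T) -> forall G T, X G T -> proj r G T.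
Proof.
  intros HX. cofix CH. intros G T HGT. destruct (HX G T HGT).
  - apply proj_end; auto.
  - eapply proj_out; eauto.
  - eapply proj_in; eauto.
  - eapply proj_other; eauto.
Qed.

(* The projection of [informG q l rs (char_global n T)] onto [r]. *)
Definition local (n r : nat) (q : participant) (l : label) (rs : list participant)
    (T : stype) : stype :=
  if r =? n then T
  else if r =? q then inform l rs (peer n r T)
  else if in_dec Nat.eq_dec r rs then TIn q [(l, SBool, peer n r T)]
  else peer n r T.

Lemma local_session_type n r q l rs T :
  session_type T -> session_type (local n r q l rs T).
Proof.
  intros HT. unfold local. destruct (r =? n); [exact HT|].
  destruct (r =? q); [apply wfT_inform, peer_wfT, HT|].
  destruct (in_dec _ _ _); [|apply peer_wfT, HT].
  apply wfT_in_iff, wf_branches_single, peer_wfT, HT.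
Qed.

Lemma local_nil n r q l T :
  local n r q l [] T = if r =? n then T else peer n r T.
Proof. unfold local. simpl. destruct (r =? n), (r =? q); reflexivity. Qed.

Lemma local_owner n q l rs T : local n n q l rs T = T.
Proof. unfold local. rewrite Nat.eqb_refl. reflexivity. Qed.

Lemma local_sender n q l rs T : q < n -> local n q q l rs T = inform l rs (peer n q T).
Proof.
  intros Hq. unfold local. destruct (Nat.eqb_spec q n); [lia|].
  rewrite Nat.eqb_refl. reflexivity.
Qed.

Lemma local_informed n r q l rs T : r < n -> r <> q -> In r rs ->
  local n r q l rs T = TIn q [(l, SBool, peer n r T)].
Proof.
  intros Hrn Hrq Hr. unfold local.
  destruct (Nat.eqb_spec r n); [lia|]. destruct (Nat.eqb_spec r q); [lia|].
  destruct (in_dec _ _ _); [reflexivity|contradiction].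
Qed.

Lemma local_not_informed n r q l rs T : r <> q -> ~ In r rs ->
  local n r q l rs T = if r =? n then T else peer n r T.
Proof.
  intros Hrq Hr. unfold local. destruct (r =? n); [reflexivity|].
  destruct (Nat.eqb_spec r q); [contradiction|].
  destruct (in_dec _ _ _); [contradiction|reflexivity].
Qed.

Lemma local_cons_other n r q l r' rs T : r <> q -> r <> r' ->
  local n r q l (r' :: rs) T = local n r q l rs T.
Proof.
  intros Hrq Hrr'. unfold local. destruct (r =? n); [reflexivity|].
  destruct (Nat.eqb_spec r q); [contradiction|].
  destruct (in_dec Nat.eq_dec r (r' :: rs)) as [Hr|Hr], (in_dec Nat.eq_dec r rs) as [Hr'|Hr'];
    simpl in Hr; try reflexivity; exfalso; intuition congruence.
Qed.

Definition local_branches (n r : nat) (q : participant)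
    (bs : list (label * sort * stype)) : list (label * sort * stype) :=
  map_cont (fun l U => local n r q l (others n q) U) bs.

Lemma local_branches_owner n q bs : local_branches n n q bs = bs.
Proof. apply map_cont_id. intros b _. apply local_owner. Qed.

Lemma local_branches_partner n q bs : q < n ->
  local_branches n q q bs = map_cont (fun l U => inform l (others n q) (peer n q U)) bs.
Proof. intros Hq. apply map_cont_ext_in. intros b _. apply local_sender, Hq. Qed.

Lemma local_branches_merge n r q bs T : r < n -> r <> q -> wf_branches 0 bs ->
  headT T (TIn q (forwarded_branches (peer n r) bs)) ->
  merge (map snd (local_branches n r q bs)) T.
Proof.
  intros Hr Hrq Hbs HT.
  assert (Hrefl : forall l S U, In (l, S, U) bs -> eqT (peer n r U) (peer n r U)).
  { intros l S U HU. apply eqT_refl, peer_wfT. exact (wf_branches_cont Hbs HU). }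
  clear Hbs. apply merge_in with q
    (map (fun b : label * sort * stype => [(fst (fst b), SBool, peer n r (snd b))]) bs)
    (forwarded_branches (peer n r) bs); [|exact HT|split].
  - unfold local_branches, map_cont. rewrite map_map. clear HT Hrefl.
    induction bs as [|b bs IH]; simpl; constructor; [|exact IH].
    rewrite local_informed by (rewrite ?in_others; auto). constructor.
  - intros l S V HV. apply in_forwarded_branches in HV. destruct HV as [-> [S' [U [HU ->]]]].
    exists [(l, SBool, peer n r U)], (peer n r U).
    split; [apply in_map_iff; exists (l, S', U); auto|]. split; [apply in_eq|eauto].
  - intros cs l S V Hcs HV. apply in_map_iff in Hcs. destruct Hcs as [[[l' S'] U] [<- HU]].
    destruct HV as [HV|[]]. injection HV as <- <- <-.
    exists (peer n r U). split; [|eauto]. apply in_forwarded_branches. eauto.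
Qed.

Definition local_proj (n r : nat) (G : gtype) (U : stype) : Prop :=
  exists q l rs T, informing n q rs T /\
    G = informG q l rs (char_global n T) /\ U = local n r q l rs T.

Lemma local_proj_branches n r T q bs l S H U : session_type T -> below n T ->
  communicates T q bs ->
  In (l, S, H) (map_cont (fun l U => informG q l (others n q) (char_global n U)) bs) ->
  In (l, S, U) (local_branches n r q bs) -> local_proj n r H U.
Proof.
  intros HT Hbelow Hcomm HH HU. apply in_map_cont in HH, HU.
  destruct HH as [V [HV ->]], HU as [V' [HV' ->]].
  destruct (communicates_wf HT Hcomm) as [_ [Hnodup _]].
  destruct (labels_functional Hnodup HV HV') as [_ <-].
  exists q, l, (others n q), V. split; [|auto].
  exact (informing_others HT Hbelow Hcomm HV).
Qed.

Lemma map_fst_local_branches {A} n r q (f : label -> stype -> A) bs :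
  map fst (map_cont f bs) = map fst (local_branches n r q bs).
Proof. unfold local_branches. rewrite !map_fst_map_cont. reflexivity. Qed.

Lemma char_global_proj_bystander n r T q bs : session_type T -> below n T ->
  communicates T q bs -> r < n -> r <> q ->
  proj_node r (local_proj n r) (char_global n T) (peer n r T).
Proof.
  intros HT Hbelow Hcomm Hr Hrq.
  destruct (char_global_communicates n Hcomm) as [p1 [p2 [Hhead Hp]]].
  apply pn_other with p1 p2
    (map_cont (fun l U => informG q l (others n q) (char_global n U)) bs)
    (local_branches n r q bs); [exact Hhead|lia|lia| | | | |].
  - apply (char_global_in_pt HT Hcomm). lia.
  - apply map_fst_local_branches.
  - intros l S H U. exact (local_proj_branches HT Hbelow Hcomm).
  - apply peer_wfT, HT.
  - apply local_branches_merge; [exact Hr|exact Hrq|exact (communicates_wf HT Hcomm)|].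
    apply peer_head_bystander; assumption.
Qed.

Lemma char_global_proj_root n r T : session_type T -> below n T -> r <= n ->
  proj_node r (local_proj n r) (char_global n T) (if r =? n then T else peer n r T).
Proof.
  intros HT Hbelow Hr.
  destruct (session_type_head_view HT) as [q bs Hhead _|q bs Hhead _|Hhead];
    pose proof (char_global_head n Hhead) as HheadG; cbn [char_global] in HheadG.
  - pose proof (communicates_lt Hbelow (or_introl Hhead)) as Hq.
    destruct (Nat.eqb_spec r n) as [->|Hrn]; [|destruct (Nat.eq_dec r q) as [->|Hrq]].
    + eapply pn_in with (tbs := local_branches n n q bs); [exact HheadG| | |].
      * rewrite local_branches_owner. exact Hhead.
      * apply map_fst_local_branches.
      * intros l S H U. exact (local_proj_branches HT Hbelow (or_introl Hhead)).
    + eapply pn_out with (tbs := local_branches n q q bs); [exact HheadG| | |].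
      * rewrite local_branches_partner by exact Hq. apply peer_head_in, Hhead.
      * apply map_fst_local_branches.
      * intros l S H U. exact (local_proj_branches HT Hbelow (or_introl Hhead)).
    + apply char_global_proj_bystander with q bs; [..|left| |]; auto; lia.
  - pose proof (communicates_lt Hbelow (or_intror Hhead)) as Hq.
    destruct (Nat.eqb_spec r n) as [->|Hrn]; [|destruct (Nat.eq_dec r q) as [->|Hrq]].
    + eapply pn_out with (tbs := local_branches n n q bs); [exact HheadG| | |].
      * rewrite local_branches_owner. exact Hhead.
      * apply map_fst_local_branches.
      * intros l S H U. exact (local_proj_branches HT Hbelow (or_intror Hhead)).
    + eapply pn_in with (tbs := local_branches n q q bs); [exact HheadG| | |].
      * rewrite local_branches_partner by exact Hq. apply peer_head_out, Hhead.
      * apply map_fst_local_branches.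
      * intros l S H U. exact (local_proj_branches HT Hbelow (or_intror Hhead)).
    + apply char_global_proj_bystander with q bs; [..|right| |]; auto; lia.
  - apply pn_end; [apply headG_end_not_in_pt, HheadG|].
    destruct (r =? n); [exact Hhead|exact (peer_head n _ Hhead)].
Qed.

Lemma informG_proj_bystander n r q l r1 rs T : informing n q (r1 :: rs) T ->
  r <= n -> r <> q -> r <> r1 ->
  proj_node r (local_proj n r) (informG q l (r1 :: rs) (char_global n T))
    (local n r q l rs T).
Proof.
  intros Hinf Hr Hrq Hrr1. pose proof (informing_type Hinf) as HT.
  assert (Hpt : in_pt r (informG q l (r1 :: rs) (char_global n T)) \/
    ~ In r rs /\ headT T TEnd).
  { destruct (in_dec Nat.eq_dec r rs) as [Hrs|Hrs].
    { left. apply informG_in_pt, in_cons, Hrs. }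
    destruct (session_type_head_view HT) as [q' bs Hhead _|q' bs Hhead _|Hhead]; [..|auto];
      left; apply informG_in_pt_tail, char_global_in_pt with q' bs; auto;
      [left|right]; exact Hhead. }
  destruct Hpt as [Hpt|[Hrs Hhead]].
  - eapply pn_other with (tbs := [(l, SBool, local n r q l rs T)]);
      [constructor|exact Hrq|exact Hrr1|exact Hpt|reflexivity| | |].
    + intros l' S H U [HH|[]] [HU|[]]. injection HH as <- <- <-. injection HU as <-.
      exists q, l, rs, T. split; [eapply informing_tail; eauto|auto].
    + apply local_session_type, HT.
    + apply merge_same. intros U [<-|[]]. apply eqT_refl, local_session_type, HT.
  - apply pn_end.
    + intros Hin. apply informG_in_pt_inv in Hin. simpl in Hin.
      apply (headG_end_not_in_pt (r := r) (char_global_head n Hhead)).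
      intuition congruence.
    + rewrite local_not_informed by assumption.
      destruct (r =? n); [exact Hhead|exact (peer_head n _ Hhead)].
Qed.

Lemma informG_proj_node n r q l r1 rs T : informing n q (r1 :: rs) T -> r <= n ->
  proj_node r (local_proj n r) (informG q l (r1 :: rs) (char_global n T))
    (local n r q l (r1 :: rs) T).
Proof.
  intros Hinf Hr. pose proof Hinf as [HT Hbelow Hq Hnodup Hself Hlt].
  pose proof (Hlt r1 (in_eq _ _)) as Hr1n.
  assert (Hqr1 : q <> r1) by (intros ->; apply Hself, in_eq).
  assert (Hcont : local_proj n r (informG q l rs (char_global n T)) (local n r q l rs T)).
  { exists q, l, rs, T. split; [eapply informing_tail; eauto|auto]. }
  destruct (Nat.eq_dec r q) as [->|Hrq]; [|destruct (Nat.eq_dec r r1) as [->|Hrr1]].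
  - rewrite local_sender in * by exact Hq.
    eapply pn_out; [constructor|constructor|reflexivity|].
    intros l' S H U [HH|[]] [HU|[]]. injection HH as <- <- <-. injection HU as <-.
    exact Hcont.
  - apply NoDup_cons_iff in Hnodup. destruct Hnodup as [Hr1 _].
    rewrite local_not_informed in Hcont by assumption.
    destruct (Nat.eqb_spec r1 n); [lia|].
    rewrite local_informed by auto using in_eq.
    eapply pn_in; [constructor|constructor|reflexivity|].
    intros l' S H U [HH|[]] [HU|[]]. injection HH as <- <- <-. injection HU as <-.
    exact Hcont.
  - rewrite local_cons_other by assumption. apply informG_proj_bystander; assumption.
Qed.

Lemma informG_proj n r q l rs T : informing n q rs T -> r <= n ->
  proj r (informG q l rs (char_global n T)) (local n r q l rs T).
Proof.
  intros Hinf Hr. apply proj_coind with (local_proj n r); [|exists q, l, rs, T; auto].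
  clear q l rs T Hinf. intros G U [q [l [rs [T [Hinf [-> ->]]]]]].
  destruct rs as [|r1 rs]; [|apply informG_proj_node; assumption].
  rewrite local_nil. destruct Hinf. apply char_global_proj_root; assumption.
Qed.

Lemma char_global_proj n r T : session_type T -> below n T -> 0 < n -> r <= n ->
  proj r (char_global n T) (if r =? n then T else peer n r T).
Proof.
  intros HT Hbelow Hn Hr. rewrite <- (local_nil n r 0 0).
  apply (informG_proj (q := 0) 0 (rs := [])); [apply informing_nil|]; assumption.
Qed.

(** * Stuck configurations *)

(* [ShBlocked] is a conditional whose guard has no value. *)
Inductive shape : Type :=
| ShEnd
| ShIn (q : participant) (ls : list label)
| ShOut (q : participant) (l : label)
| ShBlocked.

Inductive summands_shape : list proc -> shape -> Prop :=
| ss_end : summands_shape [PEnd] ShEnd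
| ss_in q bs ls :
    (forall l P, In (l, P) bs -> In l ls) ->
    summands_shape (map (in_branch q) bs) (ShIn q ls)
| ss_out q l e P : summands_shape [POut q l e P] (ShOut q l)
| ss_blocked e P Q :
    (forall b, ~ eval e (VBool b)) -> summands_shape [PIf e P Q] ShBlocked.

Definition has_shape (P : proc) (sh : shape) : Prop :=
  guardedP P /\ exists As, summands P As /\ summands_shape As sh.

Lemma has_shape_intro P As sh :
  guardedP P -> summands P As -> summands_shape As sh -> has_shape P sh.
Proof. intros HP HAs Hsh. split; eauto. Qed.

Lemma has_shape_summands P sh As : has_shape P sh -> summands P As -> summands_shape As sh.
Proof.
  intros [_ [Bs [HBs Hsh]]] HAs. rewrite (summands_functional HAs HBs). exact Hsh.
Qed.

Lemma has_shape_cong P Q sh : proc_cong P Q -> has_shape P sh -> has_shape Q sh.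
Proof.
  intros HPQ [HP [As [HAs Hsh]]].
  destruct (proc_cong_summands_ex HPQ HP HAs) as [Bs [HBs Hperm]].
  apply has_shape_intro with Bs; [apply (proc_cong_guardedP HPQ), HP|exact HBs|].
  destruct Hsh as [|q bs ls Hls|q l e P'|e P' Q' Hblocked];
    try (apply PermutationA_singleton_l in Hperm; [|typeclasses eauto];
      destruct Hperm as [B [-> Hbelow]]; inversion Hbelow; subst; constructor; assumption).
  destruct (PermutationA_in_branches Hperm) as [cs [-> [_ Hcs]]].
  constructor. intros l R HR. destruct (Hcs _ _ HR) as [R0 [HR0 _]]. eauto.
Qed.

Lemma summands_shape_member As sh A : summands_shape As sh -> In A As ->
  match A with
  | PIn q l _ => exists ls, sh = ShIn q ls /\ In l ls
  | POut q l _ _ => sh = ShOut q l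
  | PIf e _ _ => forall b, ~ eval e (VBool b)
  | PEnd => sh = ShEnd
  | _ => True
  end.
Proof.
  intros [|q bs ls Hls|q l e P|e P Q Hblocked] HA; try (destruct HA as [<-|[]]; auto; fail).
  apply in_map_iff in HA. destruct HA as [[l P] [<- HP]]. simpl. eauto.
Qed.

Lemma has_shape_atom A sh : has_shape A sh -> atom A -> summands_shape [A] sh.
Proof.
  intros Hsh HA. apply has_shape_summands with A; [exact Hsh|constructor; exact HA].
Qed.

Lemma has_shape_in_inv P sh q bs l P' :
  has_shape P sh -> input_sum q P bs -> In (l, P') bs ->
  exists ls, sh = ShIn q ls /\ In l ls.
Proof.
  intros Hsh Hsum HP'. apply input_sum_summands in Hsum.
  apply (summands_shape_member (A := PIn q l P') (has_shape_summands Hsh Hsum)).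
  apply in_in_branch. auto.
Qed.

Lemma has_shape_out_inv q l e P sh : has_shape (POut q l e P) sh -> sh = ShOut q l.
Proof.
  intros Hsh. apply has_shape_atom in Hsh; [|exact I].
  exact (summands_shape_member Hsh (in_eq _ _)).
Qed.

Lemma has_shape_if_inv e P Q sh b : has_shape (PIf e P Q) sh -> ~ eval e (VBool b).
Proof.
  intros Hsh. apply has_shape_atom in Hsh; [|exact I].
  exact (summands_shape_member Hsh (in_eq _ _) b).
Qed.

Lemma has_shape_ended P sh : has_shape P sh -> ended P = true -> sh = ShEnd.
Proof.
  intros Hsh HP. apply ended_proc_cong in HP. apply (has_shape_cong HP) in Hsh.
  apply has_shape_atom in Hsh; [|exact I].
  exact (summands_shape_member Hsh (in_eq _ _)).
Qed.

Lemma has_shape_end : has_shape PEnd ShEnd.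
Proof. apply has_shape_intro with [PEnd]; constructor; exact I. Qed.

Lemma config_stuck_shapes f (sh : participant -> shape) :
  (forall r, has_shape (f r) (sh r)) ->
  (forall a b ls l, a <> b -> sh a = ShIn b ls -> sh b = ShOut a l -> ~ In l ls) ->
  (exists r, sh r <> ShEnd) -> config_stuck f.
Proof.
  intros Hsh Hno_comm [r Hr]. split.
  - exists r. destruct (ended (f r)) eqn:Hended; [|reflexivity].
    exfalso. exact (Hr (has_shape_ended (Hsh r) Hended)).
  - intros [f' Hstep].
    destruct Hstep as [p q P bs l P' e v Q Hpq HP Hsum HP' HQ _|p e P Q b HP Hb].
    + destruct (has_shape_in_inv (has_shape_cong HP (Hsh p)) Hsum HP')
        as [ls [Hp Hl]].
      pose proof (has_shape_out_inv (has_shape_cong HQ (Hsh q))) as Hq.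
      exact (Hno_comm p q ls l Hpq Hp Hq Hl).
    + exact (has_shape_if_inv (has_shape_cong HP (Hsh p)) Hb).
Qed.

Lemma standoff_stuck n q ls f shn shq : q < n ->
  has_shape (f n) shn -> has_shape (f q) shq ->
  (forall r, r < n -> r <> q -> has_shape (f r) (ShIn q ls)) ->
  (forall r, n < r -> has_shape (f r) ShEnd) ->
  shq <> ShEnd ->
  (forall r l, shq = ShOut r l -> r = n /\ forall ls, shn = ShIn q ls -> ~ In l ls) ->
  (forall l ls, shq = ShIn n ls -> shn = ShOut q l -> ~ In l ls) ->
  config_stuck f.
Proof.
  intros Hqn Hn Hq Hothers Habove Hactive Hq_out Hq_in.
  set (sh := fun r => if r =? n then shn else if r =? q then shq
    else if r <? n then ShIn q ls else ShEnd).
  assert (Hshn : sh n = shn) by (unfold sh; rewrite Nat.eqb_refl; reflexivity).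
  assert (Hshq : sh q = shq).
  { unfold sh. rewrite Nat.eqb_refl. destruct (Nat.eqb_spec q n); [lia|reflexivity]. }
  assert (Hsho : forall r, r <> n -> r <> q -> sh r = if r <? n then ShIn q ls else ShEnd).
  { intros r Hrn Hrq. unfold sh. apply Nat.eqb_neq in Hrn, Hrq. rewrite Hrn, Hrq.
    reflexivity. }
  apply config_stuck_shapes with sh.
  - intros r. destruct (Nat.eq_dec r n) as [->|Hrn]; [rewrite Hshn; exact Hn|].
    destruct (Nat.eq_dec r q) as [->|Hrq]; [rewrite Hshq; exact Hq|].
    rewrite Hsho by assumption. destruct (Nat.ltb_spec r n); [auto|apply Habove; lia].
  - intros a b ls' l Hab Ha Hb Hl.
    destruct (Nat.eq_dec b n) as [->|Hbn]; [|destruct (Nat.eq_dec b q) as [->|Hbq]].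
    + rewrite Hshn in Hb. destruct (Nat.eq_dec a q) as [->|Haq].
      * rewrite Hshq in Ha. exact (Hq_in _ _ Ha Hb Hl).
      * rewrite Hsho in Ha by assumption. destruct (a <? n); [injection Ha; lia|discriminate].
    + rewrite Hshq in Hb. destruct (Hq_out _ _ Hb) as [-> Hl'].
      rewrite Hshn in Ha. exact (Hl' _ Ha Hl).
    + rewrite Hsho in Hb by assumption. destruct (b <? n); discriminate.
  - exists q. rewrite Hshq. exact Hactive.
Qed.

(** * Runs of characteristic processes *)

Definition testing (v : value) (S : sort) (P : proc) : proc :=
  PIf (subst_expr 0 v (sort_test S)) P P.

Lemma test_steps f r v S P : value_sort v S -> proc_cong (f r) (testing v S P) ->
  config_steps f (upd f r P).
Proof.
  intros Hv HP. destruct (sort_test_eval Hv) as [b Hb].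
  apply config_step_steps. pose proof (config_step_if HP Hb) as Hstep.
  destruct b; exact Hstep.
Qed.

Lemma testing_blocked S S' P : ~ subsort S' S -> guardedP P ->
  has_shape (testing (sample S') S P) ShBlocked.
Proof.
  intros HS HP. apply has_shape_intro with [testing (sample S') S P].
  - split; exact HP.
  - constructor. exact I.
  - constructor. intros b. apply sort_test_stuck, HS.
Qed.

Lemma comm_steps f a b bs l S U v Q : a <> b ->
  proc_cong (f a) (char_proc (TIn b bs)) -> In (l, S, U) bs ->
  proc_cong (f b) (POut a l (EVal v) Q) ->
  config_steps f (upd (upd f a (testing v S (char_proc U))) b Q).
Proof.
  intros Hab Ha HU Hb. apply config_step_steps. rewrite <- (char_proc_substE U 0 v).
  assert (Hne : bs <> []) by (intros ->; destruct HU).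
  assert (Hsummand : In (l, test_then S (char_proc U))
    (map (fun br => (fst (fst br), test_then (snd (fst br)) (char_proc (snd br)))) bs)).
  { apply in_map_iff. exists (l, S, U). auto. }
  exact (config_step_comm Hab Ha (big_sum_test_input_sum b char_proc Hne) Hsummand Hb
    (eval_val v)).
Qed.

Lemma choice_steps f r P Ps : In P Ps -> proc_cong (f r) (internal_choice Ps) ->
  exists g, config_steps f g /\ proc_cong (g r) P /\ (forall x, x <> r -> g x = f x).
Proof.
  revert f. induction Ps as [|R Ps IH]; intros f HP Hf; [destruct HP|].
  destruct Ps as [|R' Ps].
  { destruct HP as [<-|[]]. exists f. split; [constructor|auto]. }
  unfold internal_choice in Hf. rewrite big_join_cons in Hf by discriminate.
  destruct HP as [->|HP].
  - exists (upd f r P). split; [|split].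
    + apply config_step_steps, (config_step_if Hf (coin_eval true)).
    + rewrite upd_eq. reflexivity.
    + intros x Hx. apply upd_neq, Hx.
  - destruct (IH (upd f r (internal_choice (R' :: Ps))) HP) as [g [Hg [HgP Hother]]].
    { rewrite upd_eq. reflexivity. }
    exists g. split; [|split; [exact HgP|]].
    + apply config_steps_trans with (upd f r (internal_choice (R' :: Ps))); [|exact Hg].
      apply config_step_steps, (config_step_if Hf (coin_eval false)).
    + intros x Hx. rewrite Hother, upd_neq; auto.
Qed.

Lemma out_steps f r T q bs l S U :
  headT T (TOut q bs) -> In (l, S, U) bs -> proc_cong (f r) (char_proc T) ->
  exists g, config_steps f g /\
    proc_cong (g r) (POut q l (EVal (sample S)) (char_proc U)) /\
    (forall x, x <> r -> g x = f x).
Proof.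
  intros Hhead HU Hf. rewrite (char_proc_head Hhead) in Hf.
  eapply choice_steps; [|exact Hf]. apply in_map_iff. exists (l, S, U). auto.
Qed.

(* A shape that the characteristic process of [T] can take. *)
Inductive type_shape (T : stype) : shape -> Prop :=
| ts_end : headT T TEnd -> type_shape T ShEnd
| ts_in q bs : headT T (TIn q bs) -> type_shape T (ShIn q (labels bs))
| ts_out q bs l S U :
    headT T (TOut q bs) -> In (l, S, U) bs -> type_shape T (ShOut q l).

Lemma type_shape_exists T : session_type T -> exists sh, type_shape T sh.
Proof.
  intros HT. destruct (session_type_head_view HT) as [q bs Hhead Hbs|q bs Hhead Hbs|Hhead].
  - eexists. eapply ts_in, Hhead.
  - destruct (wf_branches_ex Hbs) as [l [S [U HU]]]. eexists. eapply ts_out; eauto.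
  - exists ShEnd. apply ts_end, Hhead.
Qed.

Lemma char_proc_shape_in T q bs : session_type T -> headT T (TIn q bs) ->
  has_shape (char_proc T) (ShIn q (labels bs)).
Proof.
  intros HT Hhead. destruct (headT_in_wf HT Hhead) as [Hne _].
  apply has_shape_cong with (char_proc (TIn q bs)); [symmetry; apply char_proc_head, Hhead|].
  eapply has_shape_intro.
  - apply (char_proc_guardedP (k := 0)), (headT_session_type Hhead HT).
  - apply input_sum_summands, (big_sum_test_input_sum q char_proc Hne).
  - constructor. intros l P HP. apply in_map_iff in HP. destruct HP as [[[l' S] U] [Hb HU]].
    injection Hb as -> _. apply in_labels. eauto.
Qed.

Lemma char_proc_shape_end T : headT T TEnd -> has_shape (char_proc T) ShEnd.
Proof.
  intros Hhead. apply has_shape_cong with PEnd; [|exact has_shape_end].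
  symmetry. exact (char_proc_head Hhead).
Qed.

Lemma settle_steps f r T sh : session_type T -> type_shape T sh ->
  proc_cong (f r) (char_proc T) ->
  exists g, config_steps f g /\ has_shape (g r) sh /\ (forall x, x <> r -> g x = f x).
Proof.
  intros HT Hsh Hf. destruct Hsh as [Hhead|q bs Hhead|q bs l S U Hhead HU].
  - exists f. split; [constructor|split; [|auto]].
    apply has_shape_cong with (char_proc T); [symmetry; exact Hf|].
    apply char_proc_shape_end, Hhead.
  - exists f. split; [constructor|split; [|auto]].
    apply has_shape_cong with (char_proc T); [symmetry; exact Hf|].
    apply char_proc_shape_in; assumption.
  - destruct (out_steps Hhead HU Hf) as [g [Hg [HgU Hother]]].
    exists g. split; [exact Hg|split; [|exact Hother]].
    eapply has_shape_cong; [symmetry; exact HgU|].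
    eapply has_shape_intro; [|constructor; exact I|constructor].
    apply (char_proc_guardedP (k := 0)).
    exact (wf_branches_cont (headT_out_wf HT Hhead) HU).
Qed.

Definition peer_config (n : nat) (T : stype) : config :=
  fun r => if r <? n then char_proc (peer n r T) else PEnd.

Definition peers_at (n : nat) (T : stype) (f : config) : Prop :=
  forall r, r <> n -> proc_cong (f r) (peer_config n T r).

Definition peers_at_except (n q : nat) (T : stype) (f : config) : Prop :=
  forall r, r <> n -> r <> q -> proc_cong (f r) (peer_config n T r).

Lemma peer_config_lt n T r : r < n -> peer_config n T r = char_proc (peer n r T).
Proof. intros Hr. apply Nat.ltb_lt in Hr. unfold peer_config. rewrite Hr. reflexivity. Qed.

Lemma peer_config_ge n T r : n <= r -> peer_config n T r = PEnd.
Proof. intros Hr. apply Nat.ltb_ge in Hr. unfold peer_config. rewrite Hr. reflexivity. Qed.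

Lemma peers_at_except_of n q T f : peers_at n T f -> peers_at_except n q T f.
Proof. intros Hf r Hrn _. apply Hf, Hrn. Qed.

Lemma inform_steps q l X (Y : participant -> stype) rs f : NoDup rs -> ~ In q rs ->
  proc_cong (f q) (char_proc (inform l rs X)) ->
  (forall r, In r rs -> exists bs,
     proc_cong (f r) (char_proc (TIn q bs)) /\ In (l, SBool, Y r) bs) ->
  exists g, config_steps f g /\ proc_cong (g q) (char_proc X) /\
    (forall r, In r rs -> proc_cong (g r) (char_proc (Y r))) /\
    (forall x, x <> q -> ~ In x rs -> g x = f x).
Proof.
  revert f. induction rs as [|r rs IH]; intros f Hnodup Hself Hq Hrs.
  { exists f. split; [constructor|]. split; [exact Hq|]. split; [intros r []|auto]. }
  apply NoDup_cons_iff in Hnodup. destruct Hnodup as [Hr Hnodup].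
  simpl in Hself. apply Decidable.not_or in Hself. destruct Hself as [Hrq Hself].
  destruct (Hrs r (in_eq _ _)) as [bs [Hfr HYr]].
  set (f1 := upd (upd f r (testing (VBool true) SBool (char_proc (Y r)))) q
    (char_proc (inform l rs X))).
  assert (Hcomm : config_steps f f1) by exact (comm_steps Hrq Hfr HYr Hq).
  assert (Htest : config_steps f1 (upd f1 r (char_proc (Y r)))).
  { apply test_steps with (VBool true) SBool; [exact I|].
    unfold f1. rewrite upd_neq, upd_eq by exact Hrq. reflexivity. }
  destruct (IH (upd f1 r (char_proc (Y r))) Hnodup Hself) as [g [Hg [Hgq [Hgrs Hgother]]]].
  - unfold f1. rewrite upd_neq, upd_eq by auto. reflexivity.
  - intros r' Hr'. destruct (Hrs r' (in_cons _ _ _ Hr')) as [bs' [Hfr' HYr']].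
    exists bs'. split; [|exact HYr'].
    unfold f1. rewrite !upd_neq by (intros ->; contradiction). exact Hfr'.
  - exists g. split; [|split; [exact Hgq|split]].
    + apply config_steps_trans with f1; [exact Hcomm|].
      exact (config_steps_trans Htest Hg).
    + intros r' [<-|Hr']; [|exact (Hgrs _ Hr')].
      rewrite Hgother, upd_eq by auto. reflexivity.
    + intros x Hxq Hxrs. simpl in Hxrs. apply Decidable.not_or in Hxrs.
      destruct Hxrs as [Hxr Hxrs]. rewrite Hgother by assumption.
      unfold f1. rewrite !upd_neq by auto. reflexivity.
Qed.

Lemma forward_steps n T q bs l S U f : q < n -> communicates T q bs -> In (l, S, U) bs ->
  proc_cong (f q) (char_proc (inform l (others n q) (peer n q U))) ->
  peers_at_except n q T f ->
  exists g, config_steps f g /\ g n = f n /\ peers_at n U g.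
Proof.
  intros Hq Hcomm HU Hfq Hf.
  destruct (inform_steps (Y := fun r => peer n r U) (others_NoDup n q) (@others_self n q) Hfq)
    as [g [Hg [Hgq [Hgothers Hgrest]]]].
  - intros r Hr. apply in_others in Hr. destruct Hr as [Hrn Hrq].
    exists (forwarded_branches (peer n r) bs). split; [|apply in_forwarded_branches; eauto].
    rewrite (Hf r) by lia. rewrite peer_config_lt by exact Hrn.
    apply char_proc_head, peer_head_bystander; assumption.
  - exists g. split; [exact Hg|]. split.
    + apply Hgrest; [lia|]. rewrite in_others. lia.
    + intros r Hrn. destruct (Nat.eq_dec r q) as [->|Hrq].
      { rewrite peer_config_lt by exact Hq. exact Hgq. }
      destruct (Nat.lt_ge_cases r n) as [Hlt|Hge].
      * rewrite peer_config_lt by exact Hlt. apply Hgothers, in_others. auto.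
      * rewrite Hgrest by (rewrite ?in_others; lia). rewrite (Hf r Hrn Hrq).
        rewrite !peer_config_ge by exact Hge. reflexivity.
Qed.

Lemma in_round_steps n T T' q bs bs' l S U S' U' f : q < n ->
  headT T (TIn q bs) -> headT T' (TIn q bs') -> In (l, S, U) bs -> In (l, S', U') bs' ->
  proc_cong (f n) (char_proc T) -> peers_at n T' f ->
  exists g, config_steps f g /\
    g n = testing (sample S') S (char_proc U) /\ peers_at n U' g.
Proof.
  intros Hq HT HT' HU HU' Hfn Hf.
  assert (Hfq : proc_cong (f q) (char_proc (peer n q T'))).
  { rewrite <- peer_config_lt by exact Hq. apply Hf. lia. }
  assert (HU'q : In (l, S', inform l (others n q) (peer n q U'))
    (map_cont (fun l U => inform l (others n q) (peer n q U)) bs')).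
  { apply in_map_cont. eauto. }
  destruct (out_steps (peer_head_in n HT') HU'q Hfq) as [f1 [Hf1 [Hf1q Hf1other]]].
  assert (Hf1n : proc_cong (f1 n) (char_proc (TIn q bs))).
  { rewrite Hf1other by lia. rewrite Hfn. apply char_proc_head, HT. }
  pose proof (comm_steps (not_eq_sym (Nat.lt_neq q n Hq)) Hf1n HU Hf1q) as Hcomm.
  set (f2 := upd _ q _) in Hcomm.
  assert (Hf2q : proc_cong (f2 q) (char_proc (inform l (others n q) (peer n q U')))).
  { unfold f2. rewrite upd_eq. reflexivity. }
  assert (Hf2 : peers_at_except n q T' f2).
  { intros r Hrn Hrq. unfold f2. rewrite !upd_neq, Hf1other by assumption. apply Hf, Hrn. }
  destruct (forward_steps Hq (or_introl HT') HU' Hf2q Hf2) as [g [Hg [Hgn Hpeers]]].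
  exists g. split; [|split; [|exact Hpeers]].
  - apply config_steps_trans with f1; [exact Hf1|]. exact (config_steps_trans Hcomm Hg).
  - rewrite Hgn. unfold f2. rewrite upd_neq, upd_eq by lia. reflexivity.
Qed.

Lemma out_round_steps n T T' q bs bs' l S U S' U' f : q < n ->
  headT T (TOut q bs) -> headT T' (TOut q bs') -> In (l, S, U) bs -> In (l, S', U') bs' ->
  proc_cong (f n) (char_proc T) -> peers_at n T' f ->
  exists g, config_steps f g /\ g n = char_proc U /\
    g q = testing (sample S) S' (char_proc (inform l (others n q) (peer n q U'))) /\
    peers_at_except n q T' g.
Proof.
  intros Hq HT HT' HU HU' Hfn Hf.
  destruct (out_steps HT HU Hfn) as [f1 [Hf1 [Hf1n Hf1other]]].
  assert (Hf1q : proc_cong (f1 q) (char_proc (TIn n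
    (map_cont (fun l U => inform l (others n q) (peer n q U)) bs')))).
  { rewrite Hf1other, (Hf q) by lia. rewrite peer_config_lt by exact Hq.
    apply char_proc_head, peer_head_out, HT'. }
  assert (HU'q : In (l, S', inform l (others n q) (peer n q U'))
    (map_cont (fun l U => inform l (others n q) (peer n q U)) bs')).
  { apply in_map_cont. eauto. }
  pose proof (comm_steps (Nat.lt_neq q n Hq) Hf1q HU'q Hf1n) as Hcomm.
  eexists. split; [exact (config_steps_trans Hf1 Hcomm)|]. split; [|split].
  - apply upd_eq.
  - rewrite upd_neq, upd_eq by lia. reflexivity.
  - intros r Hrn Hrq. rewrite !upd_neq, Hf1other by assumption. apply Hf, Hrn.
Qed.

(** * Preciseness *)

(* A participant of shape [sh] cannot play with partners that expect [T]. *)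
Inductive clash (sh : shape) (T : stype) : Prop :=
| clash_end : headT T TEnd -> sh <> ShEnd -> clash sh T
| clash_in q bs l :
    headT T (TIn q bs) -> In l (labels bs) ->
    (forall ls, sh = ShIn q ls -> ~ In l ls) -> clash sh T
| clash_out q bs :
    headT T (TOut q bs) ->
    (forall l, sh = ShOut q l -> ~ In l (labels bs)) -> clash sh T.

Lemma clash_blocked T : session_type T -> clash ShBlocked T.
Proof.
  intros HT. destruct (session_type_head_view HT) as [q bs Hhead Hbs|q bs Hhead Hbs|Hhead].
  - destruct (wf_branches_ex Hbs) as [l [S [U HU]]].
    apply clash_in with q bs l; [exact Hhead|apply in_labels; eauto|discriminate].
  - apply clash_out with q bs; [exact Hhead|discriminate].
  - apply clash_end; [exact Hhead|discriminate].
Qed.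

Lemma peers_at_shape_above n q T f r :
  peers_at_except n q T f -> n < r -> r <> q -> has_shape (f r) ShEnd.
Proof.
  intros Hf Hr Hrq. apply has_shape_cong with PEnd; [|exact has_shape_end].
  rewrite <- (peer_config_ge T (n := n) (r := r)) by lia. symmetry. apply Hf; lia.
Qed.

Lemma peers_at_shape_bystander n q T bs f r : session_type T -> communicates T q bs ->
  peers_at_except n q T f -> r < n -> r <> q -> has_shape (f r) (ShIn q (labels bs)).
Proof.
  intros HT Hcomm Hf Hr Hrq. apply has_shape_cong with (char_proc (peer n r T)).
  - rewrite <- peer_config_lt by exact Hr. symmetry. apply Hf; lia.
  - rewrite <- (labels_forwarded_branches (peer n r)). apply char_proc_shape_in.
    + apply peer_wfT, HT.
    + apply peer_head_bystander; assumption.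
Qed.

Lemma clash_end_gets_stuck n T f sh : headT T TEnd -> sh <> ShEnd ->
  has_shape (f n) sh -> peers_at n T f -> config_gets_stuck f.
Proof.
  intros Hhead Hsh Hn Hf. exists f. split; [constructor|].
  apply config_stuck_shapes with (fun r => if r =? n then sh else ShEnd).
  - intros r. destruct (Nat.eqb_spec r n) as [->|Hrn]; [exact Hn|].
    apply has_shape_cong with (peer_config n T r); [symmetry; apply Hf, Hrn|].
    unfold peer_config. destruct (r <? n); [|exact has_shape_end].
    apply char_proc_shape_end, (peer_head n _ Hhead).
  - intros a b ls l Hab Ha Hb.
    destruct (Nat.eqb_spec a n), (Nat.eqb_spec b n); congruence.
  - exists n. rewrite Nat.eqb_refl. exact Hsh.
Qed.

Lemma clash_in_gets_stuck n T q bs l f sh : session_type T -> q < n ->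
  headT T (TIn q bs) -> In l (labels bs) -> (forall ls, sh = ShIn q ls -> ~ In l ls) ->
  has_shape (f n) sh -> peers_at n T f -> config_gets_stuck f.
Proof.
  intros HT Hq Hhead Hl Hsh Hn Hf. apply in_labels in Hl. destruct Hl as [S [U HU]].
  assert (Hfq : proc_cong (f q) (char_proc (peer n q T))).
  { rewrite <- peer_config_lt by exact Hq. apply Hf. lia. }
  assert (Hshq : type_shape (peer n q T) (ShOut n l)).
  { eapply ts_out; [apply peer_head_in, Hhead|apply in_map_cont; eauto]. }
  destruct (settle_steps (peer_wfT n q HT) Hshq Hfq) as [g [Hg [Hgq Hgother]]].
  assert (Hpeers : peers_at_except n q T g).
  { intros r Hrn Hrq. rewrite Hgother by exact Hrq. apply Hf, Hrn. }
  exists g. split; [exact Hg|].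
  apply standoff_stuck with (n := n) (q := q) (ls := labels bs) (shn := sh) (shq := ShOut n l);
    try (exact Hq || discriminate).
  - rewrite Hgother by lia. exact Hn.
  - exact Hgq.
  - intros r. exact (peers_at_shape_bystander HT (or_introl Hhead) Hpeers).
  - intros r Hr. apply (peers_at_shape_above Hpeers Hr). lia.
  - intros r l' Heq. injection Heq as <- <-. auto.
Qed.

Lemma clash_out_gets_stuck n T q bs f sh : session_type T -> q < n ->
  headT T (TOut q bs) -> (forall l, sh = ShOut q l -> ~ In l (labels bs)) ->
  has_shape (f n) sh -> peers_at n T f -> config_gets_stuck f.
Proof.
  intros HT Hq Hhead Hsh Hn Hf. exists f. split; [constructor|].
  pose proof (peers_at_except_of (q := q) Hf) as Hpeers.
  apply standoff_stuck
    with (n := n) (q := q) (ls := labels bs) (shn := sh) (shq := ShIn n (labels bs));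
    try (exact Hq || discriminate).
  - exact Hn.
  - apply has_shape_cong with (char_proc (peer n q T)).
    { rewrite <- peer_config_lt by exact Hq. symmetry. apply Hf. lia. }
    erewrite <- labels_map_cont. apply char_proc_shape_in; [apply peer_wfT, HT|].
    apply peer_head_out, Hhead.
  - intros r. exact (peers_at_shape_bystander HT (or_intror Hhead) Hpeers).
  - intros r Hr. apply (peers_at_shape_above Hpeers Hr). lia.
  - intros l ls Heq. injection Heq as <-. auto.
Qed.

Lemma clash_gets_stuck n T f sh : session_type T -> below n T -> clash sh T ->
  has_shape (f n) sh -> peers_at n T f -> config_gets_stuck f.
Proof.
  intros HT Hbelow Hclash. destruct Hclash as [Hhead Hsh|q bs l Hhead Hl Hsh|q bs Hhead Hsh].
  - exact (clash_end_gets_stuck Hhead Hsh).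
  - exact (clash_in_gets_stuck HT (communicates_lt Hbelow (or_introl Hhead)) Hhead Hl Hsh).
  - exact (clash_out_gets_stuck HT (communicates_lt Hbelow (or_intror Hhead)) Hhead Hsh).
Qed.

Inductive not_subtype : stype -> stype -> Prop :=
| nsub_clash T T' sh : type_shape T sh -> clash sh T' -> not_subtype T T'
| nsub_in_sort T T' q bs bs' l S U S' U' :
    headT T (TIn q bs) -> headT T' (TIn q bs') ->
    In (l, S, U) bs -> In (l, S', U') bs' -> ~ subsort S' S -> not_subtype T T'
| nsub_in_cont T T' q bs bs' l S U S' U' :
    headT T (TIn q bs) -> headT T' (TIn q bs') ->
    In (l, S, U) bs -> In (l, S', U') bs' -> subsort S' S -> not_subtype U U' ->
    not_subtype T T'
| nsub_out_sort T T' q bs bs' l S U S' U' :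
    headT T (TOut q bs) -> headT T' (TOut q bs') ->
    In (l, S, U) bs -> In (l, S', U') bs' -> ~ subsort S S' -> not_subtype T T'
| nsub_out_cont T T' q bs bs' l S U S' U' :
    headT T (TOut q bs) -> headT T' (TOut q bs') ->
    In (l, S, U) bs -> In (l, S', U') bs' -> subsort S S' -> not_subtype U U' ->
    not_subtype T T'.

Inductive matching_heads (T T' : stype) : Prop :=
| matching_end : headT T TEnd -> headT T' TEnd -> matching_heads T T'
| matching_in q bs bs' :
    headT T (TIn q bs) -> headT T' (TIn q bs') -> incl (labels bs') (labels bs) ->
    matching_heads T T'
| matching_out q bs bs' :
    headT T (TOut q bs) -> headT T' (TOut q bs') -> incl (labels bs) (labels bs') ->
    matching_heads T T'.

Lemma incl_or_not_in (ls ls' : list label) :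
  incl ls ls' \/ exists l, In l ls /\ ~ In l ls'.
Proof.
  destruct (Forall_Exists_dec (fun l => In l ls') (fun l => in_dec Nat.eq_dec l ls') ls)
    as [Hincl|Hnot_in].
  - left. apply incl_Forall_in_iff, Hincl.
  - right. apply Exists_exists, Hnot_in.
Qed.

Definition clashing (T T' : stype) : Prop := exists sh, type_shape T sh /\ clash sh T'.

Lemma matching_or_clashing_in T T' q' bs' : session_type T ->
  headT T' (TIn q' bs') -> wf_branches 0 bs' -> matching_heads T T' \/ clashing T T'.
Proof.
  intros HT Hhead' Hbs'. destruct (wf_branches_ex Hbs') as [l0 [S0 [U0 HU0]]].
  assert (Hl0 : In l0 (labels bs')) by (apply in_labels; eauto).
  assert (Hclash : forall sh, type_shape T sh -> (forall ls, sh <> ShIn q' ls) ->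
    clashing T T').
  { intros sh Hsh Hne. exists sh. split; [exact Hsh|].
    apply clash_in with q' bs' l0; [assumption..|]. intros ls Hls. contradiction (Hne ls). }
  destruct (type_shape_exists HT) as [sh Hsh].
  inversion Hsh as [Hhead|q bs Hhead|q bs l S U Hhead HU]; subst;
    try (right; apply (Hclash _ Hsh); discriminate).
  destruct (Nat.eq_dec q q') as [->|Hqq']; [|right; apply (Hclash _ Hsh); congruence].
  destruct (incl_or_not_in (labels bs') (labels bs)) as [Hincl|[l [Hl' Hl]]].
  - left. eapply matching_in; eauto.
  - right. exists (ShIn q' (labels bs)). split; [exact Hsh|].
    apply clash_in with q' bs' l; [assumption..|].
    intros ls Hls. injection Hls as <-. exact Hl.
Qed.

Lemma matching_or_clashing_out T T' q' bs' : session_type T ->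
  headT T' (TOut q' bs') -> matching_heads T T' \/ clashing T T'.
Proof.
  intros HT Hhead'.
  assert (Hclash : forall sh, type_shape T sh -> (forall l, sh <> ShOut q' l) ->
    clashing T T').
  { intros sh Hsh Hne. exists sh. split; [exact Hsh|].
    apply clash_out with q' bs'; [assumption|]. intros l Hl. contradiction (Hne l). }
  destruct (type_shape_exists HT) as [sh Hsh].
  inversion Hsh as [Hhead|q bs Hhead|q bs l S U Hhead HU]; subst;
    try (right; apply (Hclash _ Hsh); discriminate).
  destruct (Nat.eq_dec q q') as [->|Hqq']; [|right; apply (Hclash _ Hsh); congruence].
  destruct (incl_or_not_in (labels bs) (labels bs')) as [Hincl|[l1 [Hl1 Hl1']]].
  - left. eapply matching_out; eauto.
  - apply in_labels in Hl1. destruct Hl1 as [S1 [U1 HU1]].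
    right. exists (ShOut q' l1). split; [eapply ts_out; eauto|].
    apply clash_out with q' bs'; [assumption|]. intros l' Heq. injection Heq as <-. exact Hl1'.
Qed.

Lemma matching_or_clashing T T' : session_type T -> session_type T' ->
  matching_heads T T' \/ clashing T T'.
Proof.
  intros HT HT'.
  destruct (session_type_head_view HT') as [q' bs' Hhead' Hbs'|q' bs' Hhead' _|Hhead'].
  - eapply matching_or_clashing_in; eauto.
  - eapply matching_or_clashing_out; eauto.
  - destruct (type_shape_exists HT) as [sh Hsh].
    inversion Hsh as [Hhead|q bs Hhead|q bs l S U Hhead HU]; subst;
      [left; apply matching_end; assumption|..];
      right; eexists; (split; [exact Hsh|apply clash_end; [assumption|discriminate]]).
Qed.

Lemma not_subtype_complete T T' : session_type T -> session_type T' ->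
  ~ not_subtype T T' -> subtype T T'.
Proof.
  revert T T'. cofix CH. intros T T' HT HT' Hnot.
  destruct (matching_or_clashing HT HT') as [Hmatch|[sh [Hsh Hclash]]];
    [|destruct Hnot; exact (nsub_clash Hsh Hclash)].
  destruct Hmatch as [Hhead Hhead'|q bs bs' Hhead Hhead' Hincl|q bs bs' Hhead Hhead' Hincl].
  - apply sub_end; assumption.
  - apply sub_in with q bs bs'; [assumption..|]. intros l S' U' HU'.
    assert (Hl : In l (labels bs)) by (apply Hincl, in_labels; eauto).
    apply in_labels in Hl. destruct Hl as [S [U HU]]. exists S, U. split; [exact HU|].
    destruct (subsort_dec S' S) as [HS|HS];
      [|destruct Hnot; exact (nsub_in_sort Hhead Hhead' HU HU' HS)].
    split; [exact HS|]. apply CH.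
    + exact (wf_branches_cont (headT_in_wf HT Hhead) HU).
    + exact (wf_branches_cont (headT_in_wf HT' Hhead') HU').
    + intros HUU'. apply Hnot.
      exact (nsub_in_cont Hhead Hhead' HU HU' HS HUU').
  - apply sub_out with q bs bs'; [assumption..|]. intros l S U HU.
    assert (Hl : In l (labels bs')) by (apply Hincl, in_labels; eauto).
    apply in_labels in Hl. destruct Hl as [S' [U' HU']]. exists S', U'. split; [exact HU'|].
    destruct (subsort_dec S S') as [HS|HS];
      [|destruct Hnot; exact (nsub_out_sort Hhead Hhead' HU HU' HS)].
    split; [exact HS|]. apply CH.
    + exact (wf_branches_cont (headT_out_wf HT Hhead) HU).
    + exact (wf_branches_cont (headT_out_wf HT' Hhead') HU').
    + intros HUU'. apply Hnot.
      exact (nsub_out_cont Hhead Hhead' HU HU' HS HUU').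
Qed.

Lemma in_sort_gets_stuck n T T' q bs bs' l S U S' U' f :
  session_type T -> session_type T' -> below n T' ->
  headT T (TIn q bs) -> headT T' (TIn q bs') -> In (l, S, U) bs -> In (l, S', U') bs' ->
  ~ subsort S' S -> proc_cong (f n) (char_proc T) -> peers_at n T' f ->
  config_gets_stuck f.
Proof.
  intros HT HT' Hbelow Hhead Hhead' HU HU' HS Hn Hf.
  pose proof (communicates_lt Hbelow (or_introl Hhead')) as Hq.
  destruct (in_round_steps Hq Hhead Hhead' HU HU' Hn Hf) as [g [Hg [Hgn Hpeers]]].
  pose proof (wf_branches_cont (headT_in_wf HT Hhead) HU) as HUwf.
  pose proof (wf_branches_cont (headT_in_wf HT' Hhead') HU') as HUwf'.
  pose proof (communicates_below Hbelow (or_introl Hhead') HU') as HUbelow.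
  apply (config_steps_gets_stuck Hg).
  apply (clash_gets_stuck HUwf' HUbelow (clash_blocked HUwf')); [|exact Hpeers].
  rewrite Hgn. exact (testing_blocked HS (char_proc_guardedP HUwf)).
Qed.

Lemma out_sort_gets_stuck n T T' q bs bs' l S U S' U' f :
  session_type T -> session_type T' -> q < n ->
  headT T (TOut q bs) -> headT T' (TOut q bs') -> In (l, S, U) bs -> In (l, S', U') bs' ->
  ~ subsort S S' -> proc_cong (f n) (char_proc T) -> peers_at n T' f ->
  config_gets_stuck f.
Proof.
  intros HT HT' Hq Hhead Hhead' HU HU' HS Hn Hf.
  destruct (out_round_steps Hq Hhead Hhead' HU HU' Hn Hf) as [g [Hg [Hgn [Hgq Hpeers]]]].
  assert (HUwf : session_type U).
  { exact (wf_branches_cont (headT_out_wf HT Hhead) HU). }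
  assert (HUwf' : session_type U').
  { exact (wf_branches_cont (headT_out_wf HT' Hhead') HU'). }
  destruct (type_shape_exists HUwf) as [sh Hsh].
  assert (Hgn_cong : proc_cong (g n) (char_proc U)) by (rewrite Hgn; reflexivity).
  destruct (settle_steps HUwf Hsh Hgn_cong) as [h [Hh [Hhn Hhother]]].
  exists h. split; [exact (config_steps_trans Hg Hh)|].
  apply standoff_stuck
    with (n := n) (q := q) (ls := labels bs') (shn := sh) (shq := ShBlocked);
    try (assumption || discriminate).
  - rewrite Hhother, Hgq by lia. apply testing_blocked; [exact HS|].
    apply (char_proc_guardedP (k := 0)), wfT_inform, peer_wfT, HUwf'.
  - intros r Hr Hrq. rewrite Hhother by lia.
    exact (peers_at_shape_bystander HT' (or_intror Hhead') Hpeers Hr Hrq).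
  - intros r Hr. rewrite Hhother by lia.
    apply (peers_at_shape_above Hpeers Hr). lia.
Qed.

Lemma in_subsort_steps n T T' q bs bs' l S U S' U' f : q < n ->
  headT T (TIn q bs) -> headT T' (TIn q bs') -> In (l, S, U) bs -> In (l, S', U') bs' ->
  subsort S' S -> proc_cong (f n) (char_proc T) -> peers_at n T' f ->
  exists g, config_steps f g /\ g n = char_proc U /\ peers_at n U' g.
Proof.
  intros Hq Hhead Hhead' HU HU' HS Hn Hf.
  destruct (in_round_steps Hq Hhead Hhead' HU HU' Hn Hf) as [g [Hg [Hgn Hpeers]]].
  assert (Htest : config_steps g (upd g n (char_proc U))).
  { apply test_steps with (sample S') S; [|rewrite Hgn; reflexivity].
    exact (value_sort_subsort (sample_value_sort S') HS). }
  exists (upd g n (char_proc U)).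
  split; [exact (config_steps_trans Hg Htest)|split; [apply upd_eq|]].
  intros r Hr. rewrite upd_neq by exact Hr. apply Hpeers, Hr.
Qed.

Lemma out_subsort_steps n T T' q bs bs' l S U S' U' f : q < n ->
  headT T (TOut q bs) -> headT T' (TOut q bs') -> In (l, S, U) bs -> In (l, S', U') bs' ->
  subsort S S' -> proc_cong (f n) (char_proc T) -> peers_at n T' f ->
  exists g, config_steps f g /\ g n = char_proc U /\ peers_at n U' g.
Proof.
  intros Hq Hhead Hhead' HU HU' HS Hn Hf.
  destruct (out_round_steps Hq Hhead Hhead' HU HU' Hn Hf) as [g [Hg [Hgn [Hgq Hpeers]]]].
  set (g1 := upd g q (char_proc (inform l (others n q) (peer n q U')))).
  assert (Htest : config_steps g g1).
  { apply test_steps with (sample S) S'; [|rewrite Hgq; reflexivity].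
    exact (value_sort_subsort (sample_value_sort S) HS). }
  assert (Hg1q : proc_cong (g1 q) (char_proc (inform l (others n q) (peer n q U')))).
  { unfold g1. rewrite upd_eq. reflexivity. }
  assert (Hg1 : peers_at_except n q T' g1).
  { intros r Hrn Hrq. unfold g1. rewrite upd_neq by exact Hrq. apply Hpeers; assumption. }
  destruct (forward_steps Hq (or_intror Hhead') HU' Hg1q Hg1) as [h [Hh [Hhn Hhpeers]]].
  exists h. split; [|split; [|exact Hhpeers]].
  - exact (config_steps_trans Hg (config_steps_trans Htest Hh)).
  - rewrite Hhn. unfold g1. rewrite upd_neq by lia. exact Hgn.
Qed.

Lemma not_subtype_gets_stuck n T T' : not_subtype T T' ->
  session_type T -> session_type T' -> below n T' -> forall f,
  proc_cong (f n) (char_proc T) -> peers_at n T' f -> config_gets_stuck f.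
Proof.
  induction 1 as [T T' sh Hsh Hclash|T T' q bs bs' l S U S' U' Hhead Hhead' HU HU' HS
    |T T' q bs bs' l S U S' U' Hhead Hhead' HU HU' HS _ IH
    |T T' q bs bs' l S U S' U' Hhead Hhead' HU HU' HS
    |T T' q bs bs' l S U S' U' Hhead Hhead' HU HU' HS _ IH]; intros HT HT' Hbelow f Hn Hf;
    try (assert (Hcomm' : communicates T' q bs') by (left + right; exact Hhead');
      assert (Hcomm : communicates T q bs) by (left + right; exact Hhead);
      pose proof (communicates_lt Hbelow Hcomm') as Hq).
  - destruct (settle_steps HT Hsh Hn) as [g [Hg [Hgn Hgother]]].
    apply (config_steps_gets_stuck Hg), (clash_gets_stuck HT' Hbelow Hclash Hgn).
    intros r Hr. rewrite Hgother by exact Hr. apply Hf, Hr.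
  - exact (in_sort_gets_stuck HT HT' Hbelow Hhead Hhead' HU HU' HS Hn Hf).
  - destruct (in_subsort_steps Hq Hhead Hhead' HU HU' HS Hn Hf) as [g [Hg [Hgn Hpeers]]].
    apply (config_steps_gets_stuck Hg), IH; [..|rewrite Hgn; reflexivity|exact Hpeers].
    + exact (wf_branches_cont (communicates_wf HT Hcomm) HU).
    + exact (wf_branches_cont (communicates_wf HT' Hcomm') HU').
    + exact (communicates_below Hbelow Hcomm' HU').
  - exact (out_sort_gets_stuck HT HT' Hq Hhead Hhead' HU HU' HS Hn Hf).
  - destruct (out_subsort_steps Hq Hhead Hhead' HU HU' HS Hn Hf) as [g [Hg [Hgn Hpeers]]].
    apply (config_steps_gets_stuck Hg), IH; [..|rewrite Hgn; reflexivity|exact Hpeers].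
    + exact (wf_branches_cont (communicates_wf HT Hcomm) HU).
    + exact (wf_branches_cont (communicates_wf HT' Hcomm') HU').
    + exact (communicates_below Hbelow Hcomm' HU').
Qed.

Fixpoint session_upto (n : nat) (f : config) : session :=
  match n with
  | 0 => SProc 0 (f 0)
  | S m => SPar (SProc (S m) (f (S m))) (session_upto m f)
  end.

Lemma in_session_upto n f r P :
  In (r, P) (parties (session_upto n f)) <-> r <= n /\ P = f r.
Proof.
  induction n as [|n IH]; simpl.
  - split.
    + intros [Heq|[]]. injection Heq as <- <-. auto.
    + intros [Hr ->]. left. replace r with 0 by lia. reflexivity.
  - rewrite IH. split.
    + intros [Heq|[Hr ->]]; [injection Heq as <- <-; auto|split; [lia|reflexivity]].
    + intros [Hr ->]. destruct (Nat.eq_dec r (S n)) as [->|Hrn]; [auto|].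
      right. split; [lia|reflexivity].
Qed.

Lemma names_session_upto n f r : In r (map fst (parties (session_upto n f))) <-> r <= n.
Proof.
  rewrite in_map_fst. setoid_rewrite in_session_upto. split; [intros [P [Hr _]]|]; eauto.
Qed.

Lemma session_upto_NoDup n f : NoDup (map fst (parties (session_upto n f))).
Proof.
  induction n as [|n IH]; simpl; constructor; auto using NoDup_nil.
  rewrite names_session_upto. lia.
Qed.

Lemma session_upto_guardedS n f :
  (forall r, r <= n -> guardedP (f r)) -> guardedS (session_upto n f).
Proof. induction n; simpl; intros Hf; auto. Qed.

Lemma session_upto_hosts n f :
  (forall r, n < r -> proc_cong (f r) PEnd) -> hosts (parties (session_upto n f)) f.
Proof.
  intros Hend. assert (Hg : forall g, (forall r, r <= n -> proc_cong (f r) (g r)) ->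
    (forall r, n < r -> proc_cong (g r) PEnd) -> hosts (parties (session_upto n f)) g).
  { clear Hend. induction n as [|n IH]; intros g Hfg Hend; apply hosts_cons; auto.
    - split; [constructor|]. intros r. symmetry. destruct r; [reflexivity|].
      apply Hend. lia.
    - apply IH; intros r Hr; unfold upd; destruct (Nat.eqb_spec r (S n)).
      + lia.
      + apply Hfg. lia.
      + reflexivity.
      + apply Hend. lia. }
  apply Hg; [reflexivity|exact Hend].
Qed.

Definition char_session (m : nat) (T : stype) (P : proc) : session :=
  SPar (SProc (S m) P) (session_upto m (peer_config (S m) T)).

Lemma char_session_hosts m T P :
  hosts (parties (char_session m T P)) (upd (peer_config (S m) T) (S m) P).
Proof.
  apply hosts_cons; [rewrite upd_eq; reflexivity|].
  apply hosts_cong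
    with (L := parties (session_upto m (peer_config (S m) T))) (f := peer_config (S m) T).
  - reflexivity.
  - intros r. unfold upd. destruct (Nat.eqb_spec r (S m)) as [->|Hr]; [|reflexivity].
    rewrite peer_config_ge by lia. reflexivity.
  - apply session_upto_hosts. intros r Hr. rewrite peer_config_ge by lia. reflexivity.
Qed.

Lemma char_session_typed m T Q : session_type T -> below (S m) T -> has_type [] [] Q T ->
  typed_session (char_session m T Q) (char_global (S m) T).
Proof.
  intros HT Hbelow HQ. split; [apply char_global_wfG; assumption|]. simpl.
  split; [|split].
  - constructor; [rewrite names_session_upto; lia|apply session_upto_NoDup].
  - intros p P [Heq|HP].
    + injection Heq as <- <-. exists T. split; [|exact HQ].
      pose proof (char_global_proj HT Hbelow (Nat.lt_0_succ m) (le_n _)) as Hproj.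
      rewrite Nat.eqb_refl in Hproj. exact Hproj.
    + apply in_session_upto in HP. destruct HP as [Hp ->].
      exists (peer (S m) p T). rewrite peer_config_lt by lia.
      split; [|apply has_type_char_proc, peer_wfT, HT].
      pose proof (char_global_proj (r := p) HT Hbelow (Nat.lt_0_succ m)) as Hproj.
      destruct (Nat.eqb_spec p (S m)); [lia|]. apply Hproj. lia.
  - intros r Hr. rewrite names_session_upto.
    assert (Hle : r <= S m); [|lia].
    apply (char_global_pt_le Hr (q := 0) (l := 0) (rs := []) (T := T) eq_refl).
    apply informing_nil; [exact HT|exact Hbelow|lia].
Qed.

Lemma char_session_gets_stuck m T T' : not_subtype T T' ->
  session_type T -> session_type T' -> below (S m) T' ->
  gets_stuck (char_session m T' (char_proc T)).
Proof.
  intros Hnot HT HT' Hbelow.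
  apply (gets_stuck_iff_config_gets_stuck (char_session_hosts m T' (char_proc T))).
  apply (not_subtype_gets_stuck Hnot HT HT' Hbelow).
  - rewrite upd_eq. reflexivity.
  - intros r Hr. rewrite upd_neq by exact Hr. reflexivity.
Qed.

Theorem mainTheorem1 (T T' : stype)
    (hT : session_type T) (hT' : session_type T') :
  subtype T T' <->
  ~ (exists (P : proc) (p : participant) (M : session),
       guardedP P /\ guardedS M /\
       has_type [] [] P T /\
       (forall Q : proc, guardedP Q -> has_type [] [] Q T' ->
          exists G : gtype, typed_session (SPar (SProc p Q) M) G) /\
       gets_stuck (SPar (SProc p P) M)).
Proof.
  split.
  - intros Hsub [P [p [M [HP [HM [HPT [Htyped Hstuck]]]]]]].
    destruct (Htyped P HP) as [G HG]; [eapply ht_sub; eauto|].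
    exact (typed_session_safe (M := SPar (SProc p P) M) (conj HP HM) HG Hstuck).
  - intros Hsafe. apply (not_subtype_complete hT hT'). intros Hnot. apply Hsafe.
    destruct (below_exists T') as [m Hm].
    assert (Hbelow : below (S m) T') by (apply below_weaken with m; auto).
    exists (char_proc T), (S m), (session_upto m (peer_config (S m) T')).
    split; [|split; [|split; [|split]]].
    + exact (char_proc_guardedP hT).
    + apply session_upto_guardedS. intros r Hr. rewrite peer_config_lt by lia.
      apply (char_proc_guardedP (k := 0)), peer_wfT, hT'.
    + apply has_type_char_proc, hT.
    + intros Q _ HQ. exists (char_global (S m) T'). apply char_session_typed; assumption.
    + exact (char_session_gets_stuck Hnot hT hT' Hbelow).
Qed.
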